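(* Let $(\mathcal H,\nabla^{\mathcal H},\bar{\ },(\,,\,),\mathcal F)$ be a polarized variation of $\mathbb R$-Hodge structure of weight one over a complex manifold $S$, let $\mathbb F(\mathcal H,\mathcal F)$ be the associated bundle of Fock spaces with its inner product, let $\sigma$ be the second fundamental form of $\mathcal F\subset\mathcal H$, and let $s$, $\bar s$ be the associated $1$-forms with values in the symmetric parts of $\mathcal F\otimes\mathcal F$ and $\bar{\mathcal F}\otimes\bar{\mathcal F}$. Then the connection $$\nabla^{\mathbb F}:=\nabla^{\bar{\mathcal F}}+\rho(s+\bar s)$$ in $\mathbb F(\mathcal H,\mathcal F)$ is unitary, and its curvature is equal to the scalar $2$-form $-\tfrac12\operatorname{trace}(\bar\sigma\wedge\sigma)$, which is also half the curvature of the connection that $\nabla^{\mathcal F}$ induces on the determinant line bundle $\det(\mathcal F)$. In particular, $\nabla^{\mathbb F}$ is projectively flat.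
   Context: Fock space. Let $H$ be a finite dimensional complex vector space with a nondegenerate antisymmetric form $(\,,\,)$. The Heisenberg Lie algebra is $\hat H=H\oplus\mathbb C\hbar$ with $[a+\lambda\hbar,b+\mu\hbar]=(a,b)\hbar$; the product in its universal enveloping algebra $U\hat H$ is written $\circ$. For a maximal isotropic subspace $F\subset H$, put $\hat F=F\oplus\mathbb C\hbar$ and $\mathbb F(H,F):=U\hat H\otimes_{U\hat F}\mathbb C$, where $\hat F$ acts on $\mathbb C$ by the character $f+\lambda\hbar\mapsto\lambda$. Let $v_o$ be the image of $1\otimes1$ and $\rho:U\hat H\to\operatorname{End}(\mathbb F(H,F))$ the action; for $a,b\in H$ we put $\rho(a\otimes b)=\rho(a)\rho(b)$. Polarized case. Suppose $H$ has an anti-linear involution $a\mapsto\bar a$ with $\overline{(a,b)}=(\bar a,\bar b)$ and that $\sqrt{-1}(a,\bar a)>0$ for all nonzero $a\in F$. Then $\bar F$ is an isotropic complement of $F$, and the natural map $\operatorname{Sym}_\bullet\bar F\to\mathbb F(H,F)$, $x_1\cdots x_k\mapsto x_1\circ\cdots\circ x_k\circ v_o$, is an isomorphism. On $\bar F$ put $\langle\bar z,\bar w\rangle:=\sqrt{-1}(w,\bar z)$ ($z,w\in F$), and on $\operatorname{Sym}_\bullet\bar F\cong\mathbb F(H,F)$ put $\langle\bar z_1\cdots\bar z_n,\bar w_1\cdots\bar w_m\rangle=\sum_{\pi\in\mathcal S_n}\prod_{i=1}^n\langle\bar z_i,\bar w_{\pi(i)}\rangle$ if $m=n$ and $0$ otherwise.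 Variation. A polarized variation of $\mathbb R$-Hodge structure of weight one over $S$ consists of a complex vector bundle $\mathcal H$ with flat connection $\nabla^{\mathcal H}$, a flat anti-linear involution $\bar{\ }$ on $\mathcal H$, a flat symplectic form $(\,,\,)$ on $\mathcal H$ real relative to $\bar{\ }$, and a holomorphic subbundle $\mathcal F\subset\mathcal H$ (for the holomorphic structure on $\mathcal H$ whose flat local sections are holomorphic), such that in every fiber one has the polarized situation above. The Fock spaces of the fibers form the bundle $\mathbb F(\mathcal H,\mathcal F)\cong\operatorname{Sym}_\bullet(\bar{\mathcal F})$ with inner product. The second fundamental form $\sigma$ is the $1$-form with values in $\operatorname{Hom}(\mathcal F,\bar{\mathcal F})$ that sends a local section $a$ of $\mathcal F$ to the projection of $\nabla^{\mathcal H}(a)$ to $\bar{\mathcal F}$ along $\mathcal F$. Its complex conjugate $\bar\sigma$, $\bar\sigma(x)=\overline{\sigma(\bar x)}$, is the second fundamental form of $\bar{\mathcal F}$, with values in $\operatorname{Hom}(\bar{\mathcal F},\mathcal F)$. Let $E_{\bar{\mathcal F}}:\bar{\mathcal F}\otimes\bar{\mathcal F}\to\operatorname{Hom}(\mathcal F,\bar{\mathcal F})$, $E_{\bar{\mathcal F}}(\bar a\otimes\bar b)(x)=2\bar a(\bar b,x)$, and $E_{\mathcal F}:\mathcal F\otimes\mathcal F\to\operatorname{Hom}(\bar{\mathcal F},\mathcal F)$, $E_{\mathcal F}(a\otimes b)(x)=2a(b,x)$. Then $\bar s:=E_{\bar{\mathcal F}}^{-1}(\sigma)$ and $s:=E_{\mathcal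 F}^{-1}(\bar\sigma)$; these are complex conjugate $1$-forms with values in symmetric tensors. $\nabla^{\mathcal F}$ is the connection on $\mathcal F$ given by $\nabla^{\mathcal H}$ followed by projection onto $\mathcal F$ along $\bar{\mathcal F}$; $\nabla^{\bar{\mathcal F}}$ is defined likewise on $\bar{\mathcal F}$, and is extended by the Leibniz rule to $\operatorname{Sym}_\bullet(\bar{\mathcal F})\cong\mathbb F(\mathcal H,\mathcal F)$. The wedge product of endomorphism-valued $1$-forms is composed with composition: $(X\wedge Y)(v,w)=X(v)Y(w)-X(w)Y(v)$. *)

(* Defs.v *)
From HB Require Import structures.
From mathcomp Require Import all_boot all_order all_algebra.
From mathcomp Require Import perm complex.
From mathcomp Require Import all_classical all_reals all_analysis.
(* monalg's notations clash with those of mathcomp-analysis. *)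
From mathcomp Require Import -(notations) monalg.

Set Implicit Arguments.
Unset Strict Implicit.
Unset Printing Implicit Defensive.

Import Order.TTheory GRing.Theory Num.Theory.
Import numFieldNormedType.Exports.
Import quotient.

Local Open Scope classical_set_scope.
Local Open Scope ring_scope.
Local Open Scope quotient_scope.

Section ModuleQuotient.
Context {K : nzRingType} {V : lmodType K}.
Implicit Types (G P : set V).

Definition submodule P := P 0 /\ forall k u v, P u -> P v -> P (k *: u + v).

Definition lspan G : set V :=
  [set v | forall P, submodule P -> G `<=` P -> P v].

Lemma lspan0 G : lspan G 0.
Proof. by move=> P []. Qed.

Lemma lspanP G k u v : lspan G u -> lspan G v -> lspan G (k *: u + v).
Proof.
move=> Gu Gv P sP GP; case: (sP) => _; apply; [exact: Gu|exact: Gv].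
Qed.

Lemma lspanD G u v : lspan G u -> lspan G v -> lspan G (u + v).
Proof. by move=> Gu Gv; rewrite -[u]scale1r; apply: lspanP. Qed.

Lemma lspanZ G k u : lspan G u -> lspan G (k *: u).
Proof.
by move=> Gu; rewrite -[_ *: _]addr0; apply: lspanP => //; apply: lspan0.
Qed.

Lemma lspanN G u : lspan G u -> lspan G (- u).
Proof. by rewrite -scaleN1r; apply: lspanZ. Qed.

Context (G : set V).

Definition lquot_rel (u v : V) : bool := `[< lspan G (u - v) >].

Lemma lquot_rel_refl : reflexive lquot_rel.
Proof. by move=> u; apply/asboolP; rewrite subrr; apply: lspan0. Qed.

Lemma lquot_rel_sym : symmetric lquot_rel.
Proof.
by move=> u v; apply/asboolP/asboolP => /lspanN; rewrite opprB.
Qed.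

Lemma lquot_rel_trans : transitive lquot_rel.
Proof.
move=> v u w /asboolP uv /asboolP vw; apply/asboolP.
by rewrite -[u](subrK v) -addrA; apply: lspanD.
Qed.

Canonical lquot_equiv :=
  EquivRel lquot_rel lquot_rel_refl lquot_rel_sym lquot_rel_trans.

Definition lquot := {eq_quot lquot_equiv}%qT.

HB.instance Definition _ : EqQuotient _ lquot_equiv lquot :=
  EqQuotient.on lquot.
HB.instance Definition _ := Choice.on lquot.

Lemma lquot_eqP u v : (\pi_lquot u = \pi_lquot v) <-> lspan G (u - v).
Proof.
split=> [/eqP|uv]; first by rewrite eqmodE => /asboolP.
by apply/eqP; rewrite eqmodE; apply/asboolP.
Qed.

Lemma lspan_repr u : lspan G (u - repr (\pi_lquot u)).
Proof. by apply/lquot_eqP; rewrite reprK. Qed.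

Definition lquot_add (x y : lquot) : lquot := \pi_lquot (repr x + repr y).
Definition lquot_opp (x : lquot) : lquot := \pi_lquot (- repr x).
Definition lquot_scale (k : K) (x : lquot) : lquot := \pi_lquot (k *: repr x).

Lemma lquot_piD u v : \pi_lquot (u + v) = lquot_add (\pi_lquot u) (\pi_lquot v).
Proof. by apply/lquot_eqP; rewrite opprD addrACA; apply: lspanD; apply: lspan_repr. Qed.

Lemma lquot_piN u : \pi_lquot (- u) = lquot_opp (\pi_lquot u).
Proof. by apply/lquot_eqP; rewrite -opprD; apply: lspanN; apply: lspan_repr. Qed.

Lemma lquot_piZ k u : \pi_lquot (k *: u) = lquot_scale k (\pi_lquot u).
Proof. by apply/lquot_eqP; rewrite -scalerBr; apply: lspanZ; apply: lspan_repr. Qed.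

Lemma lquot_addA : associative lquot_add.
Proof.
move=> x y z.
elim/(@quotW _ lquot): x => x; elim/(@quotW _ lquot): y => y; elim/(@quotW _ lquot): z => z.
by rewrite -!lquot_piD addrA.
Qed.

Lemma lquot_addC : commutative lquot_add.
Proof. by move=> x y; elim/(@quotW _ lquot): x => x; elim/(@quotW _ lquot): y => y; rewrite -!lquot_piD addrC. Qed.

Lemma lquot_add0 : left_id (\pi_lquot 0) lquot_add.
Proof. by move=> x; elim/(@quotW _ lquot): x => x; rewrite -lquot_piD add0r. Qed.

Lemma lquot_addN : left_inverse (\pi_lquot 0) lquot_opp lquot_add.
Proof. by move=> x; elim/(@quotW _ lquot): x => x; rewrite -lquot_piN -lquot_piD addNr. Qed.

HB.instance Definition _ := GRing.isZmodule.Build lquot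
  lquot_addA lquot_addC lquot_add0 lquot_addN.

Lemma lquot_scaleA a b x :
  lquot_scale a (lquot_scale b x) = lquot_scale (a * b) x.
Proof. by elim/(@quotW _ lquot): x => x; rewrite -!lquot_piZ scalerA. Qed.

Lemma lquot_scale1 : left_id 1 lquot_scale.
Proof. by move=> x; elim/(@quotW _ lquot): x => x; rewrite -lquot_piZ scale1r. Qed.

Lemma lquot_scaleDr : right_distributive lquot_scale +%R.
Proof.
move=> k x y; elim/(@quotW _ lquot): x => x; elim/(@quotW _ lquot): y => y.
rewrite -[LHS]/(lquot_scale k (lquot_add (\pi_lquot x) (\pi_lquot y))).
rewrite -[RHS]/(lquot_add (lquot_scale k (\pi_lquot x)) (lquot_scale k (\pi_lquot y))).
by rewrite -!(lquot_piD, lquot_piZ) scalerDr.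
Qed.

Lemma lquot_scaleDl x : {morph lquot_scale^~ x : a b / a + b >-> a + b}.
Proof.
move=> a b; elim/(@quotW _ lquot): x => x.
rewrite -[RHS]/(lquot_add (lquot_scale a (\pi_lquot x)) (lquot_scale b (\pi_lquot x))).
by rewrite -!lquot_piZ -lquot_piD scalerDl.
Qed.

HB.instance Definition _ := GRing.Zmodule_isLmodule.Build K lquot
  lquot_scaleA lquot_scale1 lquot_scaleDr lquot_scaleDl.

End ModuleQuotient.

Arguments lquot {K V} G.

Section EnvelopingAlgebra.
Context {K : comNzRingType} {L : lmodType K} (br : L -> L -> L).

Local Notation T := (malg (fmonom L) K).

Definition free_gen (a : L) : T := mkmalgU (fmu a) 1.

(* T is the free associative algebra on the set L; the two-sided ideal below
   makes free_gen linear and turns commutators into brackets. *)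
Inductive uea_rel : set T :=
| UeaLinear x k a b y :
    uea_rel (x * (free_gen (k *: a + b) - k *: free_gen a - free_gen b) * y)
| UeaBracket x a b y :
    uea_rel (x * (free_gen a * free_gen b - free_gen b * free_gen a
                  - free_gen (br a b)) * y).

Definition uea : lmodType K := lquot uea_rel.
Definition uea_one : uea := \pi_(lquot uea_rel) 1.
Definition uea_gen (a : L) : uea := \pi_(lquot uea_rel) (free_gen a).
Definition uea_mul (x y : uea) : uea :=
  \pi_(lquot uea_rel) (repr (x : lquot uea_rel) * repr (y : lquot uea_rel)).

End EnvelopingAlgebra.

Section ExteriorPower.
Context {K : comNzRingType} (M : lmodType K) (g : nat).

Local Notation tup := {ffun 'I_g -> M}.
Local Notation T := (malg tup K).

Definition tup_set (t : tup) (i : 'I_g) (a : M) : tup :=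
  [ffun j => if j == i then a else t j].

Inductive extpow_rel : set T :=
| ExtLinear (t : tup) i k a b :
    extpow_rel (mkmalgU (tup_set t i (k *: a + b)) 1
                - k *: mkmalgU (tup_set t i a) 1 - mkmalgU (tup_set t i b) 1)
| ExtAlternating (t : tup) i j :
    i != j -> t i = t j -> extpow_rel (mkmalgU t 1).

Definition extpow : lmodType K := lquot extpow_rel.
Definition wedge (a : 'I_g -> M) : extpow :=
  \pi_(lquot extpow_rel) (mkmalgU (finfun a) 1).

End ExteriorPower.

Section Fock.
Context {K : fieldType} {H : vectType K} (form : H -> H -> K).
Context (F : {vspace H}).

(* (a, l) stands for a + l hbar. *)
Definition heis : lmodType K := (H * K^o)%type.
Definition heis_br (x y : heis) : heis := (0, form x.1 y.1).

Local Notation U := (uea heis_br).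

(* U(hat H) \otimes_{U(hat F)} K, where hat F acts on K by the character
   f + l hbar |-> l, is the quotient of U(hat H) by the left ideal generated
   by the f + l hbar - l. *)
Inductive fock_rel : set U :=
| FockRel (x : U) (f : H) (l : K) : f \in F ->
    fock_rel (uea_mul x (uea_gen heis_br ((f, l) : heis)) - l *: x).

Definition fock : lmodType K := lquot fock_rel.
Definition fock_vac : fock := \pi_(lquot fock_rel) (uea_one heis_br).
Definition fock_act (x : U) (u : fock) : fock :=
  \pi_(lquot fock_rel) (uea_mul x (repr (u : lquot fock_rel))).
Definition fock_rho (a : H) : fock -> fock :=
  fock_act (uea_gen heis_br ((a, 0) : heis)).

(* The image of x_1 ... x_k in Sym is x_1 o ... o x_k o v_o. *)
Definition fock_mono (xs : seq H) : fock := foldr fock_rho fock_vac xs.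

(* A tensor a_1 (x) b_1 + ... + a_k (x) b_k is represented by the list of the
   pairs (a_i, b_i); both maps below factor through the tensor product. *)
Definition fock_rho2 (t : seq (H * H)) (u : fock) : fock :=
  \sum_(p <- t) fock_rho p.1 (fock_rho p.2 u).

Definition tensor_hom (t : seq (H * H)) (x : H) : H :=
  \sum_(p <- t) (2 * form p.2 x) *: p.1.

Definition trace_on (f : H -> H) : K :=
  \sum_(i < \dim F) coord (vbasis F) i (f (vbasis F)`_i).

End Fock.


Definition Cn (R : realType) (n : nat) : normedModType R[i]%C := 'rV[R[i]%C]_n.

Section SmoothOnCn.
Context {R : realType} {n : nat}.
Local Notation C := (R[i]%C).
Local Notation Cn := (Cn R n).
Implicit Types (f : Cn -> C) (U : set Cn) (z v : Cn).

(* Real directional derivatives: the increment h is real. *)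
Definition dquot f z v : R -> C^o :=
  fun h => (h^-1)%:C%C * (f (z + h%:C%C *: v) - f z).
Definition ddir v f z : C := lim (dquot f z v @ 0^').

(* For U open: the iterated real directional derivatives of order at most k
   exist and are continuous on U. *)
Fixpoint Ck (k : nat) U f : Prop :=
  (forall z, U z -> {for z, continuous (f : Cn -> C^o)}) /\
  (if k is k'.+1 then
     forall v, (forall z, U z -> cvg (dquot f z v @ 0^')) /\ Ck k' U (ddir v f)
   else True).

Definition Cinfty U f := forall k, Ck k U f.

End SmoothOnCn.

Record cmanifold (R : realType) (n : nat) := CManifold {
  mspace :> topologicalType;
  mchart : Type;
  mdom : mchart -> set mspace;
  mcoord : mchart -> mspace -> Cn R n;
  mparam : mchart -> Cn R n -> mspace;
  m_hausdorff : hausdorff_space mspace;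
  mdom_open : forall c, open (mdom c);
  mdom_cover : forall x, exists c, mdom c x;
  mimage_open : forall c, open (mcoord c @` mdom c);
  mcoordK : forall c x, mdom c x -> mparam c (mcoord c x) = x;
  mcoord_cont : forall c x, mdom c x -> {for x, continuous (mcoord c)};
  mparam_cont : forall c z, (mcoord c @` mdom c) z ->
    {for z, continuous (mparam c)};
  mtrans_holo : forall c c' z, (mcoord c @` (mdom c `&` mdom c')) z ->
    differentiable (mcoord c' \o mparam c) z
}.

Section Manifold.
Context {R : realType} {n : nat} {S : cmanifold R n}.
Local Notation C := (R[i]%C).
Local Notation Cn := (Cn R n).
Implicit Types (W : set S) (f : S -> C) (c : mchart S) (v : Cn).

Definition in_chart c f : Cn -> C := f \o mparam c.

Definition smooth_fun W f :=
  forall c, Cinfty (mcoord c @` (W `&` mdom c)) (in_chart c f).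

Definition holo_fun W f :=
  forall c z, (mcoord c @` (W `&` mdom c)) z ->
    differentiable (in_chart c f : Cn -> C^o) z.

(* The derivative along the coordinate vector field with constant
   coordinates v in the chart c. *)
Definition pderiv c v f (x : S) : C := ddir v (in_chart c f) (mcoord c x).
Definition is_pderiv c v f (x : S) (l : C) : Prop :=
  dquot (in_chart c f) (mcoord c x) v @ 0^' --> (l : C^o).

(* A bundle is given by its fibers E and by the predicate
   smooth : "is a smooth section over the open set W", where sections over W
   are extended arbitrarily outside W.  A connection is given by the operators
   D c v of covariant derivation along the coordinate vector field of a chart c
   with constant coordinates v in C^n = R^2n.  A 1-form is likewise given by
   its values on these vector fields. *)
Section Connection.
Context {E : S -> lmodType C} (smooth : set S -> (forall x, E x) -> Prop).

Definition covder := mchart S -> Cn -> (forall x, E x) -> (forall x, E x).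

Record is_connection (D : covder) : Prop := {
  conn_smooth : forall c v W s, open W -> W `<=` mdom c ->
    smooth W s -> smooth W (D c v s);
  conn_local : forall c v W s t, open W -> W `<=` mdom c ->
    smooth W s -> smooth W t -> (forall x, W x -> s x = t x) ->
    forall x, W x -> D c v s x = D c v t x;
  conn_add : forall c v W s t, open W -> W `<=` mdom c ->
    smooth W s -> smooth W t ->
    forall x, W x -> D c v (fun y => s y + t y) x = D c v s x + D c v t x;
  conn_leibniz : forall c v W f s, open W -> W `<=` mdom c ->
    smooth_fun W f -> smooth W s ->
    forall x, W x ->
      D c v (fun y => f y *: s y) x = pderiv c v f x *: s x + f x *: D c v s x;
  conn_linear : forall c (k : R) v w W s, open W -> W `<=` mdom c ->
    smooth W s -> forall x, W x ->
      D c (k%:C%C *: v + w) s x = k%:C%C *: D c v s x + D c w s x;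
  conn_chart : forall c c' v W s, open W -> W `<=` mdom c `&` mdom c' ->
    smooth W s -> forall x, W x ->
      D c v s x = D c' ('d (mcoord c' \o mparam c) (mcoord c x) v) s x
}.

(* Coordinate vector fields of one chart commute, hence no bracket term. *)
Definition scalar_curvature (D : covder)
    (om : mchart S -> Cn -> Cn -> S -> C) : Prop :=
  forall c v w W s, open W -> W `<=` mdom c -> smooth W s ->
    forall x, W x ->
      D c v (D c w s) x - D c w (D c v s) x = om c v w x *: s x.

Definition flat (D : covder) := scalar_curvature D (fun _ _ _ _ => 0).

Definition projectively_flat (D : covder) :=
  exists om, scalar_curvature D om.

(* For ip sesquilinear on the fibers; covariant derivation is along real
   vector fields. *)
Definition unitary (ip : forall x, E x -> E x -> C) (D : covder) :=
  forall c v W s t, open W -> W `<=` mdom c -> smooth W s -> smooth W t ->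
    forall x, W x ->
      is_pderiv c v (fun y => ip y (s y) (t y)) x
        (ip x (D c v s x) (t x) + ip x (s x) (D c v t x)).

End Connection.

End Manifold.

Arguments covder {R n S} E.

Record vbundle (R : realType) (n : nat) (S : cmanifold R n) (r : nat) :=
  VBundle {
  vfib : S -> vectType R[i]%C;
  vtriv : Type;
  vdom : vtriv -> set S;
  vmap : vtriv -> forall x, {linear vfib x -> 'cV[R[i]%C]_r};
  vdom_open : forall t, open (vdom t);
  vdom_cover : forall x, exists t, vdom t x;
  vmap_bij : forall t x, vdom t x -> bijective (vmap t x);
  vtrans : forall t t', exists h : S -> 'M[R[i]%C]_r,
    (forall i j, smooth_fun (vdom t `&` vdom t') (fun x => h x i j)) /\
    (forall x, vdom t x -> vdom t' x ->
       forall u, vmap t' x u = h x *m vmap t x u)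
}.

Definition smooth_sec (R : realType) (n : nat) (S : cmanifold R n) (r : nat)
    (E : vbundle S r) (W : set S) (s : forall x, vfib E x) : Prop :=
  forall (t : vtriv E) i, smooth_fun (W `&` vdom t) (fun x => vmap t x (s x) i 0).

(* As conj is antilinear, the conjugates of a basis span the conjugate space. *)
Definition conj_space (R : realType) (H : vectType R[i]%C) (conj : H -> H)
    (F : {vspace H}) : {vspace H} :=
  <<[seq conj a | a <- vbasis F]>>%VS.

Definition isotropic (K : fieldType) (H : vectType K) (form : H -> H -> K)
    (F : {vspace H}) : Prop :=
  forall a b, a \in F -> b \in F -> form a b = 0.

Record pvhs (R : realType) (n : nat) (S : cmanifold R n) (r g : nat) := PVHS {
  pbun : vbundle S r;
  pnabla : covder (vfib pbun);
  pconj : forall x, vfib pbun x -> vfib pbun x;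
  pform : forall x, vfib pbun x -> vfib pbun x -> R[i]%C;
  pF : forall x, {vspace vfib pbun x};

  pnabla_conn : is_connection (smooth_sec (E := pbun)) pnabla;
  pnabla_flat : flat (smooth_sec (E := pbun)) pnabla;

  pconj_antilinear : forall x (k : R[i]%C) (a b : vfib pbun x),
    pconj (k *: a + b) = k^* *: pconj a + pconj b;
  pconj_invol : forall x (a : vfib pbun x), pconj (pconj a) = a;
  pconj_smooth : forall W s, open W -> smooth_sec W s ->
    smooth_sec W (fun x => pconj (s x));
  pconj_flat : forall c v W s, open W -> W `<=` mdom c -> smooth_sec W s ->
    forall x, W x ->
      pnabla c v (fun y => pconj (s y)) x = pconj (pnabla c v s x);

  pform_linear : forall x (k : R[i]%C) (a a' b : vfib pbun x),
    pform (k *: a + a') b = k * pform a b + pform a' b;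
  pform_antisym : forall x (a b : vfib pbun x), pform a b = - pform b a;
  pform_nondeg : forall x (a : vfib pbun x),
    (forall b, pform a b = 0) -> a = 0;
  pform_smooth : forall W s t, open W -> smooth_sec W s -> smooth_sec W t ->
    smooth_fun W (fun x => pform (s x) (t x));
  pform_flat : forall c v W s t, open W -> W `<=` mdom c ->
    smooth_sec W s -> smooth_sec W t ->
    forall x, W x ->
      pderiv c v (fun y => pform (s y) (t y)) x =
        pform (pnabla c v s x) (t x) + pform (s x) (pnabla c v t x);
  pform_real : forall x (a b : vfib pbun x),
    (pform a b)^* = pform (pconj a) (pconj b);

  pF_isotropic : forall x, isotropic (@pform x) (pF x);
  pF_maximal : forall x (G : {vspace vfib pbun x}),
    isotropic (@pform x) G -> (pF x <= G)%VS -> (G <= pF x)%VS;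
  pF_positive : forall x (a : vfib pbun x), a \in pF x -> a != 0 ->
    0 < 'i * pform a (pconj a);
  (* Locally, F has a frame whose coefficients with respect to a flat frame of
     the whole bundle are holomorphic. *)
  pF_holomorphic : forall x0, exists W,
    [/\ open W, W x0 &
     exists (e : 'I_r -> forall x, vfib pbun x) (m : 'I_g -> 'I_r -> S -> R[i]%C),
     [/\ forall k, smooth_sec W (e k),
         forall k c v x, W x -> mdom c x -> pnabla c v (e k) x = 0,
         forall x, W x -> basis_of fullv [seq e k x | k <- enum 'I_r],
         forall j k, holo_fun W (m j k) &
         forall x, W x -> basis_of (pF x)
           [seq \sum_k m j k x *: e k x | j <- enum 'I_g]]]
}.

Arguments pnabla {R n S r g} V c v s x : rename.
Arguments pconj {R n S r g} V x a : rename.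
Arguments pform {R n S r g} V x a b : rename.
Arguments pF {R n S r g} V x : rename.

Section Variation.
Context {R : realType} {n : nat} {S : cmanifold R n} {r g : nat}.
Context (V : pvhs S r g).
Local Notation C := (R[i]%C).
Local Notation Cn := (Cn R n).
Local Notation H := (vfib (pbun V)).
Local Notation F := (pF V).
Implicit Types (W : set S) (c : mchart S) (v : Cn) (x : S).

Definition Fbar x : {vspace H x} := conj_space (pconj V x) (F x).
Definition projF x : H x -> H x := daddv_pi (F x) (Fbar x).
Definition projFbar x : H x -> H x := daddv_pi (Fbar x) (F x).

Definition smooth_in (G : forall x, {vspace H x}) W (s : forall x, H x) :=
  smooth_sec W s /\ forall x, W x -> s x \in G x.

Definition nablaF : covder H := fun c v s x => projF (pnabla V c v s x).
Definition nablaFbar : covder H := fun c v s x => projFbar (pnabla V c v s x).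

(* The projection of the derivative at x of a local section s of F depends
   on s x only. *)
Definition sigma c v x (a : H x) : H x :=
  xget 0 [set b | exists W s, [/\ open W, W x, W `<=` mdom c,
                    smooth_in F W s & s x = a /\ b = projFbar (pnabla V c v s x)]].

Definition sigmabar c v x (a : H x) : H x :=
  pconj V x (sigma c v (pconj V x a)).

(* The preimages of sigmabar and sigma under the isomorphisms E_F of
   F (x) F with Hom(Fbar, F) and E_Fbar of Fbar (x) Fbar with Hom(F, Fbar). *)
Definition tens_s c v x : seq (H x * H x) :=
  xget [::] [set t | all (fun p => (p.1 \in F x) && (p.2 \in F x)) t /\
    forall a, a \in Fbar x -> tensor_hom (pform V x) t a = sigmabar c v a].

Definition tens_sbar c v x : seq (H x * H x) :=
  xget [::] [set t | all (fun p => (p.1 \in Fbar x) && (p.2 \in Fbar x)) t /\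
    forall a, a \in F x -> tensor_hom (pform V x) t a = sigma c v a].

Definition trace_sigmabar_sigma c v w x : C :=
  trace_on (F x) (fun a => sigmabar c v (sigma c w a)
                           - sigmabar c w (sigma c v a)).

Definition Fock x : lmodType C := fock (pform V x) (F x).
Definition rho x (a : H x) : Fock x -> Fock x := fock_rho a.
Definition vac x : Fock x := fock_vac _ _.

Definition fock_sum (e : seq ((S -> C) * seq (forall x, H x))) x : Fock x :=
  \sum_(p <- e) p.1 x *: fock_mono _ _ [seq z x | z <- p.2].

(* Smooth sections of Sym(Fbar) are locally finite combinations of products of
   smooth sections of Fbar. *)
Definition smooth_Fock W (u : forall x, Fock x) : Prop :=
  forall x, W x -> exists W' (e : seq ((S -> C) * seq (forall x, H x))),
    [/\ open W', W' x, W' `<=` W,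
        forall p, p \in e -> smooth_fun W' p.1 /\
          forall z, z \in p.2 -> smooth_in Fbar W' z &
        forall y, W' y -> u y = fock_sum e y].

(* The extension of nablaFbar to Sym(Fbar) by the Leibniz rule; multiplication
   by a section z of Fbar is rho z.  These rules determine D on the smooth
   sections, as the latter are locally generated by products. *)
Record is_sym_connection (D : covder Fock) : Prop := {
  symc_conn : is_connection smooth_Fock D;
  symc_vac : forall c v x, mdom c x -> D c v vac x = 0;
  symc_mul : forall c v W z u, open W -> W `<=` mdom c ->
    smooth_in Fbar W z -> smooth_Fock W u ->
    forall x, W x ->
      D c v (fun y => rho (z y) (u y)) x =
        rho (nablaFbar c v z x) (u x) + rho (z x) (D c v u x)
}.

Definition herm x (p q : H x) : C := 'i * pform V x (pconj V x q) p.

Record is_fock_inner_product (ip : forall x, Fock x -> Fock x -> C) : Prop := {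
  fip_linear : forall x (k : C) (u u' w : Fock x),
    ip x (k *: u + u') w = k * ip x u w + ip x u' w;
  fip_antilinear : forall x (k : C) (u w w' : Fock x),
    ip x u (k *: w + w') = k^* * ip x u w + ip x u w';
  fip_sym : forall x (m : nat) (z w : m.-tuple (H x)),
    {subset z <= Fbar x} -> {subset w <= Fbar x} ->
    ip x (fock_mono _ _ z) (fock_mono _ _ w) =
      \sum_(p : 'S_m) \prod_(i < m) herm (tnth z i) (tnth w (p i));
  fip_orth : forall x (z w : seq (H x)),
    {subset z <= Fbar x} -> {subset w <= Fbar x} -> size z != size w ->
    ip x (fock_mono _ _ z) (fock_mono _ _ w) = 0
}.

Definition nablaFock (D : covder Fock) : covder Fock :=
  fun c v u x => D c v u x
    + (fock_rho2 (tens_s c v x) (u x) + fock_rho2 (tens_sbar c v x) (u x)).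

Definition detF x : lmodType C := extpow (subvs_of (F x)) g.

Definition wedgeF (a : 'I_g -> forall x, H x) x : detF x :=
  wedge (fun i => vsproj (F x) (a i x)).

Definition smooth_det W (u : forall x, detF x) : Prop :=
  forall x, W x -> exists W' (e : seq ((S -> C) * ('I_g -> forall x, H x))),
    [/\ open W', W' x, W' `<=` W,
        forall p, p \in e -> smooth_fun W' p.1 /\
          forall i, smooth_in F W' (p.2 i) &
        forall y, W' y -> u y = \sum_(p <- e) p.1 y *: wedgeF p.2 y].

(* The connection induced by nablaF on the top exterior power; it is determined
   by these rules on the smooth sections. *)
Record is_det_connection (D : covder detF) : Prop := {
  detc_conn : is_connection smooth_det D;
  detc_wedge : forall c v W a, open W -> W `<=` mdom c ->
    (forall i, smooth_in F W (a i)) ->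
    forall x, W x ->
      D c v (wedgeF a) x =
        \sum_(i < g) wedgeF (fun j => if j == i then nablaF c v (a j) else a j) x
}.

End Variation.

(* Main.v *)
Require Import Defs.
From mathcomp Require Import all_boot all_order all_algebra.
From mathcomp Require Import perm complex ring lra.
From mathcomp Require Import all_classical all_reals all_analysis.
From mathcomp Require Import finmap.
From mathcomp Require Import -(notations) monalg.

(** Write [sigma] and [sigmabar] for the two off-diagonal parts of the flat
    connection in the decomposition of the bundle into [F] and its conjugate.
    The quadratic operator [A = rho (s + sbar)] is built so that its commutator
    with [rho a] is [rho] of [(sigma + sigmabar) a], and the connection [D] on
    the symmetric algebra satisfies the Leibniz rule with respect to [rho] and
    the diagonal part of the flat connection.  Hence [nabla = D + A] makes the
    Heisenberg action parallel,
    [nabla (rho a u) = rho (nabla^H a) u + rho a (nabla u)],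
    for every section [a] of the whole bundle ([fock_nabla_rho]).

    Curvature.  As the flat connection has no curvature, the curvature of
    [nabla] commutes with every [rho a], so that its value on the vacuum decides
    everything.  That value is a multiple of the vacuum plus a vector of degree
    two, the terms of degree four being symmetric in the two directions; it is
    annihilated by [F] because the vacuum is, and the number operator, which
    acts by 2 in degree two, shows that the component of degree two vanishes.
    The remaining scalar is read off in a frame of [F] and the frame of the
    conjugate bundle dual to it, and is the trace of the theorem
    ([curv_vac_frame], [fock_curvature]).

    Unitarity.  The adjoint of [rho a] is ['i *: rho (conj a)], by the expansion
    of permanents along a row ([ip_adjoint]).  As [s] and [sbar] are conjugate,
    [A] is skew-hermitian ([conn_op_skew]), and as the Heisenberg action is
    parallel, the derivation rule for the inner product passes from a vector to
    its products with sections of the conjugate of [F]; on the vacuum it is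
    skew-hermiticity again ([fock_unitary]).

    Determinant line.  By the Gauss equation the curvature of [nabla^F] is the
    endomorphism [- sigmabar /\ sigma] of [F] ([nablaF_curv]).  The curvature of
    the determinant line applies it to one factor of a wedge product at a time,
    which multiplies the product by the trace ([wedge_trace]).

    Smoothness.  Smooth functions have continuous iterated real directional
    derivatives; that these commute is Schwarz's theorem ([ddirC]).  The
    holomorphic frames of [F] are given by complex differentiability alone, so
    that their smoothness needs Cauchy's theory: Goursat's lemma for rectangles,
    transported to circles by the exponential, writes a directional derivative
    as a mean of difference quotients over a circle, a formula which can be
    differentiated again ([goursat], [cauchy_derivative],
    [differentiable_Cinfty]). *)

Set Implicit Arguments.
Unset Strict Implicit.
Unset Printing Implicit Defensive.

Import Order.TTheory GRing.Theory Num.Theory.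
Import numFieldNormedType.Exports.
Import quotient.

Local Open Scope classical_set_scope.
Local Open Scope complex_scope.
Local Open Scope ring_scope.
Local Open Scope quotient_scope.

(** * Complex-valued functions of a real variable *)
Section RealVariable.
Context {R : realType}.
Local Notation C := (R[i]).
Implicit Types (g G : R -> C) (t a b : R) (l : C).

Section Limits.
Context {T : Type} {F : set_system T} {FF : Filter F}.
Implicit Types (f h : T -> C^o) (k m : C^o).

Lemma cvgC_cst k : (fun=> k) @ F --> k.
Proof. exact: cvg_cst. Qed.

Lemma cvgC_add f h k m : f @ F --> k -> h @ F --> m ->
  (fun x => f x + h x : C^o) @ F --> (k + m : C^o).
Proof. exact: cvgD. Qed.

Lemma cvgC_opp f k : f @ F --> k -> (fun x => - f x : C^o) @ F --> (- k : C^o).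
Proof. exact: cvgN. Qed.

Lemma cvgC_mul f h k m : f @ F --> k -> h @ F --> m ->
  (fun x => f x * h x : C^o) @ F --> (k * m : C^o).
Proof. exact: cvgM. Qed.

Lemma cvgC_inv f k : k != 0 -> f @ F --> k ->
  (fun x => (f x)^-1 : C^o) @ F --> (k^-1 : C^o).
Proof. exact: (@cvgV C). Qed.

Lemma cvgC_distI f k : (forall e : C, 0 < e -> \forall x \near F, `|k - f x| < e) ->
  f @ F --> k.
Proof. by move=> H; apply/(@cvgrPdist_lt C C^o). Qed.

Lemma cvgC_distE f k : f @ F --> k ->
  forall e : C, 0 < e -> \forall x \near F, `|k - f x| < e.
Proof. by move=> H e e0; exact: ((@cvgrPdist_lt C C^o _ _ _ _ _).1 H). Qed.

Lemma cvgC_near f h k : (\forall x \near F, f x = h x) ->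
  f @ F --> k -> h @ F --> k.
Proof. by move=> fh; apply: cvg_trans; exact: near_eq_cvg. Qed.

Lemma cvgC_eq f h k : f =1 h -> f @ F --> k -> h @ F --> k.
Proof. by move=> /funext ->. Qed.

End Limits.

Arguments cvgC_cst {T F FF} k.

Lemma cvg_real_complex {T : Type} {F : set_system T} {FF : Filter F}
    (f : T -> R) (l : R) :
  f x @[x --> F] --> l -> ((f x)%:C : C^o) @[x --> F] --> (l%:C : C^o).
Proof.
move=> /cvgrPdist_lt h; apply/cvgrPdist_lt => e e0.
have e0' := e0; rewrite ltcE /= in e0; case/andP: e0 => /eqP ime ree.
near=> x; rewrite -rmorphB /= normc_def /= expr0n /= addr0 sqrtr_sqr.
rewrite ltcE /= ime eqxx /=; near: x; exact: h.
Unshelve. all: by end_near. Qed.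

Lemma cvg_conjC {T : Type} {F : set_system T} {FF : Filter F}
    (f : T -> C^o) (l : C^o) :
  f x @[x --> F] --> l -> ((f x)^* : C^o) @[x --> F] --> (l^* : C^o).
Proof.
move=> /cvgrPdist_lt h; apply/cvgrPdist_lt => e e0.
by near=> x; rewrite -rmorphB norm_conjC; near: x; exact: h.
Unshelve. all: by end_near. Qed.

Lemma norm_Re_le l : `|complex.Re l|%:C <= `|l|.
Proof. exact: normc_ge_Re. Qed.

Lemma cvg_Re {T : Type} {F : set_system T} {FF : Filter F}
    (f : T -> C^o) (l : C^o) :
  f x @[x --> F] --> l -> complex.Re (f x) @[x --> F] --> complex.Re l.
Proof.
move=> /cvgrPdist_lt h; apply/cvgrPdist_lt => e e0.
near=> x; rewrite -ltcR -raddfB; apply: le_lt_trans (norm_Re_le _) _.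
by near: x; apply: h; rewrite ltcR.
Unshelve. all: by end_near. Qed.

Lemma cvg_Im {T : Type} {F : set_system T} {FF : Filter F}
    (f : T -> C^o) (l : C^o) :
  f x @[x --> F] --> l -> complex.Im (f x) @[x --> F] --> complex.Im l.
Proof.
move=> h; rewrite (_ : (fun x => _) = fun x => complex.Re (- 'i%C * f x)).
  rewrite (_ : complex.Im l = complex.Re (- 'i%C * l)).
    exact (cvg_Re (cvgC_mul (cvgC_cst (- 'i%C : C^o)) h)).
  by case: l {h} => x y /=; ring.
by apply/funext => x; case: (f x) => u v /=; ring.
Qed.

Definition rderiv g t l :=
  (fun h : R => (h^-1)%:C * (g (t + h) - g t) : C^o) @ 0^' --> (l : C^o).

Lemma rderiv_near g g' t l :
  (\forall s \near t, g s = g' s) -> rderiv g t l -> rderiv g' t l.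
Proof.
move=> h; rewrite /rderiv; apply: cvg_trans; apply: near_eq_cvg.
have ht : g t = g' t by exact: nbhs_singleton h.
have : \forall s \near (0 : R)^', g (t + s) = g' (t + s).
  apply: nbhs_dnbhs.
  have /(_ (0 : R)) : continuous (fun s : R => t + s).
    by move=> s; apply: cvgD; [exact: cvg_cst|exact: cvg_id].
  by move/(_ [set s | g s = g' s]); apply; rewrite addr0.
by apply: filterS => s /= ->; rewrite ht.
Qed.

Lemma rderiv_incr g t l : rderiv g t l ->
  (g (t + h) : C^o) @[h --> (0 : R)^'] --> (g t : C^o).
Proof.
move=> gl.
have -> : g t = g t + 0 * l by rewrite mul0r addr0.
apply: (cvg_trans (G := (fun h : R => g t + h%:C * ((h^-1)%:C * (g (t + h) - g t)) : C^o) @ 0^')).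
  apply: near_eq_cvg; near=> h; rewrite mulrA -rmorphM /= divff ?rmorph1 ?mul1r.
    by rewrite addrC subrK.
  by near: h; exact: nbhs_dnbhs_neq.
have id0 : (h%:C : C^o) @[h --> (0 : R)^'] --> (0%:C : C^o).
  by apply: (@cvg_real_complex _ _ _ id _); exact: nbhs_dnbhs.
exact (cvgC_add (cvgC_cst _) (cvgC_mul id0 gl)).
Unshelve. all: by end_near. Qed.

Lemma rderiv_continuous g t l : rderiv g t l -> {for t, continuous (g : R -> C^o)}.
Proof.
move=> /rderiv_incr gl; apply/(@cvgrPdist_lt C C^o) => e e0.
move/(@cvgrPdist_lt C C^o): gl => /(_ e e0) gl.
have gl0 : \forall h \near (0 : R), `|g t - g (t + h)| < e.
  by move: gl; rewrite near_withinE; apply: filterS => h; case: (eqVneq h 0) => [->|h0 ->//];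
     rewrite addr0 subrr normr0.
have : \forall s \near t, `|g t - g (t + (s - t))| < e.
  have /(_ [set h | `|g t - g (t + h)| < e]) : (s - t) @[s --> t] --> (0 : R).
    by rewrite -(subrr t); apply: cvgB; [exact: cvg_id|exact: cvg_cst].
  exact.
by apply: filterS => s; rewrite addrCA subrr addr0.
Qed.

Lemma rderiv_cst (k : C) t : rderiv (fun=> k) t 0.
Proof.
rewrite /rderiv; under eq_fun do rewrite subrr mulr0.
exact: cvgC_cst.
Qed.

Lemma rderivD g1 g2 t l1 l2 : rderiv g1 t l1 -> rderiv g2 t l2 ->
  rderiv (fun s => g1 s + g2 s) t (l1 + l2).
Proof.
move=> h1 h2; pose proof (cvgC_add h1 h2) as H.
by rewrite /rderiv; apply: (cvgC_eq _ H) => h /=; ring.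
Qed.

Lemma rderivM g1 g2 t l1 l2 : rderiv g1 t l1 -> rderiv g2 t l2 ->
  rderiv (fun s => g1 s * g2 s) t (l1 * g2 t + g1 t * l2).
Proof.
move=> h1 h2; have h2' := rderiv_incr h2.
pose proof (cvgC_mul h1 h2') as hM.
pose proof (cvgC_mul (cvgC_cst (g1 t)) h2) as hN.
pose proof (cvgC_add hM hN) as H.
by rewrite /rderiv; apply: (cvgC_eq _ H) => h /=; ring.
Qed.

Lemma rderivZ (k : C) g t l : rderiv g t l -> rderiv (fun s => k * g s) t (k * l).
Proof. by move=> h; have := rderivM (rderiv_cst k t) h; rewrite mul0r add0r. Qed.

Lemma rderivN g t l : rderiv g t l -> rderiv (fun s => - g s) t (- l).
Proof.
move=> /(rderivZ (k := -1)); rewrite mulN1r; congr rderiv.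
by apply/funext => s; rewrite mulN1r.
Qed.

Lemma rderivB g1 g2 t l1 l2 : rderiv g1 t l1 -> rderiv g2 t l2 ->
  rderiv (fun s => g1 s - g2 s) t (l1 - l2).
Proof. by move=> h1 /rderivN h2; exact: rderivD. Qed.

Lemma rderivV g t l : g t != 0 -> rderiv g t l ->
  rderiv (fun s => (g s)^-1) t (- l * (g t)^-1 * (g t)^-1).
Proof.
move=> g0 h; have h' := rderiv_incr h.
pose proof (cvgC_inv g0 h') as hV.
pose proof (cvgC_mul (cvgC_mul (cvgC_opp h) hV) (cvgC_cst (g t)^-1)) as H; move: H.
apply: cvg_trans; apply: near_eq_cvg.
have : \forall h \near (0 : R)^', g (t + h) != 0.
  move/(@cvgrPdist_lt C C^o): h' => /(_ `|g t|); rewrite normr_gt0 => /(_ g0).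
  by apply: filterS => s; apply: contraTneq => ->; rewrite subr0 ltxx.
apply: filterS => s /=; move: (g (t + s)) (g t) g0 (s^-1)%:C => x y y0 k x0.
by field; rewrite x0 y0.
Qed.

Lemma rderiv_conjC g t l : rderiv g t l -> rderiv (fun s => (g s)^*) t (l^*).
Proof.
move=> h; pose proof (cvg_conjC h) as H; rewrite /rderiv; apply: (cvgC_eq _ H) => s.
by rewrite rmorphM rmorphB; congr (_ * _); exact: conjc_real.
Qed.

Lemma rderiv_eq g g' t l : g =1 g' -> rderiv g t l <-> rderiv g' t l.
Proof. by move=> /funext ->. Qed.

Lemma rderiv_shift g t l : rderiv (fun s => g (t + s)) 0 l <-> rderiv g t l.
Proof.
rewrite /rderiv.
suff -> : (fun h : R => (h^-1)%:C * (g (t + (0 + h)) - g (t + 0))) =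
  fun h : R => (h^-1)%:C * (g (t + h) - g t) by [].
by apply/funext => h; rewrite add0r addr0.
Qed.

Lemma rderiv_line g (t0 k : R) t l : rderiv g (t0 + k * t) l ->
  rderiv (fun s => g (t0 + k * s)) t (k%:C * l).
Proof.
have [->|k0] := eqVneq k 0.
  move=> _; rewrite mul0r; under eq_fun do rewrite mul0r; exact: rderiv_cst.
move=> h.
have : (k * s) @[s --> (0 : R)^'] --> (0 : R)^'.
  move=> A; rewrite /= /dnbhs /= !withinE /= => -[B B0 BA].
  exists [set s | B (k * s)].
    have /(_ B) : (k * s) @[s --> (0 : R)] --> (k * 0).
      by apply: cvgM; [exact: cvg_cst|exact: cvg_id].
    by rewrite mulr0; apply.
  apply/seteqP; split=> s /= [H s0]; split=> //.
    have : (A `&` [set s | s != 0]) (k * s) by split => //=; rewrite mulf_neq0.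
    by rewrite BA => -[].
  have : (B `&` [set s | s != 0]) (k * s) by split => //=; rewrite mulf_neq0.
  by rewrite -BA => -[].
move=> /cvg_comp /(_ h) h'.
pose proof (cvgC_mul (cvgC_cst k%:C) h') as H; move: H.
rewrite /rderiv; apply: cvg_trans; apply: near_eq_cvg; near=> s => /=.
by rewrite (mulrDr k) addrA mulrA -rmorphM /= invfM mulrA divff ?mul1r.
Unshelve. all: by end_near. Qed.

Lemma rderiv_real (F : R -> R) t (d : R) :
  is_derive t 1 F d -> rderiv (fun s => (F s)%:C) t d%:C.
Proof.
case=> /cvg_ex[l' Fl] Fd.
have ll : l' = d by rewrite -Fd; apply/esym/cvg_lim.
rewrite ll in Fl; pose proof (cvg_real_complex Fl) as H; rewrite /rderiv; apply: (cvgC_eq _ H) => h /=.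
by rewrite [h%:A]mulr1 -rmorphB -rmorphM /= [t + h]addrC.
Qed.

Lemma rderiv_Re g t l :
  rderiv g t l -> is_derive t 1 (fun s => complex.Re (g s)) (complex.Re l).
Proof.
move=> /cvg_Re h.
have h' : (fun h : R => h^-1 *: (((fun s => complex.Re (g s)) \o shift t) (h *: 1) - complex.Re (g t))) @ 0^' --> complex.Re l.
  rewrite (_ : (fun h : R => _) = fun h : R => complex.Re ((h^-1)%:C * (g (t + h) - g t))) //; apply/funext => s /=.
  rewrite [s%:A]mulr1 [s + t]addrC -raddfB; case: (_ - _) => x y /=.
  by rewrite mul0r subr0.
split; first by apply/cvg_ex; eexists; exact: h'.
exact/cvg_lim.
Qed.

(** The bound on the real part of a unit multiple of the increment, given by
    the real mean value theorem, bounds the modulus of the increment. *)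
Lemma rderiv_bound G g a b (M : C) : a <= b ->
  (forall t, a <= t <= b -> rderiv G t (g t)) ->
  (forall t, a <= t <= b -> `|g t| <= M) ->
  `|G b - G a| <= M * (b - a)%:C.
Proof.
move=> ab Gg gM.
have M0 : 0 <= M by apply: le_trans (gM a _) => //; rewrite lexx.
set D := G b - G a.
have [->|D0] := eqVneq D 0.
  by rewrite normr0 mulr_ge0 // ler0c subr_ge0.
(* Multiplication by the phase [u] makes the increment real and positive. *)
set u : C := D^* / `|D|.
have nD0 : `|D| != 0 by rewrite normr_eq0.
have nu : `|u| = 1 by rewrite normf_div norm_conjC normr_id divff.
have uD : u * D = `|D| by rewrite /u mulrAC [_ * D]mulrC -normCK expr2 mulfK.
have du t : a <= t <= b ->
  is_derive t 1 (fun s => complex.Re (u * G s)) (complex.Re (u * g t)).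
  by move=> tab; apply: rderiv_Re; apply: rderivZ; exact: Gg.
have [x xab e] : exists2 x, x \in `[a, b]%R &
   complex.Re (u * G b) - complex.Re (u * G a) = complex.Re (u * g x) * (b - a).
  apply: (@MVT_segment R (fun s => complex.Re (u * G s))
            (fun s => complex.Re (u * g s)) a b ab).
    by move=> x; rewrite in_itv /= => /andP[ax xb]; apply: du; rewrite !ltW.
  apply: derivable_within_continuous => x; rewrite in_itv /= => xab.
  by have [] := du x xab.
have -> : `|D| = (complex.Re (u * D))%:C.
  by rewrite uD; case: (`|D|) (normr_ge0 D) => x' y' /=; rewrite lecE /= => /andP[/eqP -> _].
rewrite /D mulrBr raddfB e rmorphM /= ler_wpM2r ?ler0c ?subr_ge0 //.
apply: le_trans (_ : `|u * g x| <= _).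
  by apply: le_trans (norm_Re_le _); rewrite lecR ler_norm.
by rewrite normrM nu mul1r gM //; move: xab; rewrite in_itv.
Qed.

Lemma rderiv0_cst G a b : a <= b ->
  (forall t, a <= t <= b -> rderiv G t 0) -> G b = G a.
Proof.
move=> ab h; apply/eqP; rewrite -subr_eq0 -normr_le0.
by rewrite -(mul0r (b - a)%:C); apply: (@rderiv_bound G (fun=> 0)) => // t _; rewrite normr0.
Qed.

Lemma real_primitive (f : R -> R) a b : continuous f ->
  exists F, forall t, a <= t <= b -> is_derive t 1 F (f t).
Proof.
move=> cf.
exists (fun y => \int[lebesgue_measure]_(t in `[a - 1, y]) f t)%R => t /andP[at' tb].
have [|| | | d1 d2] := @continuous_FTC1_closed R f (a - 1) t (b + 1).
- lra.
- apply: continuous_compact_integrable; first exact: segment_compact.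
  exact: continuous_subspaceT.
- lra.
- exact: cf.
split; first exact: d1.
by rewrite -d2 derive1E.
Qed.

Lemma primitive_continuous g a b : continuous (g : R -> C^o) ->
  exists G, forall t, a <= t <= b -> rderiv G t (g t).
Proof.
move=> cg.
have [U HU] := @real_primitive (fun s => complex.Re (g s)) a b (fun t => cvg_Re (cg t)).
have [V HV] := @real_primitive (fun s => complex.Im (g s)) a b (fun t => cvg_Im (cg t)).
exists (fun s => (U s)%:C + 'i%C * (V s)%:C) => t tab.
rewrite [g t]complexE; apply: rderivD; first exact/rderiv_real/HU.
exact/rderivZ/rderiv_real/HV.
Qed.

(** Composing with the retraction onto the segment makes the integrand
    continuous everywhere without changing it on the segment. *)
Lemma primitive_segment g a b : a <= b ->
  (forall t, a <= t <= b -> {for t, continuous (g : R -> C^o)}) ->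
  exists G, forall t, a <= t <= b -> rderiv G t (g t).
Proof.
move=> ab cg.
pose cl t := Num.max a (Num.min t b).
have clP t : a <= cl t <= b.
  by rewrite /cl le_max lexx /= ge_max ab /= ge_min lexx orbT.
have clE t : a <= t <= b -> cl t = t.
  by case/andP => h1 h2; rewrite /cl min_l // max_r.
have [|G HG] := @primitive_continuous (g \o cl) a b.
  move=> t; apply: continuous_comp; last exact: cg.
  apply: (@continuous_max _ _ (cst a) (fun t => Num.min t b)); first exact: cvg_cst.
  by apply: (@continuous_min _ _ id (cst b)); [exact: cvg_id|exact: cvg_cst].
by exists G => t tab; have := HG t tab; rewrite /= clE.
Qed.

(** The integral, as the increment of any antiderivative; by [rderiv0_cst] the
    choice is immaterial. *)
Definition cint a b g : C :=
  let G := xget (fun=> 0) [set G | forall t, a <= t <= b -> rderiv G t (g t)] in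
  G b - G a.

Lemma cintE a b g G : a <= b ->
  (forall t, a <= t <= b -> rderiv G t (g t)) -> cint a b g = G b - G a.
Proof.
move=> ab h; rewrite /cint.
have := @xgetI _ (fun=> 0) [set G | forall t, a <= t <= b -> rderiv G t (g t)] G h.
set G' := xget _ _ => /= h'.
have := @rderiv0_cst (fun s => G' s - G s) a b ab => H.
have : G' b - G b = G' a - G a.
  by apply: H => t tab; rewrite -(subrr (g t)); apply: rderivB; [exact: h'|exact: h].
by move/eqP; rewrite subr_eq => /eqP->; ring.
Qed.

End RealVariable.

Arguments cvgC_cst {R T F FF} k.
Arguments rderiv_cst {R} k t.
Arguments rderiv_eq {R g g' t l} _.

(** * Smooth functions on complex coordinate space *)
Section SmoothFunctions.
Context {R : realType} {n : nat}.
Local Notation C := (R[i]).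
Local Notation Cn := (Cn R n).
Implicit Types (f g : Cn -> C) (U : set Cn) (z v w : Cn) (l : C).

Definition is_ddir f z v l := rderiv (fun s : R => f (z + s%:C *: v)) 0 l.

Lemma dquotE f z v l : (dquot f z v @ 0^' --> (l : C^o)) = is_ddir f z v l.
Proof.
rewrite /is_ddir /rderiv.
suff -> : dquot f z v =
    fun h : R => (h^-1)%:C * (f (z + (0 + h)%:C *: v) - f (z + 0%:C *: v)) by [].
by apply/funext => h; rewrite /dquot add0r scale0r addr0.
Qed.

Lemma is_ddir_val f z v l : is_ddir f z v l -> ddir v f z = l.
Proof. by rewrite -dquotE; exact: (cvg_lim (@norm_hausdorff _ C^o)). Qed.

Lemma is_ddir_cvg f z v l : is_ddir f z v l -> cvg (dquot f z v @ 0^').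
Proof. by rewrite -dquotE => h; apply/cvg_ex; exists l. Qed.

Lemma ddirP f z v : cvg (dquot f z v @ 0^') -> is_ddir f z v (ddir v f z).
Proof. by rewrite -dquotE. Qed.

Lemma is_ddir_line f z v (t : R) l :
  is_ddir f (z + t%:C *: v) v l <-> rderiv (fun s => f (z + s%:C *: v)) t l.
Proof.
rewrite -rderiv_shift; apply: rderiv_eq => s.
by rewrite rmorphD scalerDl addrA.
Qed.

Lemma cvg_line z v (t : R) : (z + s%:C *: v) @[s --> t] --> z + t%:C *: v.
Proof.
apply: (@cvgD C Cn); first exact: cvg_cst.
apply: (@cvgZ C Cn); last exact: cvg_cst.
by apply: (@cvg_real_complex _ _ _ _ id); exact: cvg_id.
Qed.

Lemma near_line z v (P : Cn -> Prop) :
  (\forall y \near z, P y) -> \forall s \near (0 : R), P (z + s%:C *: v).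
Proof. by move=> h; apply: (cvg_line (z := z) (v := v) (t := 0)); rewrite scale0r addr0. Qed.

Lemma is_ddir_near f g z v l : (\forall y \near z, f y = g y) ->
  is_ddir f z v l -> is_ddir g z v l.
Proof. by move=> h; apply: rderiv_near; exact: (near_line v h). Qed.

Lemma ddir_near f g z v : (\forall y \near z, f y = g y) ->
  ddir v f z = ddir v g z.
Proof.
move=> h; rewrite /ddir.
have e : dquot f z v @ 0^' = dquot g z v @ 0^'.
  suff H u1 u2 : (\forall y \near z, u1 y = u2 y) -> dquot u1 z v @ 0^' `=>` dquot u2 z v @ 0^'.
    by apply/seteqP; split; apply: H => //; move: h; apply: filterS => y.
  move=> hu; apply: near_eq_cvg; have hz := nbhs_singleton hu.
  by apply: nbhs_dnbhs; move: (near_line v hu); apply: filterS => s; rewrite /dquot hz => ->.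
by rewrite /ddir e.
Qed.

(** Being of class [Ck] is a condition at each point, since the derivatives are
    taken of the function on the whole space; locality follows. *)
Lemma Ck_pt k U f : Ck k U f <-> forall z, U z -> Ck k [set z] f.
Proof.
elim: k f => [|k IH] f /=.
  split=> [[h _] z Uz|h]; first by split=> [y ->|]; [exact: h|exact: I].
  by split=> [z Uz|]; [have [h' _] := h z Uz; exact: h'|exact: I].
split=> [[h1 h2] z Uz|h].
  split=> [y ->|v]; first exact: h1.
  have [h3 h4] := h2 v; split=> [y ->|]; first exact: h3.
  by have [/(_ h4 z Uz)] := IH (ddir v f).
split=> [z Uz|v]; first by have [h' _] := h z Uz; exact: h'.
split=> [z Uz|]; first by have [_ /(_ v)[h' _]] := h z Uz; exact: h'.
by apply/IH => z Uz; have [_ /(_ v)[_]] := h z Uz.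
Qed.

Lemma CkS k U f : Ck k.+1 U f -> Ck k U f.
Proof.
elim: k f => [|k IH] f [h1 h2]; first by split.
split=> [|v]; first exact: h1.
by have [h3 h4] := h2 v; split; [exact: h3|exact: IH].
Qed.

Lemma Ck_sub k U U' f : U' `<=` U -> Ck k U f -> Ck k U' f.
Proof. by move=> s /Ck_pt h; apply/Ck_pt => z /s; exact: h. Qed.

Lemma Ck_near k z f g : (\forall y \near z, f y = g y) ->
  Ck k [set z] f -> Ck k [set z] g.
Proof.
have cont f' g' y : (\forall y' \near y, f' y' = g' y') ->
  {for y, continuous (f' : Cn -> C^o)} -> {for y, continuous (g' : Cn -> C^o)}.
  move=> h cf; rewrite /prop_for /continuous_at -(nbhs_singleton h).
  exact (cvgC_near h cf).
elim: k f g => [|k IH] f g h /=.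
  by move=> [h1 _]; split=> [y ->|]; [apply: cont h _; exact: h1|exact: I].
move=> [h1 h2]; split=> [y ->|v]; first by apply: cont h _; exact: h1.
have [h3 h4] := h2 v; split=> [y ->|].
  by apply: is_ddir_cvg; apply: is_ddir_near h _; apply: ddirP; exact: h3.
apply: IH h4; move/nbhs_interior: h; apply: filterS => y.
exact: ddir_near.
Qed.

Lemma Ck_eq k U f g : open U -> (forall z, U z -> f z = g z) ->
  Ck k U f -> Ck k U g.
Proof.
move=> oU fg /Ck_pt h; apply/Ck_pt => z Uz; apply: Ck_near (h z Uz).
by move: (open_nbhs_nbhs (conj oU Uz)); apply: filterS.
Qed.

Lemma Ck_continuous k U f z : Ck k U f -> U z -> {for z, continuous (f : Cn -> C^o)}.
Proof. by case: k => [|k] [h _] /h. Qed.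

Lemma Ck_ddirP k U f z v : Ck k.+1 U f -> U z -> is_ddir f z v (ddir v f z).
Proof. by move=> [_ /(_ v)[h _]] Uz; apply: ddirP; exact: h. Qed.

Arguments Ck_ddirP {k U f z} v _ _.

Lemma Ck_ddir k U f v : Ck k.+1 U f -> Ck k U (ddir v f).
Proof. by move=> [_ /(_ v)[_]]. Qed.

(** The derivatives may be given by any functions that agree with them on [U];
    the closure properties of [Ck] are inductions through this step. *)
Lemma Ck_step k U f (df : Cn -> Cn -> C) : open U ->
  (forall z, U z -> {for z, continuous (f : Cn -> C^o)}) ->
  (forall v z, U z -> is_ddir f z v (df v z)) ->
  (forall v, Ck k U (df v)) -> Ck k.+1 U f.
Proof.
move=> oU cf hdf Cdf; split=> [|v]; [exact: cf|split=> [z Uz|]].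
  exact: is_ddir_cvg (hdf v z Uz).
by apply: (Ck_eq oU _ (Cdf v)) => z Uz; rewrite (is_ddir_val (hdf v z Uz)).
Qed.

Lemma Ck_cst k U (l : C) : Ck k U (fun=> l).
Proof.
elim: k l => [|k IH] l.
  by split=> [z _|]; [exact (cvgC_cst (F := nbhs z) l)|exact: I].
split=> [z _|v]; first exact (cvgC_cst (F := nbhs z) l).
have h z : is_ddir (fun=> l) z v 0 by apply: rderiv_cst.
split=> [z _|]; first exact: is_ddir_cvg (h z).
by have -> : ddir v (fun=> l) = fun=> 0 by apply/funext => z; exact: is_ddir_val (h z).
Qed.

Lemma CkD k U f g : open U -> Ck k U f -> Ck k U g -> Ck k U (fun z => f z + g z).
Proof.
move=> oU; elim: k f g => [|k IH] f g hf hg.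
  split=> [z Uz|]; last exact: I.
  exact (cvgC_add (Ck_continuous hf Uz) (Ck_continuous hg Uz)).
apply: (@Ck_step _ _ _ (fun v z => ddir v f z + ddir v g z)) => //.
- by move=> z Uz; exact (cvgC_add (Ck_continuous hf Uz) (Ck_continuous hg Uz)).
- by move=> v z Uz; exact (rderivD (Ck_ddirP v hf Uz) (Ck_ddirP v hg Uz)).
- by move=> v; apply: IH; exact: Ck_ddir.
Qed.

Lemma CkM k U f g : open U -> Ck k U f -> Ck k U g -> Ck k U (fun z => f z * g z).
Proof.
move=> oU; elim: k f g => [|k IH] f g hf hg.
  split=> [z Uz|]; last exact: I.
  exact (cvgC_mul (Ck_continuous hf Uz) (Ck_continuous hg Uz)).
apply: (@Ck_step _ _ _ (fun v z => ddir v f z * g z + f z * ddir v g z)) => //.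
- by move=> z Uz; exact (cvgC_mul (Ck_continuous hf Uz) (Ck_continuous hg Uz)).
- move=> v z Uz; have := rderivM (Ck_ddirP v hf Uz) (Ck_ddirP v hg Uz).
  by rewrite scale0r addr0.
- move=> v; apply: CkD => //; apply: IH => //; try exact: Ck_ddir; exact: CkS.
Qed.

Lemma CkV k U f : open U -> (forall z, U z -> f z != 0) ->
  Ck k U f -> Ck k U (fun z => (f z)^-1).
Proof.
move=> oU f0; elim: k => [|k IH] hf.
  split=> [z Uz|]; last exact: I.
  exact (cvgC_inv (f0 z Uz) (Ck_continuous hf Uz)).
apply: (@Ck_step _ _ _ (fun v z => (-1) * ddir v f z * (f z)^-1 * (f z)^-1)) => //.
- by move=> z Uz; exact (cvgC_inv (f0 z Uz) (Ck_continuous hf Uz)).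
- move=> v z Uz; have := rderivV _ (Ck_ddirP v hf Uz).
  by rewrite scale0r addr0 mulN1r; apply; exact: f0.
- move=> v; have hV := IH (CkS hf).
  by do 3![apply: CkM => //]; [exact: Ck_cst|exact: Ck_ddir].
Qed.

Lemma small_real (d M : C) : 0 < d -> 0 <= M -> exists2 h : R, 0 < h & h%:C * M < d.
Proof.
rewrite ltcE lecE /= => /andP[/eqP d1 d0] /andP[/eqP M1 M0].
have -> : d = (complex.Re d)%:C by case: d d1 {d0} => ? ? /= ->.
have -> : M = (complex.Re M)%:C by case: M M1 {M0} => ? ? /= ->.
exists (complex.Re d / (complex.Re M + 1)); first by rewrite divr_gt0 // ltr_wpDl.
rewrite -rmorphM ltcR mulrAC ltr_pdivrMr ?ltr_wpDl // mulrDr mulr1.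
by rewrite ltrDl.
Qed.

Local Opaque ddir.

(** Two applications of the mean value inequality, one along each side of the
    parallelogram. *)
Lemma second_difference U f z v w (h : R) (L e : C) : 0 <= h -> Ck 2 U f ->
  (forall s t : R, 0 <= s <= h -> 0 <= t <= h ->
     U (z + s%:C *: v + t%:C *: w) /\
     `|ddir w (ddir v f) (z + s%:C *: v + t%:C *: w) - L| <= e) ->
  `|f (z + h%:C *: v + h%:C *: w) - f (z + h%:C *: v) - f (z + h%:C *: w) + f z
    - h%:C * h%:C * L| <= e * h%:C * h%:C.
Proof.
move=> h0 C2 hU.
have h00 : 0 <= (0 : R) <= h by rewrite lexx.
have hhh : 0 <= h <= h by rewrite lexx h0.
pose phi (s : R) := f (z + h%:C *: w + s%:C *: v) - f (z + s%:C *: v) - s%:C * (h%:C * L).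
pose dphi (s : R) := ddir v f (z + h%:C *: w + s%:C *: v) - ddir v f (z + s%:C *: v) - h%:C * L.
have rid (t : R) : rderiv (fun s : R => s%:C : C) t 1.
  by rewrite -[1]/(1%:C); apply: (@rderiv_real _ id); exact: is_derive_id.
have Hphi t : 0 <= t <= h -> rderiv phi t (dphi t).
  move=> ht; apply: rderivB.
    apply: rderivB; apply/is_ddir_line.
      apply: (Ck_ddirP _ C2); rewrite addrAC.
      by have [] := hU t h ht hhh.
    apply: (Ck_ddirP _ C2).
    by have [] := hU t 0 ht h00; rewrite scale0r addr0.
  have := rderivM (rid t) (@rderiv_cst _ (h%:C * L) t).
  by rewrite mulr0 addr0 mul1r.
have Bphi t : 0 <= t <= h -> `|dphi t| <= e * h%:C.
  move=> ht; pose psi (r : R) := ddir v f (z + t%:C *: v + r%:C *: w) - r%:C * L.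
  have Hpsi r : 0 <= r <= h ->
      rderiv psi r (ddir w (ddir v f) (z + t%:C *: v + r%:C *: w) - L).
    move=> hr; apply: rderivB.
      apply/is_ddir_line; apply: (Ck_ddirP _ (Ck_ddir _ C2)).
      by have [] := hU t r ht hr.
    have := rderivM (rid r) (@rderiv_cst _ L r).
    by rewrite mulr0 addr0 mul1r.
  have := rderiv_bound h0 Hpsi (M := e) (fun r hr => (hU t r ht hr).2).
  rewrite subr0; congr (`|_| <= _).
  by rewrite /psi /dphi scale0r addr0 mul0r subr0 [z + t%:C *: v + _]addrAC; exact: addrAC.
have := rderiv_bound h0 Hphi Bphi.
rewrite subr0; congr (`|_| <= _).
rewrite /phi scale0r !addr0 mul0r subr0 [z + _ + h%:C *: v]addrAC.
by ring.
Qed.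

Lemma mixed_close (p q r s h L1 L2 E : C) :
  `|p - q - r + s - h * L2| <= E -> `|p - r - q + s - h * L1| <= E ->
  `|h * (L2 - L1)| <= E + E.
Proof.
move=> B1 B2; have := le_trans (ler_normB _ _) (lerD B2 B1).
suff -> : p - r - q + s - h * L1 - (p - q - r + s - h * L2) = h * (L2 - L1) by [].
by ring.
Qed.

(** The second difference of [f] over a small parallelogram is close to either
    mixed derivative, by the previous estimate and its mirror image. *)
Lemma ddirC U f z v w : open U -> Ck 2 U f -> U z ->
  ddir v (ddir w f) z = ddir w (ddir v f) z.
Proof.
move=> oU C2 Uz; apply/eqP; rewrite -subr_eq0; apply/negPn/negP => D0.
set L1 := ddir v (ddir w f) z in D0; set L2 := ddir w (ddir v f) z in D0.
(* With a quarter of the gap as error, the two estimates add up to half of it. *)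
set e : C := `|L1 - L2| / 4%:R.
have e0 : 0 < e by rewrite divr_gt0 ?normr_gt0 ?ltr0n.
have near1 v' w' : \forall y \near z, `|ddir w' (ddir v' f) z - ddir w' (ddir v' f) y| < e.
  exact ((@cvgrPdist_lt C C^o _ _ _ _ _).1 (Ck_continuous (Ck_ddir w' (Ck_ddir v' C2)) Uz) e e0).
have nU := open_nbhs_nbhs (conj oU Uz).
have /nbhs_ballP[d /= d0 Hd] : nbhs z (fun y => [/\ U y, `|ddir w (ddir v f) y - L2| <= e
   & `|ddir v (ddir w f) y - L1| <= e]).
  apply: filterS (filterI nU (filterI (near1 v w) (near1 w v))) => y [Uy [/ltW h1 /ltW h2]].
  by split; [exact Uy|rewrite distrC; exact h1|rewrite distrC; exact h2].
have [h h0 hd] := @small_real d (`|v| + `|w|) d0 (addr_ge0 (normr_ge0 v) (normr_ge0 w)).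
have Hball v' w' s t : `|v'| + `|w'| = `|v| + `|w| -> 0 <= s <= h -> 0 <= t <= h ->
   ball z d (z + s%:C *: v' + t%:C *: w').
  move=> evw /andP[s0 sh] /andP[t0 th].
  rewrite -ball_normE /ball_ /= -addrA opprD addrA subrr sub0r normrN.
  apply: le_lt_trans hd; rewrite -evw mulrDr; apply: le_trans (ler_normD _ _) _.
  by rewrite !normrZ !ger0_norm ?ler0c // lerD // ler_wpM2r // lecR.
have h0' := ltW h0.
have A1 := @second_difference U f z v w h L2 e h0' C2.
have A2 := @second_difference U f z w v h L1 e h0' C2.
have B1 := A1 (fun s t hs ht => let: And3 a b _ := Hd _ (Hball v w s t erefl hs ht) in conj a b).
have B2 := A2 (fun s t hs ht => let: And3 a _ b := Hd _ (Hball w v s t (addrC _ _) hs ht) in conj a b).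
rewrite [z + h%:C *: w + h%:C *: v]addrAC in B2.
have := mixed_close B1 B2.
have hC0 : 0 < h%:C :> C by rewrite ltcR.
rewrite 2!normrM ger0_norm ?(ltW hC0) // -mulrDl -mulrDl -[leRHS]mulrA [leRHS]mulrC.
rewrite ler_pM2l ?mulr_gt0 // distrC /e => H.
have /(le_lt_trans H) : `|L1 - L2| / 4%:R + `|L1 - L2| / 4%:R < `|L1 - L2|.
  have -> : `|L1 - L2| / 4%:R + `|L1 - L2| / 4%:R = `|L1 - L2| * (2%:R / 4%:R) by move: `|_| => q; field.
  rewrite gtr_pMr ?normr_gt0 //.
  by rewrite ltr_pdivrMr ?ltr0n // mul1r ltr_nat.
by rewrite ltxx.
Qed.

End SmoothFunctions.

Arguments Ck_ddirP {R n k U f z} v _ _.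

(** * Complex derivatives and the exponential *)
Section ComplexDerivative.
Context {R : realType}.
Local Notation C := (R[i]).
Implicit Types (g k : C -> C) (z w l : C).

(** Caratheodory's form of complex differentiability: products, inverses and
    composites need no manipulation of quotients. *)
Definition cderiv g z l := exists phi : C -> C,
  [/\ (phi w : C^o) @[w --> (z : C^o)] --> (phi z : C^o), phi z = l &
      \forall w \near (z : C^o), g w - g z = phi w * (w - z)].

Lemma cvg_idC z : (w : C^o) @[w --> (z : C^o)] --> (z : C^o).
Proof. exact: cvg_id. Qed.

Arguments cvg_idC : clear implicits.

Lemma nearWC z (P : C -> Prop) : (forall w, P w) -> \forall w \near (z : C^o), P w.
Proof. by move=> h; exact: (@filterE _ (nbhs (z : C^o))). Qed.

Lemma cderiv_continuous g z l : cderiv g z l ->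
  (g w : C^o) @[w --> (z : C^o)] --> (g z : C^o).
Proof.
move=> [phi [cphi _ e]].
pose proof (cvgC_add (cvgC_cst (g z)) (cvgC_mul cphi (cvgC_add (cvg_idC z) (cvgC_cst (- z))))) as h1.
rewrite subrr mulr0 addr0 in h1.
apply: (cvgC_near _ h1); apply: filterS e => w e.
by rewrite -e addrC subrK.
Qed.

Lemma cderivM g k z l m : cderiv g z l -> cderiv k z m ->
  exists q, cderiv (fun w => g w * k w) z q.
Proof.
move=> Hg Hk; have ck := cderiv_continuous Hk.
case: Hg Hk => [phi [cphi _ e1]] [psi [cpsi _ e2]].
exists (phi z * k z + g z * psi z); exists (fun w => phi w * k w + g z * psi w); split.
- exact (cvgC_add (cvgC_mul cphi ck) (cvgC_mul (cvgC_cst (g z)) cpsi)).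
- exact: erefl.
- apply: filterS2 e1 e2 => w e1 e2.
  have -> : (phi w * k w + g z * psi w) * (w - z) =
     (phi w * (w - z)) * k w + g z * (psi w * (w - z)) by ring.
  by rewrite -e1 -e2; ring.
Qed.

Lemma cderiv_subr g z l (c : C) : cderiv g z l -> cderiv (fun w => g w - c) z l.
Proof.
move=> [phi [cphi e1 e2]]; exists phi; split; [exact: cphi|exact: e1|].
by apply: filterS e2 => w <-; ring.
Qed.

Lemma cderiv_inv z : z != 0 -> exists q, cderiv (fun w => w^-1) z q.
Proof.
move=> z0; exists (- (z^-1 * z^-1)); exists (fun w => - (w^-1 * z^-1)); split.
- exact (cvgC_opp (cvgC_mul (cvgC_inv z0 (cvg_idC z)) (cvgC_cst z^-1))).
- exact: erefl.
- have /(@cvgrPdist_lt C C^o)/(_ `|z|) := cvg_idC z.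
  rewrite normr_gt0 => /(_ z0); apply: filterS => w hw.
  have w0 : w != 0 by apply: contraTneq hw => ->; rewrite subr0 ltxx.
  by field; rewrite w0 z0.
Qed.

Lemma cderiv_comp g k z l m : cderiv g (k z) l -> cderiv k z m ->
  cderiv (fun w => g (k w)) z (l * m).
Proof.
move=> Hg Hk; have ck := cderiv_continuous Hk.
case: Hg Hk => [phi [cphi p1 e1]] [psi [cpsi p2 e2]].
exists (fun w => phi (k w) * psi w); split; last 1 first.
- have e1' : \forall w \near (z : C^o), g (k w) - g (k z) = phi (k w) * (k w - k z).
    exact (ck _ e1).
  by apply: filterS2 e1' e2 => w -> ->; rewrite mulrA.
- exact (cvgC_mul (cvg_comp _ _ ck cphi) cpsi).
- by rewrite p1 p2.
Qed.

Lemma cderiv_near g k z l : (\forall w \near (z : C^o), g w = k w) ->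
  cderiv g z l -> cderiv k z l.
Proof.
move=> gk [phi [cphi p e]]; exists phi; split; [exact: cphi|exact: p|].
have gz : g z = k z by exact: (nbhs_singleton gk).
by apply: filterS2 gk e => w <-; rewrite gz.
Qed.

(** The difference quotient itself, extended by [l], serves as [phi]. *)
Lemma cderivP g z l :
  (h^-1 * (g (z + h) - g z) : C^o) @[h --> (0 : C^o)^'] --> (l : C^o) ->
  cderiv g z l.
Proof.
move=> H; exists (fun w => if w == z then l else (w - z)^-1 * (g w - g z)).
split; [|by rewrite eqxx|]; last first.
  apply: nearWC => w; case: eqVneq => [->|wz]; first by rewrite !subrr mulr0.
  by rewrite mulrAC mulVf ?mul1r // subr_eq0.
rewrite eqxx; apply: (cvgC_distI (F := nbhs (z : C^o))) => e e0.
pose proof (cvgC_distE H e0) as H'.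
have H0 : \forall h \near (0 : C^o), h != 0 -> `|l - h^-1 * (g (z + h) - g z)| < e.
  by exact H'.
have sh : (w - z : C^o) @[w --> (z : C^o)] --> (0 : C^o).
  by pose proof (cvgC_add (cvg_idC z) (cvgC_cst (- z))) as h; rewrite subrr in h; exact h.
have := sh _ H0; rewrite /= => {}H0.
have H1 : \forall w \near (z : C^o), w - z != 0 -> `|l - (w - z)^-1 * (g (z + (w - z)) - g z)| < e by exact H0.
apply: filterS H1 => w; case: (eqVneq w z) => [-> _|wz]; first by rewrite subrr normr0.
by rewrite subr_eq0 => /(_ wz); rewrite [z + _]addrC subrK.
Qed.

Lemma cderiv_approx g z l : cderiv g z l -> forall e : C, 0 < e ->
  \forall h \near (0 : C^o), `|g (z + h) - g z - l * h| <= e * `|h|.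
Proof.
move=> [phi [cphi p q]] e e0.
pose proof (cvgC_distE cphi e0) as cphi'.
have sh : (z + h : C^o) @[h --> (0 : C^o)] --> (z : C^o).
  by pose proof (cvgC_add (cvgC_cst z) (cvg_idC 0)) as h; rewrite addr0 in h; exact h.
have Hq : \forall h \near (0 : C^o), g (z + h) - g z = phi (z + h) * (z + h - z) by exact (sh _ q).
have Hc : \forall h \near (0 : C^o), `|phi z - phi (z + h)| < e by exact (sh _ cphi').
apply: filterS2 Hq Hc => h -> Hc.
rewrite [z + h - z]addrAC subrr add0r -mulrBl normrM ler_wpM2r //.
by rewrite -p distrC ltW.
Qed.

Definition cis (y : R) : C := (cos y +i* sin y)%C.

Definition cexp z : C := (expR (complex.Re z))%:C * cis (complex.Im z).

Lemma cisD x y : cis (x + y) = cis x * cis y.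
Proof. by rewrite /cis cosD sinD; simpc; congr (_ +i* _)%C; rewrite addrC. Qed.

Lemma norm_cis y : `|cis y| = 1.
Proof. by rewrite normc_def /= cos2Dsin2 sqrtr1. Qed.

Lemma cis_neq0 y : cis y != 0.
Proof. by rewrite -normr_eq0 norm_cis oner_eq0. Qed.

Lemma cexpD z w : cexp (z + w) = cexp z * cexp w.
Proof. by rewrite /cexp !raddfD /= expRD rmorphM cisD; ring. Qed.

Lemma norm_cexp z : `|cexp z| = (expR (complex.Re z))%:C.
Proof. by rewrite normrM norm_cis mulr1 ger0_norm // ler0c expR_ge0. Qed.

Lemma cexp0 : cexp 0 = 1.
Proof. by rewrite /cexp /cis /= expR0 cos0 sin0 mul1r. Qed.

Lemma rderiv_cis y : rderiv cis y ('i%C * cis y).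
Proof.
have H := rderivD (rderiv_real (is_derive_cos y)) (rderivZ (k := 'i%C) (rderiv_real (is_derive_sin y))).
have -> : 'i%C * cis y = (- sin y)%:C + 'i%C * (cos y)%:C by rewrite /cis; simpc.
by refine ((rderiv_eq _).1 H) => s; rewrite /cis; simpc.
Qed.

Arguments rderiv_cis : clear implicits.

Lemma rderiv_cexp_ray h (t : R) :
  rderiv (fun s => cexp (s%:C * h)) t (h * cexp (t%:C * h)).
Proof.
set x := complex.Re h; set y := complex.Im h.
have e s : cexp (s%:C * h) = (expR (0 + x * s))%:C * cis (0 + y * s).
  rewrite /cexp !add0r; congr ((expR _)%:C * cis _).
    by rewrite /x; case: (h) => a b /=; ring.
  by rewrite /y; case: (h) => a b /=; ring.
have H1 := rderiv_line (rderiv_real (is_derive_expR (0 + x * t))).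
have H2 := rderiv_line (rderiv_cis (0 + y * t)).
have -> : h * cexp (t%:C * h) = x%:C * (expR (0 + x * t))%:C * cis (0 + y * t)
  + (expR (0 + x * t))%:C * (y%:C * ('i%C * cis (0 + y * t))).
  by rewrite e {1}[h]complexE -/x -/y; ring.
by refine ((rderiv_eq _).1 (rderivM H1 H2)) => s; rewrite e.
Qed.

Arguments rderiv_cexp_ray : clear implicits.

(** Two applications of the mean value inequality along the segment from 0 to
    [h]. *)
Lemma cexp_taylor h : `|h| <= 1 -> `|cexp h - 1 - h| <= (expR 1)%:C * `|h| * `|h|.
Proof.
move=> h1; set M : C := (expR 1)%:C.
have M0 : 0 <= M by rewrite ler0c expR_ge0.
have bE (t : R) : 0 <= t <= 1 -> `|cexp (t%:C * h)| <= M.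
  move=> /andP[t0 t1]; rewrite norm_cexp lecR ler_expR.
  rewrite -lecR; apply: le_trans (_ : `|t%:C * h| <= _).
    by apply: le_trans (norm_Re_le _); rewrite lecR ler_norm.
  rewrite normrM ger0_norm ?ler0c // -[1%:C]mulr1 ler_pM //; first by rewrite ler0c.
  by rewrite lecR.
have b1 (t : R) : 0 <= t <= 1 -> `|cexp (t%:C * h) - 1| <= M * `|h|.
  move=> /andP[t0 t1].
  have := @rderiv_bound R _ _ 0 t (M * `|h|) t0 (fun s _ => rderiv_cexp_ray h s).
  rewrite /= mul0r cexp0 subr0 => H.
  apply: le_trans (H _) _.
    by move=> s /andP[s0 st]; rewrite normrM mulrC ler_wpM2r // bE // s0 (le_trans st).
  by rewrite -[leRHS]mulr1 ler_wpM2l ?mulr_ge0 // lecR.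
have Hd (t : R) : rderiv (fun s => cexp (s%:C * h) - s%:C * h) t (h * (cexp (t%:C * h) - 1)).
  rewrite mulrBr mulr1; apply: rderivB; first exact: rderiv_cexp_ray.
  have := rderivM (rderiv_real (@is_derive_id _ _ t 1)) (rderiv_cst h t).
  by rewrite mulr0 addr0 mul1r.
have := @rderiv_bound R _ _ 0 1 (M * `|h| * `|h|) ler01 (fun s _ => Hd s).
rewrite /= !mul0r cexp0 !subr0 !mulr1 !mul1r addrAC; apply.
move=> s hs; rewrite normrM mulrC ler_wpM2r //; exact: b1.
Qed.

Lemma cderiv_cexp z : cderiv cexp z (cexp z).
Proof.
pose chi h := if h == 0 then 1 else (cexp h - 1) / h.
exists (fun w => cexp z * chi (w - z)); split.
- rewrite subrr.
  have chi1 : (chi h : C^o) @[h --> (0 : C^o)] --> (chi 0 : C^o).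
    apply: (cvgC_distI (F := nbhs (0 : C^o))) => e e0; rewrite /chi eqxx.
    have M0 : 0 < (expR 1)%:C :> C by rewrite ltcR expR_gt0.
    have n1 : \forall h \near (0 : C^o), `|0 - h| < 1 by exact (cvgC_distE (cvg_idC 0) ltr01).
    have n2 : \forall h \near (0 : C^o), `|0 - h| < e / (expR 1)%:C.
      by exact (cvgC_distE (cvg_idC 0) (divr_gt0 e0 M0)).
    apply: filterS2 n1 n2 => h; rewrite sub0r normrN => /ltW h1 h2.
    case: (eqVneq h 0) h1 h2 => [->|h0] h1 h2; first by rewrite subrr normr0.
    have -> : 1 - (cexp h - 1) / h = - (cexp h - 1 - h) / h by field.
    rewrite mulNr normrN normf_div ltr_pdivrMr ?normr_gt0 //.
    apply: le_lt_trans (cexp_taylor h1) _.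
    by rewrite ltr_pM2r ?normr_gt0 // mulrC -ltr_pdivlMr.
  have sh : (w - z : C^o) @[w --> (z : C^o)] --> (0 : C^o).
    by pose proof (cvgC_add (cvg_idC z) (cvgC_cst (- z))) as h; rewrite subrr in h; exact h.
  exact (cvgC_mul (cvgC_cst (cexp z)) (cvg_comp _ _ sh chi1)).
- by rewrite subrr /chi eqxx mulr1.
- apply: nearWC => w; rewrite /chi subr_eq0; case: eqVneq => [->|wz].
    by rewrite !subrr mulr0.
  rewrite -mulrA divfK ?subr_eq0 // mulrBr mulr1 -cexpD addrCA subrr addr0 //.
Qed.

End ComplexDerivative.

Arguments cvg_idC {R} z.
Arguments rderiv_cis {R} y.
Arguments rderiv_cexp_ray {R} h t.

(** * The theorem of Goursat *)
Section Goursat.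
Context {R : realType}.
Local Notation C := (R[i]).
Implicit Types (f k : R -> C) (g : C -> C) (a b m x y : R).

Local Opaque cint rderiv.

Definition has_primitive a b f :=
  exists G, forall t, a <= t <= b -> rderiv G t (f t).

Lemma cint_split a m b f : a <= m -> m <= b -> has_primitive a b f ->
  cint a b f = cint a m f + cint m b f.
Proof.
move=> am mb [G HG]; rewrite (cintE (le_trans am mb) HG).
rewrite (@cintE _ a m f G am); last by move=> t /andP[h1 h2]; apply: HG; rewrite h1 (le_trans h2).
rewrite (@cintE _ m b f G mb); last by move=> t /andP[h1 h2]; apply: HG; rewrite h2 (le_trans am).
by ring.
Qed.

Lemma cint_bound a b f (M : C) : a <= b -> has_primitive a b f ->
  (forall t, a <= t <= b -> `|f t| <= M) -> `|cint a b f| <= M * (b - a)%:C.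
Proof. by move=> ab [G HG] fM; rewrite (cintE ab HG); exact: (rderiv_bound ab HG). Qed.

Lemma cintB a b f k : a <= b -> has_primitive a b f -> has_primitive a b k ->
  cint a b (fun t => f t - k t) = cint a b f - cint a b k.
Proof.
move=> ab [G HG] [K HK]; rewrite (cintE ab HG) (cintE ab HK).
rewrite (@cintE _ _ _ _ (fun t => G t - K t) ab); first by ring.
by move=> t tab; exact (rderivB (HG t tab) (HK t tab)).
Qed.

Lemma has_primitiveB a b f k : has_primitive a b f -> has_primitive a b k ->
  has_primitive a b (fun t => f t - k t).
Proof.
move=> [G HG] [K HK]; exists (fun t => G t - K t) => t tab.
exact (rderivB (HG t tab) (HK t tab)).
Qed.

Lemma has_primitive_sub a b a' b' f : a <= a' -> b' <= b -> has_primitive a b f ->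
  has_primitive a' b' f.
Proof.
move=> aa bb [G HG]; exists G => t /andP[h1 h2]; apply: HG.
by rewrite (le_trans aa) // (le_trans h2).
Qed.

(** The contour integral along the boundary, counterclockwise: the factor ['i] is
    the derivative of the parametrization of the vertical sides. *)
Definition rect_int g x1 x2 y1 y2 : C :=
  cint x1 x2 (fun s => g (s +i* y1)%C) + 'i%C * cint y1 y2 (fun t => g (x2 +i* t)%C)
  - cint x1 x2 (fun s => g (s +i* y2)%C) - 'i%C * cint y1 y2 (fun t => g (x1 +i* t)%C).

(** Integrals being increments of antiderivatives, their existence has to be
    recorded for every horizontal and vertical segment. *)
Definition line_integrable g x1 x2 y1 y2 :=
  (forall y, y1 <= y <= y2 -> has_primitive x1 x2 (fun s => g (s +i* y)%C)) /\
  (forall x, x1 <= x <= x2 -> has_primitive y1 y2 (fun t => g (x +i* t)%C)).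

Lemma line_integrable_sub g x1 x2 y1 y2 x1' x2' y1' y2' :
  x1 <= x1' -> x2' <= x2 -> y1 <= y1' -> y2' <= y2 ->
  line_integrable g x1 x2 y1 y2 -> line_integrable g x1' x2' y1' y2'.
Proof.
move=> h1 h2 h3 h4 [H1 H2]; split=> [y /andP[u1 u2]|x /andP[u1 u2]].
  apply: (has_primitive_sub h1 h2); apply: H1.
  by rewrite (le_trans h3) // (le_trans u2).
apply: (has_primitive_sub h3 h4); apply: H2.
by rewrite (le_trans h1) // (le_trans u2).
Qed.

Lemma rect_int_splitx g x1 m x2 y1 y2 : x1 <= m -> m <= x2 -> y1 <= y2 ->
  line_integrable g x1 x2 y1 y2 ->
  rect_int g x1 x2 y1 y2 = rect_int g x1 m y1 y2 + rect_int g m x2 y1 y2.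
Proof.
move=> xm mx yy [H1 H2]; rewrite /rect_int.
rewrite (cint_split xm mx (H1 y1 _)) ?lexx // (cint_split xm mx (H1 y2 _)) ?lexx ?yy //.
have E (p1 p2 q r1 r2 s u : C) :
    p1 + p2 + q - (r1 + r2) - s = (p1 + u - r1 - s) + (p2 + q - r2 - u) by ring.
exact: E.
Qed.

Lemma rect_int_splity g x1 x2 y1 m y2 : y1 <= m -> m <= y2 -> x1 <= x2 ->
  line_integrable g x1 x2 y1 y2 ->
  rect_int g x1 x2 y1 y2 = rect_int g x1 x2 y1 m + rect_int g x1 x2 m y2.
Proof.
move=> ym my xx [H1 H2]; rewrite /rect_int.
rewrite (cint_split ym my (H2 x1 _)) ?lexx // (cint_split ym my (H2 x2 _)) ?lexx ?xx //.
have E (p q1 q2 r s1 s2 u i : C) :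
    p + i * (q1 + q2) - r - i * (s1 + s2) =
    (p + i * q1 - u - i * s1) + (u + i * q2 - r - i * s2) by ring.
exact: E.
Qed.

Lemma rect_int_bound g x1 x2 y1 y2 (M : C) : x1 <= x2 -> y1 <= y2 ->
  line_integrable g x1 x2 y1 y2 ->
  (forall x y, x1 <= x <= x2 -> y1 <= y <= y2 -> `|g (x +i* y)%C| <= M) ->
  `|rect_int g x1 x2 y1 y2| <= M * (2 * ((x2 - x1) + (y2 - y1)))%:C.
Proof.
move=> xx yy [H1 H2] gM.
have hx y : y1 <= y <= y2 -> `|cint x1 x2 (fun s => g (s +i* y)%C)| <= M * (x2 - x1)%:C.
  by move=> hy; apply: cint_bound (H1 y hy) _ => // t ht; exact: gM.
have hy x : x1 <= x <= x2 -> `|'i%C * cint y1 y2 (fun t => g (x +i* t)%C)| <= M * (y2 - y1)%:C.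
  move=> h; have ni : `|'i%C : C| = 1 by rewrite normc_def /= expr0n expr1n add0r sqrtr1.
  rewrite normrM ni mul1r.
  by apply: cint_bound (H2 x h) _ => // t ht; exact: gM.
rewrite /rect_int; apply: le_trans (ler_normB _ _) _.
apply: le_trans (lerD (ler_normB _ _) (lexx _)) _.
apply: le_trans (lerD (lerD (ler_normD _ _) (lexx _)) (lexx _)) _.
have b1 : x1 <= x1 <= x2 by rewrite lexx.
have b2 : x1 <= x2 <= x2 by rewrite lexx xx.
have b3 : y1 <= y1 <= y2 by rewrite lexx.
have b4 : y1 <= y2 <= y2 by rewrite lexx yy.
apply: le_trans (lerD (lerD (lerD (hx y1 b3) (hy x2 b2)) (hx y2 b4)) (hy x1 b1)) _.
by rewrite le_eqVlt; apply/orP; left; apply/eqP; rewrite rmorphM rmorphD /=; ring.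
Qed.

Lemma rect_intB g (k : C -> C) x1 x2 y1 y2 : x1 <= x2 -> y1 <= y2 ->
  line_integrable g x1 x2 y1 y2 -> line_integrable k x1 x2 y1 y2 ->
  rect_int (fun z => g z - k z) x1 x2 y1 y2 =
  rect_int g x1 x2 y1 y2 - rect_int k x1 x2 y1 y2.
Proof.
move=> xx yy [H1 H2] [K1 K2]; rewrite /rect_int.
have b1 : x1 <= x1 <= x2 by rewrite lexx.
have b2 : x1 <= x2 <= x2 by rewrite lexx xx.
have b3 : y1 <= y1 <= y2 by rewrite lexx.
have b4 : y1 <= y2 <= y2 by rewrite lexx yy.
rewrite (cintB xx (H1 _ b3) (K1 _ b3)) (cintB xx (H1 _ b4) (K1 _ b4)).
rewrite (cintB yy (H2 _ b1) (K2 _ b1)) (cintB yy (H2 _ b2) (K2 _ b2)).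
have E (p1 p2 q1 q2 r1 r2 s1 s2 i : C) :
    (p1 - p2) + i * (q1 - q2) - (r1 - r2) - i * (s1 - s2) =
    (p1 + i * q1 - r1 - i * s1) - (p2 + i * q2 - r2 - i * s2) by ring.
exact: E.
Qed.

Lemma affine_primitive (l c p q : C) t :
  rderiv (fun s => l * (s%:C * q + p) * (s%:C * q + p) / 2%:R + c * (s%:C * q)) t
    ((l * (t%:C * q + p) + c) * q).
Proof.
have H1 := rderivM (rderiv_real (@is_derive_id _ _ t 1)) (rderiv_cst q t).
have H2 := rderivD H1 (rderiv_cst p t).
have H3 := rderivM (rderivZ (k := l) H2) H2.
have H4 := rderivD (rderivM H3 (rderiv_cst (2%:R^-1) t)) (rderivZ (k := c) H1).
have -> : (l * (t%:C * q + p) + c) * q = (l * (1%:C * q + (id t)%:C * 0 + 0) * ((id t)%:C * q + p) +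
         l * ((id t)%:C * q + p) * (1%:C * q + (id t)%:C * 0 + 0)) / 2 +
        l * ((id t)%:C * q + p) * ((id t)%:C * q + p) * 0 +
        c * (1%:C * q + (id t)%:C * 0).
  by rewrite rmorph1 /=; field.
exact: H4.
Qed.

Arguments affine_primitive : clear implicits.

Lemma rect_int_affine (l c : C) x1 x2 y1 y2 : x1 <= x2 -> y1 <= y2 ->
  line_integrable (fun z => l * z + c) x1 x2 y1 y2 /\
  rect_int (fun z => l * z + c) x1 x2 y1 y2 = 0.
Proof.
move=> xx yy.
have E x y : (x +i* y)%C = x%:C + 'i%C * y%:C by simpc.
have Hx y t : rderiv (fun s => l * (s%:C + 'i%C * y%:C) * (s%:C + 'i%C * y%:C) / 2%:R + c * s%:C) t
   (l * (t +i* y)%C + c).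
  have := affine_primitive l c ('i%C * y%:C) 1 t; rewrite !mulr1 -E => H.
  by refine ((rderiv_eq _).1 H) => s; rewrite !mulr1.
have Hy x t : rderiv (fun s => - 'i%C * (l * (x%:C + 'i%C * s%:C) * (x%:C + 'i%C * s%:C) / 2%:R + c * ('i%C * s%:C))) t
   (l * (x +i* t)%C + c).
  have := rderivZ (k := - 'i%C) (affine_primitive l c x%:C 'i%C t).
  have -> : - 'i%C * ((l * (t%:C * 'i%C + x%:C) + c) * 'i%C) = l * (x +i* t)%C + c.
    rewrite E; have i2 : 'i%C * 'i%C = -1 :> C by rewrite -expr2 sqr_i.
    rewrite [t%:C * _]mulrC [_ + x%:C]addrC mulrCA mulNr i2 opprK mulr1 //.
  move=> H; refine ((rderiv_eq _).1 H) => s.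
  by rewrite [s%:C * _]mulrC [_ + x%:C]addrC.
split; first by split=> [y _|x _]; eexists=> t _; [exact: Hx|exact: Hy].
rewrite /rect_int !(cintE xx (fun t _ => Hx _ t)) !(cintE yy (fun t _ => Hy _ t)).
have ii (A B : C) : 'i%C * (- 'i%C * A - - 'i%C * B) = A - B.
  have i2 : 'i%C * 'i%C = -1 :> C by rewrite -expr2 sqr_i.
  by rewrite -mulrBr mulrA mulrN i2 opprK mul1r.
by rewrite !ii; field.
Qed.

(** In [q : R * R * (R * R)] the first pair is the horizontal, the second the
    vertical side of a rectangle. *)
Definition good_rect (Q : nat -> R * R * (R * R) -> Prop) n (q : R * R * (R * R)) :=
  [/\ q.1.1 <= q.1.2, q.2.1 <= q.2.2 & Q n q].

Definition half_interval (p q : R * R) :=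
  [/\ p.1 <= q.1, q.2 <= p.2 & q.2 - q.1 = (p.2 - p.1) / 2].

Lemma nested_point (I : nat -> R * R) : (I 0%N).1 <= (I 0%N).2 ->
  (forall n, half_interval (I n) (I n.+1)) ->
  exists x, forall n, (I n).1 <= x <= (I n).2 /\
    (I n).2 - (I n).1 = ((I 0%N).2 - (I 0%N).1) / 2 ^+ n.
Proof.
move=> I0 HI.
have wid n : (I n).2 - (I n).1 = ((I 0%N).2 - (I 0%N).1) / 2 ^+ n.
  elim: n => [|n IH]; first by rewrite expr0 divr1.
  by have [_ _ ->] := HI n; rewrite IH exprSr invfM mulrA.
have le12 n : (I n).1 <= (I n).2.
  by rewrite -subr_ge0 wid divr_ge0 ?exprn_ge0 // subr_ge0.
have mono n (k : nat) : (I n).1 <= (I (n + k)%N).1 /\ (I (n + k)%N).2 <= (I n).2.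
  elim: k => [|k [IH1 IH2]]; first by rewrite addn0.
  rewrite addnS; have [h1 h2 _] := HI (n + k)%N.
  by split; [exact: le_trans h1|exact: le_trans IH2].
have cross n (m' : nat) : (I n).1 <= (I m').2.
  have [nm|/ltnW mn] := leqP n m'.
    have [h1 _] := mono n (m' - n)%N; rewrite subnKC // in h1.
    exact: le_trans h1 (le12 _).
  have [_ h1] := mono m' (n - m')%N; rewrite subnKC // in h1.
  exact: le_trans (le12 _) h1.
pose A := [set (I n).1 | n in [set: nat]].
have supA : has_sup A.
  split; first by exists (I 0%N).1, 0%N.
  by exists (I 0%N).2 => _ [n _ <-].
exists (sup A) => n; split; last exact: wid.
apply/andP; split; first by apply: ub_le_sup; [exact: supA.2|exists n].
by apply: ge_sup; [exact: supA.1|move=> _ [k _ <-]].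
Qed.

(** The stage [n] is an argument of [Q], since the lower bound for the integral
    gets worse by a factor 4 at each step. *)
Lemma quartering (Q : nat -> R * R * (R * R) -> Prop) (q0 : R * R * (R * R)) :
  good_rect Q 0%N q0 ->
  (forall n q, good_rect Q n q -> exists q',
     [/\ good_rect Q n.+1 q', half_interval q.1 q'.1 & half_interval q.2 q'.2]) ->
  exists x y, forall n, exists q, [/\ good_rect Q n q,
    q.1.1 <= x <= q.1.2 /\ q.1.2 - q.1.1 = (q0.1.2 - q0.1.1) / 2 ^+ n &
    q.2.1 <= y <= q.2.2 /\ q.2.2 - q.2.1 = (q0.2.2 - q0.2.1) / 2 ^+ n].
Proof.
move=> g0 step.
have /choice[F HF] : forall p : nat * (R * R * (R * R)), exists q', good_rect Q p.1 p.2 ->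
    [/\ good_rect Q p.1.+1 q', half_interval p.2.1 q'.1 & half_interval p.2.2 q'.2].
  move=> [n q]; case: (pselect (good_rect Q n q)) => [/step[q' h]|h]; first by exists q'.
  by exists q.
pose fix I n := if n is k.+1 then F (k, I k) else q0.
have gI n : good_rect Q n (I n).
  by elim: n => [//|n IH] /=; have [] := HF (n, I n) IH.
have [x Hx] : exists x, forall n, (I n).1.1 <= x <= (I n).1.2 /\
    (I n).1.2 - (I n).1.1 = ((I 0%N).1.2 - (I 0%N).1.1) / 2 ^+ n.
  apply: (@nested_point (fun n => (I n).1)); first by case: g0.
  by move=> n; have [] := HF (n, I n) (gI n).
have [y Hy] : exists x, forall n, (I n).2.1 <= x <= (I n).2.2 /\
    (I n).2.2 - (I n).2.1 = ((I 0%N).2.2 - (I 0%N).2.1) / 2 ^+ n.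
  apply: (@nested_point (fun n => (I n).2)); first by case: g0.
  by move=> n; have [] := HF (n, I n) (gI n).
by exists x, y => n; exists (I n); split; [exact: gI|exact: Hx|exact: Hy].
Qed.

Lemma cderiv_line_integrable g x1 x2 y1 y2 : x1 <= x2 -> y1 <= y2 ->
  (forall x y, x1 <= x <= x2 -> y1 <= y <= y2 -> exists l, cderiv g (x +i* y)%C l) ->
  line_integrable g x1 x2 y1 y2.
Proof.
move=> xx yy H.
have lin (p q : C) (t : R) : ((p + s%:C * q) : C^o) @[s --> t] --> (p + t%:C * q : C^o).
  have ct : (s%:C : C^o) @[s --> t] --> (t%:C : C^o).
    by apply: (@cvg_real_complex _ _ _ _ id); exact: cvg_id.
  exact (cvgC_add (cvgC_cst p) (cvgC_mul ct (cvgC_cst q))).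
split=> [y hy|x hx]; apply: primitive_segment => // t ht.
- have [l /cderiv_continuous cg] := H t y ht hy.
  have E s : (s +i* y)%C = 'i%C * y%:C + s%:C * 1 :> C by simpc.
  rewrite /prop_for /continuous_at.
  have := lin ('i%C * y%:C) 1 t; rewrite -E => L.
  have -> : (fun s => g (s +i* y)%C) = g \o (fun s => 'i%C * y%:C + s%:C * 1).
    by apply/funext => s /=; rewrite E.
  exact (cvg_comp _ _ L cg).
- have [l /cderiv_continuous cg] := H x t hx ht.
  have E s : (x +i* s)%C = x%:C + s%:C * 'i%C :> C by simpc.
  rewrite /prop_for /continuous_at.
  have := lin x%:C 'i%C t; rewrite -E => L.
  have -> : (fun s => g (x +i* s)%C) = g \o (fun s => x%:C + s%:C * 'i%C).
    by apply/funext => s /=; rewrite E.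
  exact (cvg_comp _ _ L cg).
Qed.

Lemma norm_xy_le x y : `|(x +i* y)%C : C| <= (`|x| + `|y|)%:C.
Proof.
have -> : (x +i* y)%C = x%:C + 'i%C * y%:C :> C by simpc.
have ni : `|'i%C : C| = 1 by rewrite normc_def /= expr0n expr1n add0r sqrtr1.
apply: le_trans (ler_normD _ _) _; rewrite normrM ni mul1r.
by rewrite !normc_def /= expr0n !addr0 !sqrtr_sqr rmorphD.
Qed.

Lemma quarter_lt (p q r s t : C) : 4 * p < t -> 4 * q < t -> 4 * r < t ->
  4 * s < t -> p + q + (r + s) < t.
Proof.
move=> h1 h2 h3 h4; rewrite -(@ltr_pM2l _ 4) ?ltr0n //.
have -> : 4 * t = t + t + (t + t) by ring.
by rewrite !mulrDr; apply: ltrD; apply: ltrD.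
Qed.

(** Some quarter carries a fourth of the integral over the rectangle; along
    nested quarters this contradicts the first order approximation at their
    common point, as affine functions integrate to 0. *)
Lemma goursat g x1 x2 y1 y2 : x1 <= x2 -> y1 <= y2 ->
  (forall x y, x1 <= x <= x2 -> y1 <= y <= y2 -> exists l, cderiv g (x +i* y)%C l) ->
  rect_int g x1 x2 y1 y2 = 0.
Proof.
move=> xx yy Hg; have li := cderiv_line_integrable xx yy Hg.
set J := rect_int g x1 x2 y1 y2.
pose Q n (q : R * R * (R * R)) := [/\ x1 <= q.1.1, q.1.2 <= x2, y1 <= q.2.1, q.2.2 <= y2 &
  `|J| <= 4 ^+ n * `|rect_int g q.1.1 q.1.2 q.2.1 q.2.2|].
have [||x [y Hxy]] := @quartering Q ((x1, x2), (y1, y2)).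
- by split=> //; split=> //=; rewrite expr0 mul1r.
- move=> n [[a1 a2] [b1 b2]] [/= a12 b12 [/= h1 h2 h3 h4 h5]].
  pose ma := (a1 + a2) / 2; pose mb := (b1 + b2) / 2.
  have ama : a1 <= ma by rewrite /ma; lra.
  have maa : ma <= a2 by rewrite /ma; lra.
  have bmb : b1 <= mb by rewrite /mb; lra.
  have mbb : mb <= b2 by rewrite /mb; lra.
  have li' := line_integrable_sub h1 h2 h3 h4 li.
  have split4 : rect_int g a1 a2 b1 b2 =
     rect_int g a1 ma b1 mb + rect_int g a1 ma mb b2 +
     (rect_int g ma a2 b1 mb + rect_int g ma a2 mb b2).
    rewrite (rect_int_splitx ama maa b12 li').
    rewrite (rect_int_splity bmb mbb ama); last exact: line_integrable_sub li'.
    by rewrite (rect_int_splity bmb mbb maa) //; exact: line_integrable_sub li'.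
  have [q [Hq hq]] : exists q, [/\ `|rect_int g a1 a2 b1 b2| <=
      4 * `|rect_int g q.1.1 q.1.2 q.2.1 q.2.2|,
      q.1 = (a1, ma) \/ q.1 = (ma, a2) & q.2 = (b1, mb) \/ q.2 = (mb, b2)].
    apply: contrapT => /forallNP nq.
    have lt4 p1 p2 r1 r2 : (p1, p2) = (a1, ma) \/ (p1, p2) = (ma, a2) ->
       (r1, r2) = (b1, mb) \/ (r1, r2) = (mb, b2) ->
       4 * `|rect_int g p1 p2 r1 r2| < `|rect_int g a1 a2 b1 b2|.
      move=> hp hr; rewrite real_ltNge ?realM ?normr_real ?realn //.
      by apply/negP => H; apply: (nq ((p1, p2), (r1, r2))).
    have := quarter_lt (lt4 _ _ _ _ (or_introl erefl) (or_introl erefl))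
       (lt4 _ _ _ _ (or_introl erefl) (or_intror erefl))
       (lt4 _ _ _ _ (or_intror erefl) (or_introl erefl))
       (lt4 _ _ _ _ (or_intror erefl) (or_intror erefl)).
    rewrite split4 => H.
    have := lt_le_trans H (le_trans (ler_normD _ _) (lerD (ler_normD _ _) (ler_normD _ _))).
    by rewrite ltxx.
  case: q Hq hq => [[p1 p2] [r1 r2]] /= Hq hp hr.
  exists ((p1, p2), (r1, r2)).
  have fin : `|J| <= 4 ^+ n.+1 * `|rect_int g p1 p2 r1 r2|.
    apply: le_trans h5 _; rewrite exprSr -mulrA ler_wpM2l ?exprn_ge0 ?ler0n //.
  have wa : ma - a1 = (a2 - a1) / 2 by rewrite /ma; lra.
  have wa' : a2 - ma = (a2 - a1) / 2 by rewrite /ma; lra.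
  have wb : mb - b1 = (b2 - b1) / 2 by rewrite /mb; lra.
  have wb' : b2 - mb = (b2 - b1) / 2 by rewrite /mb; lra.
  have [k1 k2] := (le_trans h1 ama, le_trans maa h2).
  have [k3 k4] := (le_trans h3 bmb, le_trans mbb h4).
  move: fin; case: hp => -[-> ->]; case: hr => -[-> ->] fin.
  - split; [split; [exact: ama|exact: bmb|split; [exact: h1|exact: k2|exact: h3|exact: k4|exact: fin]]|by split|by split].
  - split; [split; [exact: ama|exact: mbb|split; [exact: h1|exact: k2|exact: k3|exact: h4|exact: fin]]|by split|by split].
  - split; [split; [exact: maa|exact: bmb|split; [exact: k1|exact: h2|exact: h3|exact: k4|exact: fin]]|by split|by split].
  - split; [split; [exact: maa|exact: mbb|split; [exact: k1|exact: h2|exact: k3|exact: h4|exact: fin]]|by split|by split].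
apply/eqP; rewrite -normr_le0.
have [l Hl] : exists l, cderiv g (x +i* y)%C l.
  have [q [[/= _ _ [h1 h2 h3 h4 _]] [/andP[u1 u2] _] [/andP[v1 v2] _]]] := Hxy 0%N.
  by apply: Hg; apply/andP; split; [exact: le_trans u1|exact: le_trans h2|
    exact: le_trans v1|exact: le_trans h4].
set D := (x2 - x1) + (y2 - y1).
have D0 : 0 <= D by rewrite addr_ge0 // subr_ge0.
(* The error of the affine approximation is [e] times the diameter, and it is
   integrated over a contour comparable to the diameter. *)
have key (e : C) : 0 < e -> `|J| <= e * (2 * D * D)%:C.
  move=> e0.
  have /nbhs_ballP[d /= d0 Hd] : nbhs (0 : C^o) (fun h => `|g ((x +i* y)%C + h) - g (x +i* y)%C - l * h| <= e * `|h|).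
    exact: cderiv_approx Hl e e0.
  have dE : d = (complex.Re d)%:C.
    by move: d0; rewrite ltcE /= => /andP[/eqP]; case: (d) => ? ? /= ->.
  have d0' : 0 < complex.Re d by rewrite -ltcR -dE.
  have [n Hn] : exists n, D / 2 ^+ n < complex.Re d.
    pose n := Num.bound (D / complex.Re d); exists n.
    rewrite ltr_pdivrMr ?exprn_gt0 // mulrC -ltr_pdivrMr //.
    apply: lt_le_trans (_ : n%:R <= _); last by rewrite -natrX ler_nat ltnW // ltn_expl.
    by apply: le_lt_trans (archi_boundP _); [exact: lexx|rewrite divr_ge0 // ltW].
  have [[[a1 a2] [b1 b2]] [[/= a12 b12 [/= h1 h2 h3 h4 h5]] [/andP[/= u1 u2] wa] [/andP[/= v1 v2] wb]]] := Hxy n.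
  have li' := line_integrable_sub h1 h2 h3 h4 li.
  pose c := g (x +i* y)%C - l * (x +i* y)%C.
  have [liA JA] := rect_int_affine l c a12 b12.
  have -> : D = 2 ^+ n * (D / 2 ^+ n) by rewrite mulrC divfK // expf_neq0.
  set Dn := D / 2 ^+ n in Hn *.
  have wab : (a2 - a1) + (b2 - b1) = Dn by rewrite wa wb -mulrDl.
  have Dn0 : 0 <= Dn by rewrite -wab; lra.
  have B : `|rect_int g a1 a2 b1 b2| <= e * Dn%:C * (2 * Dn)%:C.
    rewrite -[rect_int _ _ _ _ _]subr0 -JA -rect_intB // -{2}wab.
    apply: (rect_int_bound a12 b12).
      case: li' liA => p1 p2 [r1 r2]; split=> [y' hy'|x' hx'].
        exact (has_primitiveB (p1 y' hy') (r1 y' hy')).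
      exact (has_primitiveB (p2 x' hx') (r2 x' hx')).
    move=> x' y' /andP[k1 k2] /andP[k3 k4].
    set w := (x' +i* y')%C - (x +i* y)%C : C.
    have -> : g (x' +i* y')%C - (l * (x' +i* y')%C + c) = g ((x +i* y)%C + w) - g (x +i* y)%C - l * w.
      by rewrite /c /w [(x +i* y)%C + _]addrC subrK; ring.
    have nw : `|w| <= Dn%:C.
      apply: le_trans (norm_xy_le _ _) _; rewrite lecR -wab.
      apply: lerD; rewrite ler_norml; apply/andP.
        by split; [move: k1 u2 {Hxy}|move: k2 u1]; clear; lra.
      by split; [move: k3 v2|move: k4 v1]; clear; lra.
    apply: le_trans (Hd w _) _; last by rewrite ler_wpM2l // ltW.
    rewrite -ball_normE /ball_ /= sub0r normrN; apply: le_lt_trans nw _.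
    by rewrite dE ltcR.
  apply: le_trans h5 _; apply: le_trans (ler_wpM2l _ B) _; first by rewrite exprn_ge0 ?ler0n.
  rewrite le_eqVlt; apply/orP; left; apply/eqP; rewrite !rmorphM !rmorphXn !rmorphMn !rmorph1 /=.
  have -> : 4 = 2 * 2 :> C by rewrite -natrM.
  by rewrite exprMn; ring.
have [->|J0] := eqVneq J 0; first by rewrite normr0.
exfalso.
have K0 : 0 < (2 * D * D + 1)%:C :> C by rewrite ltcR ltr_wpDl // mulr_ge0 // mulr_ge0 // ler0n.
have J0' : 0 < `|J| by rewrite normr_gt0.
have := key (`|J| / (2 * D * D + 1)%:C) (divr_gt0 J0' K0).
rewrite mulrAC ler_pdivlMr // ler_pM2l // lecR.
by lra.
Qed.

End Goursat.

(** * Holomorphic functions are smooth *)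
Section CircleMean.
Context {R : realType}.
Local Notation C := (R[i]).

Local Opaque cint rderiv.

Lemma cintZ a b (c : C) (f : R -> C) : a <= b -> has_primitive a b f ->
  has_primitive a b (fun t => c * f t) /\ cint a b (fun t => c * f t) = c * cint a b f.
Proof.
move=> ab [G HG].
have H t : a <= t <= b -> rderiv (fun s => c * G s) t (c * f t).
  by move=> tab; exact (rderivZ (HG t tab)).
split; first by exists (fun s => c * G s).
by rewrite (cintE ab H) (cintE ab HG) mulrBr.
Qed.

Lemma small_eq0 (z M : C) : 0 <= M -> (forall e : C, 0 < e -> `|z| <= e * M) -> z = 0.
Proof.
move=> M0 H; apply/eqP/negPn/negP => z0.
have z1 : 0 < `|z| by rewrite normr_gt0.
have M1 : 0 < M + 1 by rewrite ltr_wpDl.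
have := H (`|z| / (M + 1)) (divr_gt0 z1 M1).
rewrite mulrAC ler_pdivlMr // ler_pM2l // => /(lt_le_trans (_ : M < M + 1)).
by rewrite ltrDl ltr01 ltxx => /(_ isT).
Qed.

Lemma pi2_ge0 : 0 <= 2 * pi :> R.
Proof. by rewrite mulr_ge0 ?pi_ge0. Qed.

(** In the logarithmic coordinate circles become vertical segments, whose
    integrals agree by [goursat], the horizontal sides cancelling by periodicity;
    the radius can then tend to 0. *)
Lemma circle_mean (k : C -> C) (r : R) : 0 < r ->
  (forall z : C, 0 < `|z| -> `|z| <= r%:C -> exists l, cderiv k z l) ->
  (k z : C^o) @[z --> (0 : C^o)] --> (k 0 : C^o) ->
  has_primitive 0 (2 * pi) (fun t => k (r%:C * cis t)) /\
  cint 0 (2 * pi) (fun t => k (r%:C * cis t)) = (2 * pi)%:C * k 0.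
Proof.
move=> r0 Hk k0; set S := ln r.
have eS : expR S = r by rewrite lnK // posrE.
pose g z := k (cexp z).
have Hg s (x y : R) : s <= x <= S -> exists l, cderiv g (x +i* y)%C l.
  move=> /andP[_ xS].
  have [||l Hl] := Hk (cexp (x +i* y)%C).
  - by rewrite norm_cexp ltcR expR_gt0.
  - by rewrite norm_cexp lecR /= -eS ler_expR.
  by eexists; exact (cderiv_comp Hl (cderiv_cexp _)).
have E (x y : R) : g (x +i* y)%C = k ((expR x)%:C * cis y) by [].
have li s : s <= S -> line_integrable g s S 0 (2 * pi).
  by move=> sS; apply: (cderiv_line_integrable sS pi2_ge0) => x y hx _; exact (Hg s x y hx).
have per : cis (2 * pi) = cis 0 :> C.
  by rewrite /cis mulr_natl cos2pi sin2pi cos0 sin0.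
have eqr s : s <= S -> cint 0 (2 * pi) (fun t => k (r%:C * cis t)) =
    cint 0 (2 * pi) (fun t => k ((expR s)%:C * cis t)).
  move=> sS.
  have := goursat sS pi2_ge0 (fun x y hx _ => Hg s x y hx); rewrite /rect_int.
  have -> : (fun s0 => g (s0 +i* (2 * pi))%C) = (fun s0 => g (s0 +i* 0)%C).
    by apply/funext => t; rewrite !E per.
  have -> : (fun t => g (S +i* t)%C) = (fun t => k (r%:C * cis t)).
    by apply/funext => t; rewrite E eS.
  have -> : (fun t => g (s +i* t)%C) = (fun t => k ((expR s)%:C * cis t)).
    by apply/funext => t; rewrite E.
  have gen (A B D : C) : A + 'i%C * B - A - 'i%C * D = 0 -> B = D.
    have -> : A + 'i%C * B - A - 'i%C * D = 'i%C * (B - D) by ring.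
    move/eqP; rewrite mulf_eq0 subr_eq0 => /orP[|/eqP//].
    by rewrite eq_complex /= oner_eq0 andbF.
  exact: gen.
have hp : has_primitive 0 (2 * pi) (fun t => k (r%:C * cis t)).
  have [_ /(_ S)] := li S (lexx _); rewrite lexx => /(_ isT).
  have -> // : (fun t => g (S +i* t)%C) = (fun t => k (r%:C * cis t)).
  by apply/funext => t; rewrite E eS.
split; first exact: hp.
have hc (c : C) t : rderiv (fun s : R => c * s%:C) t c.
  have := rderivZ (k := c) (rderiv_real (@is_derive_id _ _ t 1)).
  by rewrite mulr1.
apply/eqP; rewrite -subr_eq0; apply/eqP.
apply: (@small_eq0 _ (2 * pi)%:C); first by rewrite ler0c pi2_ge0.
move=> e e0.
have /nbhs_ballP[d /= d0 Hd] : nbhs (0 : C^o) (fun z => `|k 0 - k z| < e).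
  exact (cvgC_distE k0 e0).
have dE : d = (complex.Re d)%:C.
  by move: d0; rewrite ltcE /= => /andP[/eqP]; case: (d) => ? ? /= ->.
have d0' : 0 < complex.Re d by rewrite -ltcR -dE.
(* On the circle of radius [expR s] the values of [k] are within [e] of [k 0]. *)
pose s := Num.min S (ln (complex.Re d / 2)).
have sS : s <= S by rewrite /s ge_min lexx.
have es : expR s < complex.Re d.
  apply: le_lt_trans (_ : complex.Re d / 2 < _); last by lra.
  have p0 : 0 < complex.Re d / 2 by lra.
  by rewrite -[leRHS](lnK (x := complex.Re d / 2)) ?posrE // ler_expR /s ge_min lexx orbT.
rewrite (eqr s sS).
have hp' : has_primitive 0 (2 * pi) (fun t => k ((expR s)%:C * cis t)).
  by have [_ /(_ s)] := li s sS; rewrite lexx => /(_ sS).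
have hk : has_primitive 0 (2 * pi) (fun _ : R => k 0).
  by exists (fun s : R => k 0 * s%:C) => t _; exact: hc.
have ck : cint 0 (2 * pi) (fun _ : R => k 0) = (2 * pi)%:C * k 0.
  rewrite (cintE pi2_ge0 (fun t _ => hc (k 0) t)) mulr0 subr0 mulrC //.
rewrite -ck -(cintB pi2_ge0 hp' hk).
have := cint_bound (M := e) pi2_ge0 (has_primitiveB hp' hk).
rewrite subr0; apply => t _; rewrite distrC ltW //.
apply: Hd; rewrite -ball_normE /ball_ /= sub0r normrN normrM norm_cis mulr1.
by rewrite ger0_norm ?ler0c ?expR_ge0 // dE ltcR.
Qed.

(** Means over the circle depend continuously on the integrand, which is how
    continuity and differentiability pass to derivatives below. *)
Lemma mean_diff_le (A B M : C) (K1 K2 : R -> C) :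
  has_primitive 0 (2 * pi) K1 -> has_primitive 0 (2 * pi) K2 ->
  cint 0 (2 * pi) K1 = (2 * pi)%:C * A -> cint 0 (2 * pi) K2 = (2 * pi)%:C * B ->
  (forall t, 0 <= t <= 2 * pi -> `|K1 t - K2 t| <= M) -> `|A - B| <= M.
Proof.
move=> h1 h2 e1 e2 H; have := cint_bound pi2_ge0 (has_primitiveB h1 h2) H.
rewrite (cintB pi2_ge0 h1 h2) e1 e2 -mulrBr subr0 normrM ger0_norm ?ler0c ?pi2_ge0 //.
by rewrite mulrC ler_pM2r // ltcR mulr_gt0 ?pi_gt0.
Qed.

End CircleMean.

Section Holomorphic.
Context {R : realType} {n : nat}.
Local Notation C := (R[i]).
Local Notation Cn := (Cn R n).
Implicit Types (f : Cn -> C) (U : set Cn) (z v w : Cn) (l : C).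

Local Opaque cint.

Definition is_cdir f z v l :=
  (h^-1 * (f (z + h *: v) - f z) : C^o) @[h --> (0 : C^o)^'] --> (l : C^o).

(** Continuity with complex directional derivatives; unlike Frechet
    differentiability this class is stable under directional derivation by an
    elementary argument. *)
Definition gateaux_holo U f :=
  (forall z, U z -> {for z, continuous (f : Cn -> C^o)}) /\
  (forall z v, U z -> is_cdir f z v (ddir v f z)).

Lemma cvg_dnbhs_scale (c : C) : c != 0 ->
  (s%:C * c : C^o) @[s --> (0 : R)^'] --> (0 : C^o)^'.
Proof.
move=> c0 P HP.
have HP0 : \forall h \near (0 : C^o), h != 0 -> P h by exact HP.
have ct : (s%:C : C^o) @[s --> (0 : R)] --> (0%:C : C^o).
  by apply: (@cvg_real_complex _ _ _ _ id); exact: cvg_id.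
pose proof (cvgC_mul ct (cvgC_cst c)) as ct'; rewrite mul0r in ct'.
have H := ct' _ HP0.
have H1 : \forall s \near (0 : R), s%:C * c != 0 -> P (s%:C * c) by exact H.
have H2 : \forall s \near (0 : R), s != 0 -> P (s%:C * c).
  apply: filterS H1 => s hs s0; apply: hs; rewrite mulf_neq0 //.
  by rewrite eq_complex /= negb_and s0.
exact H2.
Qed.

Lemma is_cdir_ray f z w (h l : C) (t : R) : is_cdir f (z + (t%:C * h) *: w) w l ->
  rderiv (fun s => f (z + (s%:C * h) *: w)) t (h * l).
Proof.
move=> H; have [->|h0] := eqVneq h 0.
  rewrite mul0r; have := rderiv_cst (f z) t.
  by apply: (rderiv_eq _).1 => s; rewrite mulr0 scale0r addr0.
pose proof (cvg_comp _ _ (cvg_dnbhs_scale h0) H) as H'.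
pose proof (cvgC_mul (cvgC_cst (F := (0:R)^') h) H') as H2.
apply: (cvgC_near _ H2).
have n0 : \forall s \near (0 : R)^', s != 0 by exact: nbhs_dnbhs_neq.
apply: filterS n0 => s s0 /=.
have sc : s%:C != 0 :> C by rewrite eq_complex /= negb_and s0.
rewrite -addrA -scalerDl -mulrDl -rmorphD mulrA invfM; congr (_ * _).
by rewrite fmorphV /= mulrCA divff // mulr1.
Qed.

Lemma is_cdir_ddir f z v l : is_cdir f z v l -> is_ddir f z v l.
Proof.
move=> H; have := @is_cdir_ray f z v 1 l 0; rewrite mul0r scale0r addr0 mul1r => /(_ H).
by apply: (rderiv_eq _).1 => s; rewrite mulr1.
Qed.

Lemma is_cdir_line f z v (a l : C) : is_cdir f (z + a *: v) v l ->
  cderiv (fun b => f (z + b *: v)) a l.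
Proof.
move=> H; apply: cderivP; apply: (cvgC_near _ H).
by apply: nearWC => h; rewrite scalerDl addrA.
Qed.

Lemma continuous_circle z v (r t : R) :
  (z + (r%:C * cis s) *: v) @[s --> t] --> z + (r%:C * cis t) *: v.
Proof.
have c1 : (cis s : C^o) @[s --> t] --> (cis t : C^o) by exact (rderiv_continuous (rderiv_cis t)).
pose proof (cvgC_mul (cvgC_cst (F := nbhs t) r%:C) c1) as c2.
apply: (@cvgD C Cn); first exact: cvg_cst.
by apply: (@cvgZ C Cn); [exact c2|exact: cvg_cst].
Qed.

(** The difference quotient is holomorphic off the center and continuous
    there, so its mean over the circle is the derivative. *)
Lemma cauchy_derivative U f z v (r : R) : 0 < r -> gateaux_holo U f ->
  (forall a : C, `|a| <= r%:C -> U (z + a *: v)) ->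
  let K t := (f (z + (r%:C * cis t) *: v) - f z) * (r%:C * cis t)^-1 in
  has_primitive 0 (2 * pi) K /\ cint 0 (2 * pi) K = (2 * pi)%:C * ddir v f z.
Proof.
move=> r0 [cf df] HU K.
pose u (a : C) := f (z + a *: v).
have Hu a : `|a| <= r%:C -> exists l, cderiv u a l.
  by move=> ar; eexists; exact (is_cdir_line (df _ v (HU a ar))).
pose k (a : C) := if a == 0 then ddir v f z else (u a - f z) * a^-1.
have r0' : 0 < r%:C :> C by rewrite ltcR.
have U0 : U z by have := HU 0; rewrite normr0 scale0r addr0; apply; exact: ltW.
have [||hp e] := @circle_mean R k r r0.
- move=> a; rewrite normr_gt0 => a0 ar; have [l Hl] := Hu a ar.
  have [q Hq] := cderiv_inv a0.
  have [q' Hq'] := cderivM (cderiv_subr (f z) Hl) Hq.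
  exists q'; apply: cderiv_near Hq'.
  pose proof (cvgC_distE (cvg_idC a)) as na.
  have na' : \forall w \near (a : C^o), `|a - w| < `|a| by apply: na; rewrite normr_gt0.
  apply: filterS na' => w hw; rewrite /k ifF //.
  by apply: contraTF hw => /eqP ->; rewrite subr0 ltxx.
- rewrite /k eqxx; apply: (cvgC_distI (F := nbhs (0 : C^o))) => e e0.
  pose proof (cvgC_distE (df z v U0) e0) as H.
  have H0 : \forall h \near (0 : C^o), h != 0 -> `|ddir v f z - h^-1 * (f (z + h *: v) - f z)| < e.
    by exact H.
  apply: filterS H0 => h; case: eqVneq => [_ _|_ /(_ isT)]; first by rewrite subrr normr0.
  by rewrite [h^-1 * _]mulrC.
have E : (fun t => k (r%:C * cis t)) = K.
  apply/funext => t; rewrite /k ifF //; apply/negbTE.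
  by rewrite mulf_neq0 ?cis_neq0 // gt_eqF.
by rewrite E in hp e; rewrite e /k eqxx.
Qed.

Lemma cauchy_radius U z v : open U -> U z -> exists (r : R) (d : C),
  [/\ 0 < r, 0 < d & forall y a, ball z d y -> `|a| <= r%:C -> U (y + a *: v)].
Proof.
move=> oU Uz; have /nbhs_ballP[d /= d0 Hd] := open_nbhs_nbhs (conj oU Uz).
have d2 : 0 < d / 2 by rewrite divr_gt0.
have [r r0 hr] := small_real d2 (normr_ge0 v).
exists r, (d / 2); split=> // y a; rewrite -ball_normE /ball_ /= => hy ha.
apply: Hd; rewrite -ball_normE /ball_ /= opprD addrA.
apply: le_lt_trans (ler_normB _ _) _; rewrite normrZ [d]splitr.
by apply: ltr_leD hy _; apply: ltW; apply: le_lt_trans hr; rewrite ler_wpM2r.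
Qed.

Lemma near_compact_circle (I : Type) (F : set_system I) (FF : Filter F)
    (P : I -> Cn -> Prop) z v (r : R) :
  (forall t, 0 <= t <= 2 * pi ->
     exists2 A, F A & \forall y \near (z + (r%:C * cis t) *: v), forall i, A i -> P i y) ->
  \forall i \near F, forall t, 0 <= t <= 2 * pi -> P i (z + (r%:C * cis t) *: v).
Proof.
move=> H.
have HK := (compact_near_coveringP _).1 (@segment_compact R 0 (2 * pi)) I F
  (fun i t => P i (z + (r%:C * cis t) *: v)) FF.
apply: filterS (HK _) => [i Hi t ht|t /=]; first by apply: Hi; rewrite /= in_itv.
rewrite in_itv => /= ht; have [A FA HA] := H t ht.
exists ([set t' | forall i, A i -> P i (z + (r%:C * cis t') *: v)], A).
  by split; [exact: (continuous_circle (z := z) (v := v) (r := r) (t := t) HA)|exact: FA].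
by move=> [t' i] /= [h1 h2]; exact: h1.
Qed.

Lemma norm_circle (r t : R) : 0 < r -> `|r%:C * cis t : C| = r%:C.
Proof. by move=> r0; rewrite normrM norm_cis mulr1 ger0_norm // ler0c ltW. Qed.

Lemma nbhs_Filter z : Filter (nbhs z).
Proof. exact: nbhs_filter. Qed.

Lemma continuous_dist f z : {for z, continuous (f : Cn -> C^o)} ->
  forall e : C, 0 < e -> nbhs z (fun y => `|f z - f y| < e).
Proof. exact (@cvgC_distE R Cn (nbhs z) (nbhs_Filter z) f (f z)). Qed.

Lemma continuous_distI f z :
  (forall e : C, 0 < e -> nbhs z (fun y => `|f z - f y| < e)) ->
  {for z, continuous (f : Cn -> C^o)}.
Proof. exact (@cvgC_distI R Cn (nbhs z) (nbhs_Filter z) f (f z)). Qed.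

Lemma near_ballE z (P : set Cn) : nbhs z P -> exists2 d : C, 0 < d & ball z d `<=` P.
Proof. by move=> /nbhs_ballP[d d0 H]; exists d. Qed.

Lemma near_ball z (d : C) : 0 < d -> nbhs z (ball z d).
Proof. by move=> d0; apply: nbhsx_ballx. Qed.

Lemma uniform_translate U f z v (r : R) (e : C) : 0 < r -> 0 < e ->
  (forall y, U y -> {for y, continuous (f : Cn -> C^o)}) ->
  (forall a : C, `|a| <= r%:C -> U (z + a *: v)) ->
  \forall y \near z, forall t, 0 <= t <= 2 * pi ->
    `|f (y + (r%:C * cis t) *: v) - f (z + (r%:C * cis t) *: v)| < e.
Proof.
move=> r0 e0 cf HU.
have e2 : 0 < e / 2 by rewrite divr_gt0.
have := @near_compact_circle Cn (nbhs z) (nbhs_Filter z) (fun y p => `|f (p + (y - z)) - f p| < e) z v r.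
move=> H; apply: filterS (H _) => [y Hy t ht|t ht].
  by have := Hy t ht; rewrite [z + _ + (y - z)]addrAC [z + (y - z)]addrC subrK.
set p := z + _.
have Up : U p by apply: HU; rewrite norm_circle.
clearbody p.
have hp := continuous_dist (cf p Up) e2.
have [d d0 Hd] := near_ballE hp.
have d2 : 0 < d / 2 by rewrite divr_gt0.
exists (ball z (d / 2)); first exact (near_ball z d2).
apply: filterS (near_ball p d2) => q; rewrite -!ball_normE /ball_ /= => hq y hy.
have h1 : `|f p - f q| < e / 2.
  apply: Hd; rewrite -ball_normE /ball_ /=; apply: lt_trans hq _.
  by rewrite ltr_pdivrMr // ltr_pMr // ltr1n.
have h2 : `|f p - f (q + (y - z))| < e / 2.
  apply: Hd; rewrite -ball_normE /ball_ /= opprD addrA [d]splitr.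
  apply: le_lt_trans (ler_normB _ _) _; apply: ltrD; first exact: hq.
  by rewrite distrC.
have -> : f (q + (y - z)) - f q = (f p - f q) - (f p - f (q + (y - z))).
  by move: (f p) (f q) (f (q + _)) => A B D; ring.
by apply: le_lt_trans (ler_normB _ _) _; rewrite [e]splitr; exact: ltrD.
Qed.

(** The integrand of [cauchy_derivative] depends uniformly continuously on the
    center. *)
Lemma ddir_continuous U f z v : open U -> gateaux_holo U f -> U z ->
  {for z, continuous (ddir v f : Cn -> C^o)}.
Proof.
move=> oU Hf Uz; have [r [d [r0 d0 Hd]]] := cauchy_radius v oU Uz.
have rC : 0 < r%:C :> C by rewrite ltcR.
apply: continuous_distI => e e0.
have e4 : 0 < e * r%:C / 4%:R by rewrite divr_gt0 // mulr_gt0.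
have Uc y (hy : ball z d y) a : `|a| <= r%:C -> U (y + a *: v) by exact: Hd.
have zz : ball z d z by exact: ballxx.
have n1 := uniform_translate r0 e4 Hf.1 (Uc z zz).
have n2 := continuous_dist (Hf.1 z Uz) e4.
have n3 := near_ball z d0.
apply: filterS (filterI n1 (filterI n2 n3)) => y [h1 [h2 h3]].
have [p1 c1] := cauchy_derivative r0 Hf (Uc z zz).
have [p2 c2] := cauchy_derivative r0 Hf (Uc y h3).
apply: (@le_lt_trans _ _ (e / 2)); last by rewrite ltr_pdivrMr // ltr_pMr // ltr1n.
apply: (mean_diff_le p1 p2 c1 c2) => t ht.
rewrite -mulrBl normrM normfV norm_circle // ler_pdivrMr //.
have := h1 t ht; move: (f (y + _)) (f (z + _)) (f z) (f y) h2 => A B D E hDE hAB.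
have -> : B - D - (A - E) = - ((A - B) + (D - E)) by ring.
rewrite normrN; apply: le_trans (ler_normD _ _) _.
apply: le_trans (lerD (ltW hAB) (ltW hDE)) _.
by rewrite le_eqVlt; apply/orP; left; apply/eqP; field.
Qed.

Arguments ddir_continuous {U f z} v _ _ _.

Lemma two_close (A B D E : C) : `|A - B| < E / 2 -> `|A - D| < E / 2 -> `|D - B| <= E.
Proof.
move=> h1 h2; have -> : D - B = (A - B) - (A - D) by ring.
by apply: le_trans (ler_normB _ _) _; rewrite [E]splitr; exact: lerD (ltW h1) (ltW h2).
Qed.

Lemma quotient_close (A B D F G H h E : C) : h != 0 ->
  `|A - B - h * G| <= E * `|h| -> `|D - F - h * H| <= E * `|h| ->
  `|G - H - h^-1 * (A - D - (B - F))| <= E + E.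
Proof.
move=> h0 h1 h2; have hn : 0 < `|h| by rewrite normr_gt0.
rewrite -(ler_pM2r hn) -normrM.
have -> : (G - H - h^-1 * (A - D - (B - F))) * h =
    (D - F - h * H) - (A - B - h * G) by field.
by apply: le_trans (ler_normB _ _) _; rewrite mulrDl; exact: lerD.
Qed.

(** By the mean value inequality along the ray from [y] in direction [w], where
    the derivative is continuous. *)
Lemma uniform_derivative U f z w (e : C) : open U -> gateaux_holo U f -> U z -> 0 < e ->
  exists2 A, nbhs (0 : C^o) A &
    \forall y \near z, forall h : C, A h ->
      `|f (y + h *: w) - f y - h * ddir w f y| <= e * `|h|.
Proof.
move=> oU Hf Uz e0; have e2 : 0 < e / 2 by rewrite divr_gt0.
have n1 := continuous_dist (ddir_continuous w oU Hf Uz) e2.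
have n2 := open_nbhs_nbhs (conj oU Uz).
have n12 := @filterI _ _ (nbhs_Filter z) _ _ n2 n1.
have [d d0 Hd] := near_ballE n12.
have d2 : 0 < d / 2 by rewrite divr_gt0.
have [r r0 hr] := small_real d2 (normr_ge0 w).
have rC : 0 < r%:C :> C by rewrite ltcR.
exists (ball (0 : C^o) r%:C); first exact (@nbhsx_ballx _ C^o 0 r%:C rC).
apply: filterS (near_ball z d2) => y; rewrite -!ball_normE /ball_ /= => hy h; rewrite sub0r normrN => hh.
have seg (t : R) : 0 <= t <= 1 -> U (y + (t%:C * h) *: w) /\
    `|ddir w f z - ddir w f (y + (t%:C * h) *: w)| < e / 2.
  move=> /andP[t0 t1]; apply: Hd; rewrite -ball_normE /ball_ /= opprD addrA.
  apply: le_lt_trans (ler_normB _ _) _; rewrite [d]splitr.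
  apply: ltrD; first exact: hy.
  rewrite normrZ; apply: le_lt_trans hr; rewrite ler_wpM2r // normrM ger0_norm ?ler0c //.
  apply: le_trans (ltW hh); rewrite -[leRHS]mul1r ler_wpM2r // -[1]/(1%:C) lecR //.
have i00 : 0 <= (0 : R) <= 1 by rewrite lexx ler01.
have [_ s0] := seg 0 i00; rewrite mul0r scale0r addr0 in s0.
pose G (t : R) := f (y + (t%:C * h) *: w) - t%:C * (h * ddir w f y).
have HG (t : R) : 0 <= t <= 1 ->
    rderiv G t (h * ddir w f (y + (t%:C * h) *: w) - h * ddir w f y).
  move=> ht; have [Ut _] := seg t ht.
  have D1 := is_cdir_ray (Hf.2 _ w Ut).
  have D2 := rderivM (rderiv_real (@is_derive_id _ _ t 1)) (rderiv_cst (h * ddir w f y) t).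
  have := rderivB D1 D2; rewrite mulr0 addr0 mul1r; exact.
have := @rderiv_bound R G _ 0 1 (e * `|h|) ler01 HG.
rewrite subr0 mulr1.
have -> : G 1 - G 0 = f (y + h *: w) - f y - h * ddir w f y.
  rewrite /G !mul1r !mul0r scale0r addr0 subr0.
  by move: (f _) (f y) (ddir w f y) => A B D; ring.
apply=> t ht; have [_ s1] := seg t ht.
rewrite -mulrBr normrM mulrC ler_wpM2r //.
exact (two_close s0 s1).
Qed.

(** Differentiation under the integral sign of [cauchy_derivative]: by
    [uniform_derivative] the difference quotients of the integrand converge
    uniformly on the circle. *)
Lemma gateaux_holo_ddir U f v : open U -> gateaux_holo U f -> gateaux_holo U (ddir v f).
Proof.
move=> oU Hf; split=> [z Uz|z w Uz]; first exact (ddir_continuous v oU Hf Uz).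
suff [L HL] : exists L, is_cdir (ddir v f) z w L.
  by have := is_ddir_val (is_cdir_ddir HL) => ->.
have [r [d [r0 d0 Hd]]] := cauchy_radius v oU Uz.
have rC : 0 < r%:C :> C by rewrite ltcR.
have zz : ball z d z by exact: ballxx.
have Uc t : U (z + (r%:C * cis t) *: v) by apply: Hd => //; rewrite norm_circle.
pose KL t := (ddir w f (z + (r%:C * cis t) *: v) - ddir w f z) * (r%:C * cis t)^-1.
have pL : has_primitive 0 (2 * pi) KL.
  apply: primitive_segment pi2_ge0 _ => t _.
  have c1 := cvg_comp _ _ (continuous_circle (z := z) (v := v) (r := r) (t := t))
    (ddir_continuous w oU Hf (Uc t)).
  have cc : (cis s : C^o) @[s --> t] --> (cis t : C^o) by exact (rderiv_continuous (rderiv_cis t)).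
  pose proof (cvgC_mul (cvgC_cst (F := nbhs t) r%:C) cc) as c2.
  have n0 : r%:C * cis t != 0 :> C by rewrite mulf_neq0 ?cis_neq0 // gt_eqF.
  exact (cvgC_mul (cvgC_add c1 (cvgC_cst (- ddir w f z))) (cvgC_inv n0 c2)).
have pi0 : (2 * pi)%:C != 0 :> C by rewrite gt_eqF // ltcR mulr_gt0 ?pi_gt0.
pose L := (2 * pi)%:C^-1 * cint 0 (2 * pi) KL.
have cL : cint 0 (2 * pi) KL = (2 * pi)%:C * L by rewrite /L mulrA divff // mul1r.
exists L; apply: (cvgC_distI (F := (0 : C^o)^')) => e e0.
have e4 : 0 < e * r%:C / 4%:R by rewrite divr_gt0 // mulr_gt0.
have n1 : \forall h \near (0 : C^o), forall t, 0 <= t <= 2 * pi ->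
    `|f (z + (r%:C * cis t) *: v + h *: w) - f (z + (r%:C * cis t) *: v)
      - h * ddir w f (z + (r%:C * cis t) *: v)| <= (e * r%:C / 4%:R) * `|h|.
  apply: (@near_compact_circle C (nbhs (0 : C^o)) _ (fun h p =>
    `|f (p + h *: w) - f p - h * ddir w f p| <= (e * r%:C / 4%:R) * `|h|)).
  by move=> t _; exact (uniform_derivative w oU Hf (Uc t) e4).
have n2 : \forall h \near (0 : C^o),
    `|f (z + h *: w) - f z - h * ddir w f z| <= (e * r%:C / 4%:R) * `|h|.
  have [A A0 HA] := uniform_derivative w oU Hf Uz e4.
  by have HA' := nbhs_singleton HA; apply: filterS A0.
have n3 : \forall h \near (0 : C^o), ball z d (z + h *: w).
  have [q q0 hq] := small_real d0 (normr_ge0 w).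
  have qC : 0 < q%:C :> C by rewrite ltcR.
  apply: filterS (@nbhsx_ballx _ C^o 0 q%:C qC) => h.
  rewrite -!ball_normE /ball_ /= sub0r normrN opprD addrA subrr sub0r normrN normrZ => hh.
  by apply: le_lt_trans hq; rewrite ler_wpM2r // ltW.
have n4 : \forall h \near (0 : C^o), h != 0 ->
    `|L - h^-1 * (ddir v f (z + h *: w) - ddir v f z)| < e; last by exact n4.
apply: filterS (filterI n1 (filterI n2 n3)) => h [h1 [h2 h3]] h0.
have [p1 c1] := cauchy_derivative r0 Hf (fun a => Hd z a zz).
have [p2 c2] := cauchy_derivative r0 Hf (fun a => Hd (z + h *: w) a h3).
have [p3 c3] := cintZ h^-1 pi2_ge0 (has_primitiveB p2 p1).
rewrite (cintB pi2_ge0 p2 p1) c1 c2 -mulrBr mulrCA in c3.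
apply: (@le_lt_trans _ _ (e / 2)); last by rewrite ltr_pdivrMr // ltr_pMr // ltr1n.
apply: (mean_diff_le pL p3 cL c3) => t ht.
rewrite /KL -mulrBl mulrA -mulrBl normrM normfV norm_circle // ler_pdivrMr //.
have E : e / 2 * r%:C = e * r%:C / 4%:R + e * r%:C / 4%:R by field.
have := h1 t ht; rewrite [z + _ + h *: w]addrAC E => h4.
exact (quotient_close h0 h4 h2).
Qed.

Lemma gateaux_holo_Ck k U f : open U -> gateaux_holo U f -> Ck k U f.
Proof.
move=> oU; elim: k f => [|k IH] f Hf.
  by split=> [z Uz|]; [exact (Hf.1 z Uz)|exact I].
apply: (Ck_step (df := fun v => ddir v f) oU).
- by move=> z Uz; exact (Hf.1 z Uz).
- by move=> v z Uz; exact (is_cdir_ddir (Hf.2 z v Uz)).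
- by move=> v; apply: IH; exact: gateaux_holo_ddir.
Qed.

(** Complex differentiability gives the class [gateaux_holo], which is closed
    under directional derivation. *)
Lemma differentiable_Cinfty U f : open U ->
  (forall z, U z -> differentiable (f : Cn -> C^o) z) -> Cinfty U f.
Proof.
move=> oU df k; apply: gateaux_holo_Ck => //; split=> [z Uz|z v Uz].
  exact (differentiable_continuous (df z Uz)).
suff [l Hl] : exists l, is_cdir f z v l.
  by have := is_ddir_val (is_cdir_ddir Hl) => ->.
have /cvg_ex[/= l Hl] : derivable (f : Cn -> C^o) z v by exact (diff_derivable (df z Uz)).
by exists l; apply: (cvgC_eq _ Hl) => h /=; rewrite [h *: v + z]addrC.
Qed.

End Holomorphic.

(** * Smooth functions on a complex manifold *)
Section SmoothManifold.
Context {R : realType} {n : nat} {S : cmanifold R n}.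
Local Notation C := (R[i]).
Local Notation Cn := (Cn R n).
Implicit Types (W : set S) (f g : S -> C) (c : mchart S) (v w : Cn).

Local Opaque ddir.

(** The image is the preimage of [W] under the parametrization, within the open
    image of the chart. *)
Lemma chart_image_open W c : open W -> open (mcoord c @` (W `&` mdom c)).
Proof.
move=> oW; rewrite openE => z [x [Wx cx] <-].
have oi : open (mcoord c @` mdom c) by exact: mimage_open.
have ix : (mcoord c @` mdom c) (mcoord c x) by exists x.
have n1 := open_nbhs_nbhs (conj oi ix).
have n2 : nbhs (mcoord c x) (fun z => W (mparam c z)).
  have := @mparam_cont _ _ S c _ ix; apply.
  by rewrite mcoordK //; apply: open_nbhs_nbhs.
rewrite /interior; apply: filterS (@filterI _ _ (nbhs_Filter _) _ _ n1 n2) => z' [[y cy <-] /=].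
by rewrite mcoordK // => Wy; exists y.
Qed.

Arguments chart_image_open {W} c _.

Lemma chart_image_mem W c x : W x -> mdom c x ->
  (mcoord c @` (W `&` mdom c)) (mcoord c x).
Proof. by move=> Wx cx; exists x. Qed.

Lemma smooth_fun_sub W W' f : W' `<=` W -> smooth_fun W f -> smooth_fun W' f.
Proof.
move=> sW h c k; apply: Ck_sub (h c k) => z [x [Wx cx] <-].
by exists x => //; split=> //; exact: sW.
Qed.

Lemma smooth_fun_eq W f g : open W -> (forall x, W x -> f x = g x) ->
  smooth_fun W f -> smooth_fun W g.
Proof.
move=> oW fg h c k; apply: Ck_eq (h c k); first exact: chart_image_open.
by move=> z [x [Wx cx] <-]; rewrite /in_chart /= mcoordK // fg.
Qed.

Lemma smooth_fun_local W f :
  (forall x, W x -> exists2 W', W' x & smooth_fun W' f) -> smooth_fun W f.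
Proof.
move=> H c k; apply/Ck_pt => z [x [Wx cx] <-].
have [W' W'x h] := H x Wx.
have /Ck_pt := h c k; apply; exact: chart_image_mem.
Qed.

Lemma smooth_fun_cst W (k : C) : smooth_fun W (fun=> k).
Proof. by move=> c m; exact: Ck_cst. Qed.

Arguments smooth_fun_cst : clear implicits.

Lemma smooth_funD W f g : open W -> smooth_fun W f -> smooth_fun W g ->
  smooth_fun W (fun x => f x + g x).
Proof.
by move=> oW hf hg c k; exact (CkD (chart_image_open c oW) (hf c k) (hg c k)).
Qed.

Lemma smooth_funM W f g : open W -> smooth_fun W f -> smooth_fun W g ->
  smooth_fun W (fun x => f x * g x).
Proof.
by move=> oW hf hg c k; exact (CkM (chart_image_open c oW) (hf c k) (hg c k)).
Qed.

Lemma smooth_funV W f : open W -> (forall x, W x -> f x != 0) -> smooth_fun W f ->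
  smooth_fun W (fun x => (f x)^-1).
Proof.
move=> oW f0 hf c k; apply: CkV (hf c k); first exact: chart_image_open.
by move=> z [x [Wx cx] <-]; rewrite /in_chart /= mcoordK // f0.
Qed.

Lemma smooth_funN W f : open W -> smooth_fun W f -> smooth_fun W (fun x => - f x).
Proof.
move=> oW hf; apply: (smooth_fun_eq oW _ (smooth_funM oW (smooth_fun_cst W (-1)) hf)).
by move=> x _; rewrite mulN1r.
Qed.

Lemma smooth_fun_sum W (I : Type) (r : seq I) (P : pred I) (F : I -> S -> C) : open W ->
  (forall i, P i -> smooth_fun W (F i)) -> smooth_fun W (fun x => \sum_(i <- r | P i) F i x).
Proof.
move=> oW H; elim: r => [|i r IH].
  by apply: (smooth_fun_eq oW _ (smooth_fun_cst W 0)) => x _; rewrite big_nil.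
have [Pi|nPi] := boolP (P i).
  by apply: (smooth_fun_eq oW _ (smooth_funD oW (H i Pi) IH)) => x _; rewrite big_cons Pi.
by apply: (smooth_fun_eq oW _ IH) => x _; rewrite big_cons (negbTE nPi).
Qed.

Lemma smooth_fun_prod W (I : Type) (r : seq I) (F : I -> S -> C) : open W ->
  (forall i, smooth_fun W (F i)) -> smooth_fun W (fun x => \prod_(i <- r) F i x).
Proof.
move=> oW H; elim: r => [|i r IH].
  by apply: (smooth_fun_eq oW _ (smooth_fun_cst W 1)) => x _; rewrite big_nil.
by apply: (smooth_fun_eq oW _ (smooth_funM oW (H i) IH)) => x _; rewrite big_cons.
Qed.

Lemma smooth_fun_det W m (M : S -> 'M[C]_m) : open W ->
  (forall i j, smooth_fun W (fun x => M x i j)) -> smooth_fun W (fun x => \det (M x)).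
Proof.
move=> oW H; rewrite /determinant; apply: (smooth_fun_sum _ oW) => s _.
apply: (smooth_funM oW); first exact: smooth_fun_cst.
by apply: (smooth_fun_prod _ oW) => i; exact: H.
Qed.

(** Cramer's rule. *)
Lemma smooth_fun_invmx W m (M : S -> 'M[C]_m) : open W ->
  (forall i j, smooth_fun W (fun x => M x i j)) ->
  (forall x, W x -> M x \in unitmx) ->
  forall i j, smooth_fun W (fun x => invmx (M x) i j).
Proof.
move=> oW H HU i j.
have hd : smooth_fun W (fun x => (\det (M x))^-1).
  apply: (smooth_funV oW); last exact: smooth_fun_det.
  by move=> x Wx; have := HU x Wx; rewrite unitmxE unitfE.
have hc : smooth_fun W (fun x => cofactor (M x) j i).
  rewrite /cofactor; apply: (smooth_funM oW); first exact: smooth_fun_cst.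
  apply: smooth_fun_det => // a b.
  by apply: (smooth_fun_eq oW _ (H (lift j a) (lift i b))) => x _; rewrite !mxE.
apply: (smooth_fun_eq oW _ (smooth_funM oW hd hc)) => x Wx.
by rewrite /invmx HU // !mxE.
Qed.

Lemma holo_smooth_fun W f : open W -> holo_fun W f -> smooth_fun W f.
Proof.
by move=> oW hf c; apply: differentiable_Cinfty; [exact: chart_image_open|exact: hf].
Qed.

Lemma is_pderivE c v f x l :
  is_pderiv c v f x l = is_ddir (in_chart c f) (mcoord c x) v l.
Proof. exact: dquotE. Qed.

Lemma is_pderiv_val c v f x l : is_pderiv c v f x l -> pderiv c v f x = l.
Proof. by rewrite is_pderivE; exact: is_ddir_val. Qed.

Lemma pderivP W c v f x : smooth_fun W f -> W x -> mdom c x ->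
  is_pderiv c v f x (pderiv c v f x).
Proof.
move=> hf Wx cx; rewrite is_pderivE; exact (Ck_ddirP v (hf c 1%N) (chart_image_mem Wx cx)).
Qed.

Lemma near_in_chart W c x (P : S -> Prop) : open W -> W x -> mdom c x ->
  (forall y, W y -> mdom c y -> P y) ->
  \forall z \near mcoord c x, P (mparam c z) /\ mcoord c (mparam c z) = z.
Proof.
move=> oW Wx cx H.
have := open_nbhs_nbhs (conj (chart_image_open c oW) (chart_image_mem Wx cx)).
apply: (@filterS _ _ (nbhs_Filter _)) => z [y [Wy cy] <-].
by rewrite mcoordK //; split; [exact: H|].
Qed.

Lemma is_pderiv_eq W c v f g x l : open W -> W x -> mdom c x ->
  (forall y, W y -> f y = g y) -> is_pderiv c v f x l -> is_pderiv c v g x l.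
Proof.
move=> oW Wx cx fg; rewrite !is_pderivE; apply: is_ddir_near.
have := near_in_chart oW Wx cx (fun y Wy _ => fg y Wy).
by apply: (@filterS _ _ (nbhs_Filter _)) => z [].
Qed.

Lemma is_pderiv_cst c v (k : C) x : is_pderiv c v (fun=> k) x 0.
Proof. rewrite is_pderivE; exact: rderiv_cst. Qed.

Lemma is_pderivD c v f g x l m : is_pderiv c v f x l -> is_pderiv c v g x m ->
  is_pderiv c v (fun y => f y + g y) x (l + m).
Proof. by rewrite !is_pderivE; exact: rderivD. Qed.

Lemma is_pderivM c v f g x l m : mdom c x -> is_pderiv c v f x l -> is_pderiv c v g x m ->
  is_pderiv c v (fun y => f y * g y) x (l * g x + f x * m).
Proof.
move=> cx; rewrite !is_pderivE => h1 h2; have := rderivM h1 h2.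
by rewrite /in_chart /= scale0r addr0 mcoordK.
Qed.

Lemma is_pderiv_conj c v f x l : is_pderiv c v f x l ->
  is_pderiv c v (fun y => (f y)^*) x (l^*).
Proof. by rewrite !is_pderivE; exact: rderiv_conjC. Qed.

Lemma pderivC W c v w f x : open W -> smooth_fun W f -> W x -> mdom c x ->
  pderiv c v (pderiv c w f) x = pderiv c w (pderiv c v f) x.
Proof.
move=> oW hf Wx cx.
have e u u' : pderiv c u (pderiv c u' f) x = ddir u (ddir u' (in_chart c f)) (mcoord c x).
  rewrite {1}/pderiv; apply: ddir_near.
  have := near_in_chart oW Wx cx (fun _ _ _ => I).
  by apply: (@filterS _ _ (nbhs_Filter _)) => z [_ e]; rewrite /in_chart /= /pderiv e.
rewrite !e; exact: (ddirC _ _ (chart_image_open c oW) (hf c 2%N) (chart_image_mem Wx cx)).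
Qed.

End SmoothManifold.

Arguments smooth_fun_cst {R n S} W k.

(** * Quotients of modules and the enveloping algebra *)
Section LinearQuotient.
Context {K : nzRingType} {V : lmodType K} (G : set V).

Lemma lspan_sub u : G u -> lspan G u.
Proof. by move=> Gu P _; exact. Qed.

Lemma pi_linear k u v :
  \pi_(lquot G) (k *: u + v) = k *: (\pi_(lquot G) u : lquot G) + \pi_(lquot G) v.
Proof. by rewrite lquot_piD lquot_piZ. Qed.

Lemma pi_repr (x : lquot G) : \pi_(lquot G) (repr x) = x.
Proof. exact: reprK. Qed.

Lemma lquot_ind (P : lquot G -> Prop) : (forall u, P (\pi_(lquot G) u)) -> forall x, P x.
Proof. by move=> H x; rewrite -[x]pi_repr. Qed.

(** The way in which relations are transported: a linear map that sends relations
    to consequences of relations descends to the quotients. *)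
Lemma lspan_map (V' : lmodType K) (G' : set V') (f : V -> V') :
  (forall k u v, f (k *: u + v) = k *: f u + f v) ->
  (forall u, G u -> lspan G' (f u)) -> forall u, lspan G u -> lspan G' (f u).
Proof.
move=> fl fG u Gu; apply: (Gu (fun u => lspan G' (f u))) => //; split=> [|k a b ha hb] /=.
  by have := fl (-1) 0 0; rewrite scaler0 addr0 scaleN1r addNr => ->; exact: lspan0.
by rewrite fl; exact: lspanP.
Qed.

End LinearQuotient.

Section EnvelopingAlgebraTheory.
Context {K : comNzRingType} {L : lmodType K} (br : L -> L -> L).
Local Notation T := (malg (fmonom L) K).
Local Notation U := (uea br).
Local Notation pi := (\pi_(lquot (uea_rel br))).
Implicit Types (s t : T) (x y z : U).

Lemma malg_scaleU (k x : K) (m : fmonom L) : k *: mkmalgU m x = mkmalgU m (k * x) :> T.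
Proof. by apply/malgP => m'; rewrite mcoeffZ !mcoeffU mulrnAr. Qed.

Lemma malg_scaleAr (k : K) s t : s * (k *: t) = k *: (s * t).
Proof.
rewrite (malgMEw (fsubset_refl _) (msuppZ_le k t)) (malgMEw (fsubset_refl _) (fsubset_refl _)).
rewrite scaler_sumr; apply: eq_bigr => i _; rewrite scaler_sumr; apply: eq_bigr => j _.
by rewrite mcoeffZ malg_scaleU mulrCA.
Qed.

Lemma mulA3 (A : pzRingType) (s x d y : A) : s * (x * d * y) = s * x * d * y.
Proof. by rewrite !mulrA. Qed.

Lemma mulBB (A : pzRingType) (a b c d : A) : a * b - c * d = a * (b - d) + (a - c) * d.
Proof. by rewrite mulrBr mulrBl subrKA. Qed.

(** The relations are closed under multiplication on both sides by free words, so
    that their span is an ideal. *)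
Lemma uea_rel_mull s t : lspan (uea_rel br) t -> lspan (uea_rel br) (s * t).
Proof.
apply: lspan_map => [k u v|u]; first by rewrite mulrDr malg_scaleAr.
by case=> [x k a b y|x a b y]; rewrite mulA3;
  [exact (lspan_sub (UeaLinear br (s * x) k a b y))|exact (lspan_sub (UeaBracket br (s * x) a b y))].
Qed.

Lemma uea_rel_mulr s t : lspan (uea_rel br) t -> lspan (uea_rel br) (t * s).
Proof.
apply: (lspan_map (f := fun t => t * s)) => [k u v|u]; first by rewrite mulrDl scalerAl.
by case=> [x k a b y|x a b y]; rewrite -mulrA;
  [exact (lspan_sub (UeaLinear br x k a b (y * s)))|exact (lspan_sub (UeaBracket br x a b (y * s)))].
Qed.

Lemma uea_mulE s t : uea_mul (pi s : U) (pi t : U) = pi (s * t).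
Proof.
apply/lquot_eqP; rewrite mulBB; apply: lspanD.
  by apply: uea_rel_mull; apply/lquot_eqP; exact: pi_repr.
by apply: uea_rel_mulr; apply/lquot_eqP; exact: pi_repr.
Qed.

Local Opaque uea_mul.

Lemma uea_ind (P : U -> Prop) : (forall t, P (pi t)) -> forall x, P x.
Proof. exact: lquot_ind. Qed.

Lemma uea_mulA x y z : uea_mul x (uea_mul y z) = uea_mul (uea_mul x y) z.
Proof.
by elim/uea_ind: x => x; elim/uea_ind: y => y; elim/uea_ind: z => z; rewrite !uea_mulE mulrA.
Qed.

Lemma uea_mul_linear x k y z : uea_mul x (k *: y + z) = k *: uea_mul x y + uea_mul x z.
Proof.
elim/uea_ind: x => x; elim/uea_ind: y => y; elim/uea_ind: z => z.
by rewrite -pi_linear 3!uea_mulE mulrDr malg_scaleAr pi_linear.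
Qed.

Lemma uea_mul_linearl x k y z : uea_mul (k *: y + z) x = k *: uea_mul y x + uea_mul z x.
Proof.
elim/uea_ind: x => x; elim/uea_ind: y => y; elim/uea_ind: z => z.
by rewrite -pi_linear 3!uea_mulE mulrDl -scalerAl pi_linear.
Qed.

Lemma uea_mul0 x : uea_mul x 0 = 0.
Proof. by have := uea_mul_linear x (-1) 0 0; rewrite scaler0 addr0 scaleN1r addNr. Qed.

Lemma uea_mulB x y z : uea_mul x (y - z) = uea_mul x y - uea_mul x z.
Proof. by have := uea_mul_linear x (-1) z y; rewrite !scaleN1r addrC [X in _ = X]addrC. Qed.

Lemma uea_mul1 x : uea_mul (uea_one br) x = x.
Proof. by elim/uea_ind: x => x; rewrite uea_mulE mul1r. Qed.

Lemma uea_mulr1 x : uea_mul x (uea_one br) = x.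
Proof. by elim/uea_ind: x => x; rewrite uea_mulE mulr1. Qed.

Lemma uea_gen_linear k a b : uea_gen br (k *: a + b) = k *: uea_gen br a + uea_gen br b.
Proof.
rewrite /uea_gen -pi_linear; apply/lquot_eqP; apply: lspan_sub.
by have := UeaLinear br 1 k a b 1; rewrite mul1r mulr1 opprD addrA.
Qed.

Lemma uea_gen0 : uea_gen br 0 = 0.
Proof.
have := uea_gen_linear 1 0 0; rewrite !scale1r addr0 => /eqP.
by rewrite -subr_eq subrr => /eqP.
Qed.

Lemma uea_bracket a b :
  uea_mul (uea_gen br a) (uea_gen br b) =
  uea_mul (uea_gen br b) (uea_gen br a) + uea_gen br (br a b).
Proof.
rewrite /uea_gen !uea_mulE -[X in _ = X + _]scale1r -pi_linear scale1r.
apply/lquot_eqP; apply: lspan_sub.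
by have := UeaBracket br 1 a b 1; rewrite mul1r mulr1 opprD addrA.
Qed.

(** An element whose brackets vanish is central: the enveloping algebra is
    spanned by words in the generators. *)
Lemma uea_central c x : (forall a, br c a = 0) ->
  uea_mul (uea_gen br c) x = uea_mul x (uea_gen br c).
Proof.
move=> hc.
have comm a : uea_mul (uea_gen br c) (uea_gen br a) = uea_mul (uea_gen br a) (uea_gen br c).
  by rewrite uea_bracket hc uea_gen0 addr0.
have asc (g y z : U) : uea_mul g y = uea_mul y g -> uea_mul g z = uea_mul z g ->
    uea_mul g (uea_mul y z) = uea_mul (uea_mul y z) g.
  move=> h1 h2; exact (etrans (uea_mulA g y z) (etrans (congr1 (fun w => uea_mul w z) h1)
    (etrans (esym (uea_mulA y g z)) (etrans (congr1 (uea_mul y) h2) (uea_mulA y z g))))).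
have lin (g y z : U) k : uea_mul g y = uea_mul y g -> uea_mul g z = uea_mul z g ->
    uea_mul g (k *: y + z) = uea_mul (k *: y + z) g.
  by move=> h1 h2; rewrite uea_mul_linear uea_mul_linearl h1 h2.
have word (m : fmonom L) : uea_mul (uea_gen br c) (pi (mkmalgU m 1)) =
    uea_mul (pi (mkmalgU m 1)) (uea_gen br c).
  case: m; elim=> [|a m IH].
    have -> : mkmalgU (FMonom [::]) (1 : K) = 1 :> T.
      by rewrite -mpolyC1E; congr mkmalgU; apply: val_inj; rewrite /= fm1.
    by rewrite -[pi 1]/(uea_one br) uea_mul1 uea_mulr1.
  have -> : mkmalgU (FMonom (a :: m)) (1 : K) = free_gen a * mkmalgU (FMonom m) 1 :> T.
    rewrite malgM_def fgmulUU mul1r; congr mkmalgU.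
    by apply: val_inj; rewrite /= fmM fmU.
  rewrite -uea_mulE -[pi (free_gen a)]/(uea_gen br a).
  exact: asc (comm a) IH.
have z0 : uea_mul (uea_gen br c) 0 = 0.
  by have := uea_mul_linear (uea_gen br c) (-1) 0 0; rewrite scaler0 addr0 scaleN1r addNr.
have z1 : uea_mul 0 (uea_gen br c) = 0.
  by have := uea_mul_linearl (uea_gen br c) (-1) 0 0; rewrite scaler0 addr0 scaleN1r addNr.
elim/uea_ind: x => x; rewrite [x]monalgE.
elim/big_ind: _ => [|u v hu hv|m _].
- have -> : pi 0 = 0 :> U by [].
  by rewrite z0 z1.
- have -> : pi (u + v) = 1 *: (pi u : U) + pi v by rewrite -pi_linear scale1r.
  exact (lin _ _ _ _ hu hv).
- have -> : mkmalgU m (mcoeff m x) = (mcoeff m x) *: mkmalgU m 1 :> T by rewrite malg_scaleU mulr1.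
  have -> : pi ((mcoeff m x) *: mkmalgU m 1) = (mcoeff m x) *: (pi (mkmalgU m 1) : U) + 0.
    by rewrite addr0 lquot_piZ.
  exact (lin _ _ _ _ (word m) (etrans z0 (esym z1))).
Qed.

End EnvelopingAlgebraTheory.

(** * The Fock space *)
Section FockTheory.
Context {K : fieldType} {H : vectType K} (form : H -> H -> K) (F : {vspace H}).
Hypothesis form0l : forall a, form 0 a = 0.
Local Notation br := (heis_br form).
Local Notation U := (uea br).
Local Notation gen := (uea_gen br).
Local Notation hgen a := (uea_gen br ((a, 0) : @heis K H)).
Local Notation Fk := (fock form F).
Local Notation pi := (\pi_(lquot (@fock_rel K H form F))).
Implicit Types (x y : U) (u w : Fk) (a b : H).

Local Opaque uea_mul uea_gen uea.

Lemma fock_ind (P : Fk -> Prop) : (forall x, P (pi x)) -> forall u, P u.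
Proof. exact: lquot_ind. Qed.

(** The span of the relations is a left ideal, so that left multiplication
    descends. *)
Lemma fock_actE x y : fock_act x (pi y : Fk) = pi (uea_mul x y).
Proof.
apply/lquot_eqP; rewrite -uea_mulB.
have hG : forall v : U, fock_rel F v -> lspan (fock_rel F) (uea_mul x v).
  move=> _ [y' f l fF]; rewrite uea_mulB uea_mulA.
  have -> : uea_mul x (l *: y') = l *: uea_mul x y'.
    by rewrite -[l *: y']addr0 uea_mul_linear uea_mul0 addr0.
  exact: (lspan_sub (FockRel (uea_mul x y') l fF)).
apply: (lspan_map (uea_mul_linear x) hG).
by apply/lquot_eqP; exact: pi_repr.
Qed.

Lemma fock_act_linear x k u w :
  fock_act x (k *: u + w) = k *: fock_act x u + fock_act x w.
Proof.
elim/fock_ind: u => y; elim/fock_ind: w => z.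
exact (etrans (congr1 (fock_act x) (esym (pi_linear _ k y z)))
  (etrans (fock_actE x _) (etrans (congr1 (fun t => pi t) (uea_mul_linear x k y z))
  (etrans (pi_linear _ k _ _)
    (esym (congr2 (fun s t => k *: s + t) (fock_actE x y) (fock_actE x z))))))).
Qed.

Lemma fock_act_linearl u k x y :
  fock_act (k *: x + y) u = k *: fock_act x u + fock_act y u.
Proof. elim/fock_ind: u => z.
exact (etrans (fock_actE _ z) (etrans (congr1 (fun t => pi t) (uea_mul_linearl z k x y))
  (etrans (pi_linear _ k _ _)
    (esym (congr2 (fun s t => k *: s + t) (fock_actE x z) (fock_actE y z)))))). Qed.

Lemma fock_act_mul x y u : fock_act (uea_mul x y) u = fock_act x (fock_act y u).
Proof. by elim/fock_ind: u => z; rewrite 3!fock_actE uea_mulA. Qed.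

(** The central elements act through the character, after being moved to the
    right. *)
Lemma fock_act_scalar (l : K) u : fock_act (gen ((0, l) : @heis K H)) u = l *: u.
Proof.
elim/fock_ind: u => z; rewrite fock_actE uea_central; last first.
  by move=> a; rewrite /heis_br /= form0l.
have := FockRel (form := form) z l (mem0v F) => h.
exact (etrans ((lquot_eqP _ _ _).2 (lspan_sub h)) (lquot_piZ _ l z)).
Qed.

Lemma fock_rho_linear (a : H) k u w :
  fock_rho a (k *: u + w) = k *: fock_rho a u + fock_rho a w :> Fk.
Proof. exact: fock_act_linear. Qed.

Lemma fock_rho_linearl u k a b :
  fock_rho (k *: a + b) u = k *: fock_rho a u + fock_rho b u :> Fk.
Proof.
rewrite /fock_rho -fock_act_linearl -uea_gen_linear; congr (fock_act (gen _) u).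
by congr pair; rewrite /= scaler0 addr0.
Qed.

Lemma fock_rho_comm a b u :
  fock_rho a (fock_rho b u) = fock_rho b (fock_rho a u) + form a b *: u :> Fk.
Proof.
rewrite /fock_rho -!fock_act_mul uea_bracket -[X in X + _]scale1r fock_act_linearl scale1r.
by rewrite fock_act_scalar.
Qed.

Lemma fock_rho_vac a : a \in F -> fock_rho a (fock_vac form F) = 0.
Proof.
move=> aF; rewrite /fock_rho /fock_vac fock_actE uea_mulr1.
have := FockRel (form := form) (uea_one br) 0 aF; rewrite scale0r subr0 uea_mul1 => h.
by apply/lquot_eqP; rewrite subr0; exact: lspan_sub.
Qed.

End FockTheory.

(** * Linear algebra of one fiber *)
Section Permanent.
Context {K : comNzRingType}.

(** A permutation is determined by its value at 0 and the permutation that it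
    induces on the rest. *)
Lemma permanent_expand n (A : 'I_n.+1 -> 'I_n.+1 -> K) :
  \sum_(s : 'S_n.+1) \prod_i A i (s i) =
  \sum_j A ord0 j * \sum_(s : 'S_n) \prod_i A (lift ord0 i) (lift j (s i)).
Proof.
pose h (p : 'I_n.+1 * 'S_n) := lift_perm ord0 p.1 p.2.
have hi : injective h.
  move=> [j s] [j' s'] e.
  have /= jj := congr1 (fun t : 'S_n.+1 => t ord0) e; rewrite /h !lift_perm_id /= in jj.
  rewrite -jj in e *; congr pair; apply/permP => k.
  have := congr1 (fun t : 'S_n.+1 => t (lift ord0 k)) e.
  by rewrite /h /= !lift_perm_lift => /lift_inj.
have hb : bijective h.
  by apply: inj_card_bij hi _; rewrite card_prod card_ord !card_Sn factS.
rewrite (reindex h (onW_bij _ hb)) /=; under [RHS]eq_bigr do rewrite big_distrr.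
rewrite pair_bigA; apply: eq_bigr => -[j s] _ /=.
rewrite big_ord_recl /h lift_perm_id; congr (_ * _).
by apply: eq_bigr => i _; rewrite lift_perm_lift.
Qed.

End Permanent.

Section DirectSum.
Context {K : fieldType} {H : vectType K} (A B : {vspace H}).

Lemma daddv_pi_unique (u v : H) : (A :&: B = 0)%VS -> u \in A -> v \in B ->
  daddv_pi A B (u + v) = u.
Proof.
move=> dAB uA vB; rewrite linearD /= (daddv_pi_id dAB uA).
have vs : v \in (A + B)%VS by rewrite (subvP (addvSr A B)).
have := daddv_pi_add dAB vs; rewrite capvC in dAB.
by rewrite (daddv_pi_id dAB vB) => /(canRL (addrK v)); rewrite subrr => ->; rewrite addr0.
Qed.

End DirectSum.

Section Fiber.
Context {R : realType} {n : nat} {S : cmanifold R n} {r g : nat}.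
Context (V : pvhs S r g) (x : S).
Local Notation C := (R[i]).
Local Notation H := (vfib (pbun V) x).
Local Notation form := (pform V x).
Local Notation conj := (pconj V x).
Local Notation F := (pF V x).
Local Notation Fb := (Fbar V x).
Implicit Types (a b z w : H) (k : C).

Lemma formDl a a' b : form (a + a') b = form a b + form a' b.
Proof. by have := pform_linear 1 a a' b; rewrite scale1r mul1r. Qed.

Lemma form0l b : form 0 b = 0.
Proof. by have := pform_linear (-1) (0 : H) 0 b; rewrite scaler0 addr0 mulN1r addNr. Qed.

Lemma formZl k a b : form (k *: a) b = k * form a b.
Proof. by have := pform_linear k a 0 b; rewrite form0l !addr0. Qed.

Lemma formNr a b : form a b = - form b a.
Proof. exact: pform_antisym. Qed.

Lemma formDr a b b' : form a (b + b') = form a b + form a b'.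
Proof. by rewrite formNr formDl opprD -!formNr. Qed.

Lemma formZr k a b : form a (k *: b) = k * form a b.
Proof. by rewrite formNr formZl -mulrN -formNr. Qed.

Lemma form0r a : form a 0 = 0.
Proof. by rewrite formNr form0l oppr0. Qed.

Lemma formNl a b : form (- a) b = - form a b.
Proof. by rewrite -scaleN1r formZl mulN1r. Qed.

Lemma formNNr a b : form a (- b) = - form a b.
Proof. by rewrite -scaleN1r formZr mulN1r. Qed.

Lemma form_suml (I : Type) (s : seq I) (P : pred I) (f : I -> H) b :
  form (\sum_(i <- s | P i) f i) b = \sum_(i <- s | P i) form (f i) b.
Proof. by apply: (big_morph (form^~ b)) => [u v|]; [exact: formDl|exact: form0l]. Qed.

Lemma form_sumr (I : Type) (s : seq I) (P : pred I) (f : I -> H) b :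
  form b (\sum_(i <- s | P i) f i) = \sum_(i <- s | P i) form b (f i).
Proof. by apply: (big_morph (form b)) => [u v|]; [exact: formDr|exact: form0r]. Qed.

Lemma conjD a b : conj (a + b) = conj a + conj b.
Proof. by have := pconj_antilinear 1 a b; rewrite !scale1r rmorph1 scale1r. Qed.

Lemma conj0 : conj 0 = 0.
Proof. by have := pconj_antilinear (-1) (0 : H) 0; rewrite scaler0 addr0 rmorphN1 scaleN1r addNr. Qed.

Lemma conjZ k a : conj (k *: a) = k^* *: conj a.
Proof. by have := pconj_antilinear k a 0; rewrite conj0 !addr0. Qed.

Lemma conj_sum (I : Type) (s : seq I) (P : pred I) (f : I -> H) :
  conj (\sum_(i <- s | P i) f i) = \sum_(i <- s | P i) conj (f i).
Proof. by apply: (big_morph conj) => [u v|]; [exact: conjD|exact: conj0]. Qed.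

Lemma conjK a : conj (conj a) = a.
Proof. exact: pconj_invol. Qed.

Lemma conj_form a b : (form a b)^* = form (conj a) (conj b).
Proof. exact: pform_real. Qed.

(** [Fbar] is spanned by conjugates of a basis; conjugation being involutive, it
    is the preimage of [F]. *)
Lemma mem_Fbar a : (a \in Fb) = (conj a \in F).
Proof.
apply/idP/idP.
  rewrite /Fbar /conj_space; set X := [seq conj i | i <- _].
  move=> /(coord_span (X := in_tuple X)) ->; rewrite conj_sum.
  apply: memv_suml => i _; rewrite conjZ; apply: memvZ.
  have : X`_i \in X by apply: mem_nth; have := ltn_ord i.
  by case/mapP => b bF ->; rewrite conjK; exact: vbasis_mem.
move=> /coord_vbasis e; rewrite -[a]conjK e conj_sum.
apply: memv_suml => i _; rewrite conjZ; apply: memvZ.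
apply: memv_span; apply/mapP; exists (vbasis F)`_i => //.
by apply: mem_nth; rewrite size_tuple.
Qed.

Lemma conj_Fbar a : a \in F -> conj a \in Fb.
Proof. by rewrite mem_Fbar conjK. Qed.

Lemma form_F a b : a \in F -> b \in F -> form a b = 0.
Proof. exact: pF_isotropic. Qed.

Lemma form_Fbar a b : a \in Fb -> b \in Fb -> form a b = 0.
Proof.
rewrite !mem_Fbar => aF bF; have := form_F aF bF.
by rewrite -conj_form => /eqP; rewrite conjC_eq0 => /eqP.
Qed.

Lemma F_positive a : a \in F -> form a (conj a) = 0 -> a = 0.
Proof.
move=> aF e; apply/eqP/negPn/negP => a0.
by have := pF_positive aF a0; rewrite e mulr0 ltxx.
Qed.

Lemma F_cap_Fbar : (F :&: Fb = 0)%VS.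
Proof.
apply/eqP; rewrite -subv0; apply/subvP => a; rewrite memv_cap mem_Fbar memv0.
by case/andP => aF caF; apply/eqP/F_positive => //; exact: form_F.
Qed.

Record dual_frames (f b : 'I_g -> H) : Prop := {
  df_memF : forall i, f i \in F;
  df_memFbar : forall i, b i \in Fb;
  df_dual : forall i j, form (f i) (b j) = (i == j)%:R;
  df_F : forall a, a \in F -> a = \sum_j form a (b j) *: f j;
  df_Fbar : forall a, a \in Fb -> a = \sum_j form (f j) a *: b j }.

Definition gram (f : 'I_g -> H) : 'M[C]_g := \matrix_(i, j) form (f i) (conj (f j)).

Definition dual_frame (f : 'I_g -> H) (j : 'I_g) : H :=
  \sum_k invmx (gram f) k j *: conj (f k).

Lemma basis_coord (f : 'I_g -> H) a : basis_of F [seq f i | i <- enum 'I_g] -> a \in F ->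
  exists c : 'I_g -> C, a = \sum_i c i *: f i.
Proof.
move=> bf aF; set X := [seq f i | i <- enum 'I_g] in bf.
have sX : size X = g by rewrite size_map size_enum_ord.
have := aF; rewrite -(span_basis bf) => /(coord_span (X := in_tuple X)) e.
exists (fun i => coord (in_tuple X) (cast_ord (esym sX) i) a).
rewrite {1}e (reindex (cast_ord (esym sX))); last first.
  by exists (cast_ord sX) => i _; [exact: cast_ordKV|exact: cast_ordK].
apply: eq_bigr => i _; congr (_ *: _).
by rewrite (nth_map i) ?size_enum_ord //= nth_ord_enum.
Qed.

Lemma basis_free_coord (f : 'I_g -> H) (c : 'I_g -> C) :
  basis_of F [seq f i | i <- enum 'I_g] -> \sum_i c i *: f i = 0 -> forall i, c i = 0.
Proof.
move=> bf e; set X := [seq f i | i <- enum 'I_g] in bf.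
have sX : size X = g by rewrite size_map size_enum_ord.
have fr : forall k : 'I_(size X) -> C, \sum_i k i *: X`_i = 0 -> forall i, k i = 0.
  by apply: (elimT (freeP (X := in_tuple X))); exact: basis_free bf.
move=> i; have := fr (fun j => c (cast_ord sX j)) _ (cast_ord (esym sX) i).
rewrite cast_ordKV; apply; rewrite -[RHS]e (reindex (cast_ord (esym sX))); last first.
  by exists (cast_ord sX) => j _; [exact: cast_ordKV|exact: cast_ordK].
apply: eq_bigr => j _; rewrite cast_ordKV; congr (_ *: _).
by rewrite (nth_map j) ?size_enum_ord //= nth_ord_enum.
Qed.

(** A vector in the kernel of the Gram matrix is isotropic for the hermitian form,
    which is definite on [F]. *)
Lemma gram_unit (f : 'I_g -> H) : basis_of F [seq f i | i <- enum 'I_g] ->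
  gram f \in unitmx.
Proof.
move=> bf; rewrite -row_free_unit -kermx_eq0; apply/eqP/row_matrixP => i.
rewrite row0; set c := row i _.
have cG : c *m gram f = 0 by rewrite /c -row_mul mulmx_ker row0.
set a := \sum_j c 0 j *: f j.
have fF j : f j \in F.
  by apply: (basis_mem bf); apply/mapP; exists j => //; rewrite mem_enum.
have aF : a \in F by apply: memv_suml => j _; apply: memvZ.
have af j : form a (conj (f j)) = 0.
  have := congr1 (fun M : 'rV[C]_g => M 0 j) cG; rewrite !mxE => e.
  by rewrite form_suml -[RHS]e; apply: eq_bigr => k _; rewrite formZl !mxE.
have a0 : a = 0.
  apply: F_positive => //; rewrite {2}/a conj_sum form_sumr big1 // => j _.
  by rewrite conjZ formZr af mulr0.
by apply/rowP => j; rewrite [RHS]mxE; exact: basis_free_coord bf a0 j.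
Qed.

Lemma dual_frameP (f : 'I_g -> H) : basis_of F [seq f i | i <- enum 'I_g] ->
  dual_frames f (dual_frame f).
Proof.
move=> bf.
have fF j : f j \in F.
  by apply: (basis_mem bf); apply/mapP; exists j => //; rewrite mem_enum.
have bFb j : dual_frame f j \in Fb.
  by apply: memv_suml => k _; apply: memvZ; exact: conj_Fbar.
have dual i j : form (f i) (dual_frame f j) = (i == j)%:R.
  have := congr1 (fun M : 'M[C]_g => M i j) (mulmxV (gram_unit bf)).
  rewrite !mxE => <-; rewrite form_sumr; apply: eq_bigr => k _.
  by rewrite formZr !mxE mulrC.
have expF a : a \in F -> a = \sum_j form a (dual_frame f j) *: f j.
  move=> aF; have [c e] := basis_coord bf aF; rewrite {1}e.
  apply: eq_bigr => j _; congr (_ *: _); rewrite e form_suml (bigD1 j) //=.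
  rewrite formZl dual eqxx mulr1 big1 ?addr0 // => i ij.
  by rewrite formZl dual (negbTE ij) mulr0.
split=> // a aFb; set a' := \sum_j _; apply/eqP; rewrite -subr_eq0.
have a'F : a - a' \in Fb.
  by rewrite memvB //; apply: memv_suml => j _; exact: memvZ.
have fa i : form (f i) (a - a') = 0.
  rewrite formDr formNNr form_sumr (bigD1 i) //= formZr dual eqxx mulr1.
  rewrite big1 ?addr0 ?subrr // => j ji.
  by rewrite formZr dual eq_sym (negbTE ji) mulr0.
rewrite -[a - a']conjK; apply/eqP.
suff -> : conj (a - a') = 0 by rewrite conj0.
apply: F_positive; first by rewrite -mem_Fbar.
rewrite conjK (expF _ (_ : conj (a - a') \in F)) -?mem_Fbar //.
by rewrite form_suml big1 // => i _; rewrite formZl fa mulr0.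
Qed.

Lemma form_F_Fbar_eq0 (f b : 'I_g -> H) a : dual_frames f b ->
  (forall j, form a (b j) = 0) -> a \in F -> a = 0.
Proof. by move=> df h aF; rewrite (df_F df aF) big1 // => j _; rewrite h scale0r. Qed.

(** The difference of both sides is orthogonal to [F] and to its conjugate;
    adjoining it to [F] keeps [F] isotropic, so that maximality of [F] puts it
    in [F], where it vanishes. *)
Lemma frame_decomp (f b : 'I_g -> H) a : dual_frames f b ->
  a = \sum_j form a (b j) *: f j + \sum_j form (f j) a *: b j.
Proof.
move=> df; set a1 := \sum_j _; set a2 := \sum_j _; apply/eqP; rewrite -subr_eq0.
set y := a - _; have a1F : a1 \in F by apply: memv_suml => j _; apply: memvZ; exact: df_memF df j.
have a2F : a2 \in Fb by apply: memv_suml => j _; apply: memvZ; exact: df_memFbar df j.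
have yb j : form y (b j) = 0.
  rewrite /y formDl formNl formDl (form_Fbar a2F (df_memFbar df j)) addr0 /a1 form_suml.
  rewrite (bigD1 j) //= formZl (df_dual df) eqxx mulr1 big1 ?addr0 ?subrr // => i ij.
  by rewrite formZl (df_dual df) (negbTE ij) mulr0.
have yf j : form (f j) y = 0.
  rewrite /y formDr formNNr formDr (form_F (df_memF df j) a1F) add0r /a2 form_sumr.
  rewrite (bigD1 j) //= formZr (df_dual df) eqxx mulr1 big1 ?addr0 ?subrr // => i ij.
  by rewrite formZr (df_dual df) eq_sym (negbTE ij) mulr0.
clearbody y.
have yF c : c \in F -> form c y = 0.
  by move=> cF; rewrite (df_F df cF) form_suml big1 // => j _; rewrite formZl yf mulr0.
have yy : form y y = 0.
  have := formNr y y => /eqP; rewrite -addr_eq0 -mulr2n -mulr_natl mulf_eq0 pnatr_eq0.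
  by move/eqP.
have iso : isotropic form (F + <[y]>)%VS.
  move=> _ _ /memv_addP[c1 c1F [d1 /vlineP[k1 ->] ->]] /memv_addP[c2 c2F [d2 /vlineP[k2 ->] ->]].
  rewrite !(formDl, formDr, formZl, formZr) form_F // yF // yy [form y _]formNr yF //.
  by rewrite oppr0 !mulr0 !addr0.
have /subvP/(_ y) := pF_maximal iso (addvSl _ _).
rewrite (subvP (addvSr _ _)) ?memv_line // => /(_ isT) yF'.
by rewrite (form_F_Fbar_eq0 df yb yF').
Qed.

Lemma exists_dual_frames : exists f b : 'I_g -> H, dual_frames f b.
Proof.
have [W [_ Wx [e [m [_ _ _ _ /(_ x Wx) bf]]]]] := pF_holomorphic V x.
by eexists; eexists; exact: dual_frameP bf.
Qed.

Lemma projF_unique a b : a \in F -> b \in Fb -> projF (V := V) (a + b) = a.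
Proof. exact: daddv_pi_unique F_cap_Fbar. Qed.

Lemma projFbar_unique a b : a \in F -> b \in Fb -> projFbar (V := V) (a + b) = b.
Proof.
move=> aF bF; rewrite addrC; apply: daddv_pi_unique => //.
by rewrite capvC; exact: F_cap_Fbar.
Qed.

Lemma projFE (f b : 'I_g -> H) a : dual_frames f b ->
  projF (V := V) a = \sum_j form a (b j) *: f j.
Proof.
move=> df; rewrite {1}(frame_decomp a df) projF_unique //.
  by apply: memv_suml => j _; apply: memvZ; exact: df_memF df j.
by apply: memv_suml => j _; apply: memvZ; exact: df_memFbar df j.
Qed.

Lemma projFbarE (f b : 'I_g -> H) a : dual_frames f b ->
  projFbar (V := V) a = \sum_j form (f j) a *: b j.
Proof.
move=> df; rewrite {1}(frame_decomp a df) projFbar_unique //.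
  by apply: memv_suml => j _; apply: memvZ; exact: df_memF df j.
by apply: memv_suml => j _; apply: memvZ; exact: df_memFbar df j.
Qed.

Lemma projF_mem a : projF (V := V) a \in F.
Proof. exact: memv_pi. Qed.

Lemma projFbar_mem a : projFbar (V := V) a \in Fb.
Proof. exact: memv_pi. Qed.

Lemma projF_add a : projF (V := V) a + projFbar (V := V) a = a.
Proof.
have [f [b df]] := exists_dual_frames.
by rewrite (projFE _ df) (projFbarE _ df) -frame_decomp.
Qed.

Lemma projF_linear k a b :
  projF (V := V) (k *: a + b) = k *: projF (V := V) a + projF (V := V) b.
Proof. by rewrite /projF linearP. Qed.

Lemma projFbar_linear k a b :
  projFbar (V := V) (k *: a + b) = k *: projFbar (V := V) a + projFbar (V := V) b.
Proof. by rewrite /projFbar linearP. Qed.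

Lemma projFbar_F a : a \in F -> projFbar (V := V) a = 0.
Proof. by move=> aF; rewrite -[a]addr0 projFbar_unique // mem0v. Qed.

Lemma projF_F a : a \in F -> projF (V := V) a = a.
Proof. by move=> aF; rewrite -{1}[a]addr0 projF_unique // mem0v. Qed.

Lemma conj_projF a : conj (projF (V := V) a) = projFbar (V := V) (conj a).
Proof.
rewrite -{2}(projF_add a) conjD addrC projFbar_unique //.
  by rewrite -mem_Fbar projFbar_mem.
by rewrite conj_Fbar // projF_mem.
Qed.

Lemma conj_projFbar a : conj (projFbar (V := V) a) = projF (V := V) (conj a).
Proof. by rewrite -[RHS]conjK conj_projF conjK. Qed.

Lemma form_projFbar a b : a \in F -> form a (projFbar (V := V) b) = form a b.
Proof. by move=> aF; rewrite -[X in _ = form a X](projF_add b) formDr (form_F aF (projF_mem b)) add0r. Qed.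

Lemma form_projF a b : a \in Fb -> form a (projF (V := V) b) = form a b.
Proof. by move=> aF; rewrite -[X in _ = form a X](projF_add b) formDr (form_Fbar aF (projFbar_mem b)) addr0. Qed.

(** The trace is defined in a basis that need not be dual to anything; in dual
    frames it is a sum of values of the symplectic form. *)
Lemma trace_on_frames (f b : 'I_g -> H) (T : H -> H) : dual_frames f b ->
  (forall a, a \in F -> T a \in F) ->
  (forall k a c, a \in F -> c \in F -> T (k *: a + c) = k *: T a + T c) ->
  trace_on F T = \sum_j form (T (f j)) (b j).
Proof.
move=> df TF Tl.
have T0 : T 0 = 0.
  by have := Tl (-1) 0 0 (mem0v F) (mem0v F); rewrite scaler0 addr0 scaleN1r addNr.
have Tsum (c : 'I_g -> C) : T (\sum_j c j *: f j) = \sum_j c j *: T (f j).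
  have : forall s : seq 'I_g, T (\sum_(j <- s) c j *: f j) = \sum_(j <- s) c j *: T (f j).
    elim=> [|j s IH]; first by rewrite !big_nil.
    rewrite !big_cons Tl ?IH //; first exact: df_memF df j.
    by apply: memv_suml => i _; apply: memvZ; exact: df_memF df i.
  exact.
have ev i : (vbasis F)`_i \in F.
  have [h|h] := ltnP i (size (vbasis F)); first by apply: vbasis_mem; exact: mem_nth.
  by rewrite nth_default // mem0v.
rewrite /trace_on.
under eq_bigr => i _ do rewrite (df_F df (ev i)) Tsum linear_sum.
rewrite exchange_big /=; apply: eq_bigr => j _.
rewrite -[in RHS](esym (coord_vbasis (TF _ (df_memF df j)))) form_suml.
by apply: eq_bigr => i _; rewrite linearZ formZl mulrC.
Qed.

End Fiber.

(** * The Fock space of one fiber *)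
Section FiberFock.
Context {R : realType} {n : nat} {S : cmanifold R n} {r g : nat}.
Context (V : pvhs S r g) (x : S).
Local Notation C := (R[i]).
Local Notation H := (vfib (pbun V) x).
Local Notation form := (pform V x).
Local Notation conj := (pconj V x).
Local Notation F := (pF V x).
Local Notation Fb := (Fbar V x).
Context (Fk : lmodType C) (rho : H -> Fk -> Fk) (vac : Fk).
Implicit Types (a b z : H) (k : C) (u v w : Fk).

(** The relations of the Fock space on which all the rest depends.  The module is
    kept abstract, which hides the quotient of the enveloping algebra. *)
Record heisenberg_module : Prop := {
  hm_linear : forall a k u v, rho a (k *: u + v) = k *: rho a u + rho a v;
  hm_linearl : forall u k a b, rho (k *: a + b) u = k *: rho a u + rho b u;
  hm_comm : forall a b u, rho a (rho b u) = rho b (rho a u) + form a b *: u;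
  hm_vac : forall a, a \in F -> rho a vac = 0 }.

Hypothesis hm : heisenberg_module.

Let rho_linear := hm_linear hm.
Let rho_linearl := hm_linearl hm.
Let rho_comm := hm_comm hm.
Let rho_vac := hm_vac hm.

Definition hmono (zs : seq H) : Fk := foldr rho vac zs.
Local Notation mono := hmono.

Definition hrho2 (t : seq (H * H)) u : Fk := \sum_(p <- t) rho p.1 (rho p.2 u).

Lemma mono_nil : mono [::] = vac. Proof. by []. Qed.

Lemma mono_cons z (zs : seq H) : mono (z :: zs) = rho z (mono zs).
Proof. by []. Qed.

Lemma rho2_cons p (t : seq (H * H)) u :
  hrho2 (p :: t) u = rho p.1 (rho p.2 u) + hrho2 t u.
Proof. exact: big_cons. Qed.

Lemma rho2_nil u : hrho2 [::] u = 0.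
Proof. exact: big_nil. Qed.

Local Opaque hmono hrho2.

Lemma rhoD a u v : rho a (u + v) = rho a u + rho a v.
Proof. by rewrite -[u]scale1r rho_linear !scale1r. Qed.

Lemma rho0 a : rho a 0 = 0.
Proof. by have := rho_linear a (-1) 0 0; rewrite scaler0 addr0 scaleN1r addNr. Qed.

Lemma rhoZ a k u : rho a (k *: u) = k *: rho a u.
Proof. by rewrite -[k *: u]addr0 rho_linear rho0 addr0. Qed.

Lemma rhoDl u a b : rho (a + b) u = rho a u + rho b u.
Proof. by rewrite -[a]scale1r rho_linearl !scale1r. Qed.

Lemma rho0l u : rho 0 u = 0.
Proof. by have := rho_linearl u (-1) 0 0; rewrite scaler0 addr0 scaleN1r addNr. Qed.

Lemma rhoZl u k a : rho (k *: a) u = k *: rho a u.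
Proof. by rewrite -[k *: a]addr0 rho_linearl rho0l addr0. Qed.

Lemma rhoNl u a : rho (- a) u = - rho a u.
Proof. by rewrite -[- a]scaleN1r rhoZl scaleN1r. Qed.

Lemma rhoN u a : rho a (- u) = - rho a u.
Proof. by rewrite -[- u]scaleN1r rhoZ scaleN1r. Qed.

Lemma rho_sum (I : Type) (s : seq I) a (f : I -> Fk) :
  rho a (\sum_(i <- s) f i) = \sum_(i <- s) rho a (f i).
Proof. by apply: (big_morph (rho a)) => [u v|]; [exact: rhoD|exact: rho0]. Qed.

Lemma rho_suml (I : Type) (s : seq I) (f : I -> H) u :
  rho (\sum_(i <- s) f i) u = \sum_(i <- s) rho (f i) u.
Proof. by apply: (big_morph (fun a => rho a u)) => [a b|]; [exact: rhoDl|exact: rho0l]. Qed.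

Lemma rho2_linear (t : seq (H * H)) k u v :
  hrho2 t (k *: u + v) = k *: hrho2 t u + hrho2 t v.
Proof.
elim: t => [|p t IH]; first by rewrite !rho2_nil scaler0 addr0.
by rewrite !rho2_cons IH !rho_linear scalerDr addrACA.
Qed.

(** A frame [e] of [U] with the frame [e'] of [U'] dual to it, allowing for the
    sign that exchanging the two factors of an antisymmetric pairing causes. *)
Record is_frame (U U' : {vspace H}) (e e' : 'I_g -> H) : Prop := {
  fr_mem : forall j, e j \in U;
  fr_mem' : forall j, e' j \in U';
  fr_U : forall a, a \in U -> a = \sum_j form a (e' j) *: e j;
  fr_U' : forall a, a \in U' -> a = \sum_j form (e j) a *: e' j }.

Lemma frame_F (f b : 'I_g -> H) : dual_frames f b -> is_frame F Fb f b.
Proof. by case. Qed.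

Lemma frame_Fbar (f b : 'I_g -> H) : dual_frames f b ->
  is_frame Fb F b (fun j => - f j).
Proof.
case=> fF bF _ h1 h2; split=> // [j|a aF|a aF].
- by rewrite memvN.
- by rewrite {1}(h2 a aF); apply: eq_bigr => j _; rewrite formNNr formNr.
- by rewrite {1}(h1 a aF); apply: eq_bigr => j _; rewrite scalerN formNr scaleNr.
Qed.

Section Tensor.
Context (U U' : {vspace H}) (e e' : 'I_g -> H) (T : H -> H).
Hypothesis fr : is_frame U U' e e'.
Hypothesis TU : forall a, a \in U' -> T a \in U.
Hypothesis Tl : forall k a b, a \in U' -> b \in U' -> T (k *: a + b) = k *: T a + T b.

Lemma frame_map0 : T 0 = 0.
Proof.
by have := Tl (-1) (mem0v U') (mem0v U'); rewrite scaler0 addr0 scaleN1r addNr.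
Qed.

Lemma frame_map_sum (c : 'I_g -> C) : T (\sum_j c j *: e' j) = \sum_j c j *: T (e' j).
Proof.
have : forall s : seq 'I_g, T (\sum_(j <- s) c j *: e' j) = \sum_(j <- s) c j *: T (e' j).
  elim=> [|j s IH]; first by rewrite !big_nil frame_map0.
  rewrite !big_cons Tl ?IH //; first exact: (fr_mem' fr j).
  by apply: memv_suml => i _; apply: memvZ; exact: (fr_mem' fr i).
exact.
Qed.

Lemma frame_map a : a \in U' -> T a = \sum_j form (e j) a *: T (e' j).
Proof. by move=> aU; rewrite {1}(fr_U' fr aU) frame_map_sum. Qed.

(** The operator [rho t] for the tensor [t] in the square of [U] that corresponds
    to [T], in frames: see [rho2_tensor].  The factor is the inverse of the
    factor 2 in [tensor_hom]. *)
Definition quad_op u : Fk := 2^-1 *: \sum_j rho (T (e' j)) (rho (e j) u).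

(** The maps [E] of the square of [U] to the homomorphisms are onto, so that the
    chosen tensors have the property by which they are chosen. *)
Lemma tensor_exists : exists t : seq (H * H),
  all (fun p => (p.1 \in U) && (p.2 \in U)) t /\
  (forall a, a \in U' -> tensor_hom form t a = T a).
Proof.
exists [seq (2^-1 *: T (e' j), e j) | j <- enum 'I_g]; split.
  by apply/allP => p /mapP[j _ ->] /=; rewrite memvZ ?TU ?(fr_mem' fr) ?(fr_mem fr).
move=> a aU; rewrite (frame_map aU) /tensor_hom big_map enumT.
apply: eq_bigr => j _ /=; rewrite scalerA; congr (_ *: _).
by rewrite mulrAC divff ?mul1r // pnatr_eq0.
Qed.

Lemma rho2_tensor (t : seq (H * H)) u :
  all (fun p => (p.1 \in U) && (p.2 \in U)) t ->
  (forall a, a \in U' -> tensor_hom form t a = T a) ->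
  hrho2 t u = quad_op u.
Proof.
move=> tU tT.
have h1 : hrho2 t u = \sum_j rho (\sum_(p <- t) form p.2 (e' j) *: p.1) (rho (e j) u).
  elim: t tU {tT} => [|p t IH] /=.
    by rewrite rho2_nil big1 // => j _; rewrite big_nil rho0l.
  case/andP => /andP[p1 p2] /IH {}IH; rewrite rho2_cons IH.
  rewrite {1}(fr_U fr p2) rho_suml rho_sum -big_split /=; apply: eq_bigr => j _.
  by rewrite big_cons rhoDl !rhoZl rhoZ.
rewrite h1 /quad_op scaler_sumr; apply: eq_bigr => j _.
rewrite -rhoZl -(tT _ (fr_mem' fr j)).
apply: (congr1 (fun a => rho a (rho (e j) u))).
rewrite /tensor_hom scaler_sumr; apply: eq_bigr => p _.
by rewrite scalerA mulrA mulVf ?mul1r // pnatr_eq0.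
Qed.

Hypothesis Uiso : forall a b, a \in U -> b \in U -> form a b = 0.
Hypothesis Tsym : forall a b, a \in U' -> b \in U' -> form (T a) b = form (T b) a.

(** The two factors of the tensor contribute the same commutator, by the symmetry
    of [T]; the factor [2^-1] absorbs this. *)
Lemma quad_op_comm y y0 u : y \in U' -> y0 \in U ->
  quad_op (rho (y + y0) u) = rho (y + y0) (quad_op u) + rho (T y) u.
Proof.
move=> yU y0U; rewrite /quad_op rhoZ rho_sum.
have step j : rho (T (e' j)) (rho (e j) (rho (y + y0) u)) =
   rho (y + y0) (rho (T (e' j)) (rho (e j) u)) +
   (form (T y) (e' j) *: rho (e j) u + form (e j) y *: rho (T (e' j)) u).
  have eU := fr_mem fr j; have TeU := TU (fr_mem' fr j).
  rewrite (rho_comm (e j)) rhoD rhoZ (rho_comm (T (e' j))) -addrA.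
  rewrite !formDr (Uiso eU y0U) (Uiso TeU y0U) !addr0.
  by rewrite (Tsym (fr_mem' fr j) yU).
under eq_bigr do rewrite step.
rewrite big_split scalerDr; congr (_ + _); rewrite big_split /=.
have -> : \sum_j form (T y) (e' j) *: rho (e j) u = rho (T y) u.
  rewrite {2}(fr_U fr (TU yU)) rho_suml; apply: eq_bigr => j _.
  by rewrite rhoZl.
have -> : \sum_j form (e j) y *: rho (T (e' j)) u = rho (T y) u.
  rewrite (frame_map yU) rho_suml; apply: eq_bigr => j _.
  by rewrite rhoZl.
have half (v : Fk) : 2^-1 *: (v + v) = v.
  by rewrite -[v in v + v]scale1r -scalerDl scalerA mulVf ?scale1r // pnatr_eq0.
exact: half.
Qed.

End Tensor.

(** Contraction by an element of [F] removes one factor at a time. *)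
Lemma rho_mono a (W : nat -> H) m : a \in F ->
  rho a (mono (mkseq W m.+1)) =
  \sum_(k < m.+1) form a (W k) *: mono (mkseq (fun i => W (bump k i)) m).
Proof.
move=> aF; elim: m W => [|m IH] W.
  by rewrite big_ord_recl big_ord0 addr0 /mkseq /= mono_cons !mono_nil rho_comm rho_vac // rho0 add0r.
have mkS (Y : nat -> H) l : mkseq Y l.+1 = Y 0%N :: mkseq (fun i => Y i.+1) l.
  by rewrite /mkseq /= (iotaDl 1 0) -map_comp.
rewrite mkS mono_cons rho_comm IH rho_sum [RHS]big_ord_recl addrC; congr (_ + _).
apply: eq_bigr => k _; rewrite rhoZ lift0 mkS mono_cons /=.
by congr (_ *: rho _ (mono _)); apply: eq_mkseq => i; rewrite /bump /= ltnS addnS.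
Qed.

(** The vectors on which the axioms of the inner product determine it. *)
Inductive fock_poly : Fk -> Prop :=
| FockPoly0 : fock_poly 0
| FockPolyD k (zs : seq H) u : {subset zs <= Fb} -> fock_poly u ->
    fock_poly (k *: mono zs + u).

Lemma fock_polyD u v : fock_poly u -> fock_poly v -> fock_poly (u + v).
Proof.
move=> pu pv; elim: pu => [|k zs w zF _ IH]; first by rewrite add0r.
by rewrite -addrA; constructor.
Qed.

Lemma fock_polyZ k u : fock_poly u -> fock_poly (k *: u).
Proof.
elim=> [|l zs w zF _ IH]; first by rewrite scaler0; constructor.
by rewrite scalerDr scalerA; constructor.
Qed.

Lemma fock_poly_sum (I : Type) (s : seq I) (f : I -> Fk) :
  (forall i, fock_poly (f i)) -> fock_poly (\sum_(i <- s) f i).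
Proof. by move=> h; elim/big_ind: _ => // [|u v]; [constructor|exact: fock_polyD]. Qed.

Lemma fock_poly_mono (zs : seq H) : {subset zs <= Fb} -> fock_poly (mono zs).
Proof.
move=> zF; rewrite -[mono zs]scale1r -[_ *: _]addr0.
by apply: FockPolyD => //; constructor.
Qed.

Lemma nth_Fbar (zs : seq H) i : {subset zs <= Fb} -> nth 0 zs i \in Fb.
Proof.
move=> zF; have [h|h] := ltnP i (size zs); first by apply: zF; exact: mem_nth.
by rewrite nth_default // mem0v.
Qed.

Lemma mkseq_Fbar (W : nat -> H) m : (forall i, W i \in Fb) -> {subset mkseq W m <= Fb}.
Proof. by move=> h a /mapP[i _ ->]. Qed.

Lemma fock_poly_rho a u : fock_poly u -> fock_poly (rho a u).
Proof.
elim=> [|k zs w zF _ IH]; first by rewrite rho0; constructor.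
rewrite rho_linear; apply: fock_polyD => //; apply: fock_polyZ.
rewrite -(projF_add a) rhoDl; apply: fock_polyD; last first.
  rewrite -mono_cons; apply: fock_poly_mono => b; rewrite inE => /orP[/eqP->|/zF//].
  exact: projFbar_mem.
rewrite -[zs](mkseq_nth 0); case: (size zs) => [|m].
  by rewrite /mkseq /= mono_nil rho_vac ?projF_mem //; constructor.
rewrite rho_mono ?projF_mem //; apply: fock_poly_sum => i.
apply: fock_polyZ; apply: fock_poly_mono; apply: mkseq_Fbar => j; exact: nth_Fbar.
Qed.

Section InnerProduct.
Context (ipx : Fk -> Fk -> C).

Record fock_form : Prop := {
  ff_linear : forall k (u u' w : Fk), ipx (k *: u + u') w = k * ipx u w + ipx u' w;
  ff_antilinear : forall k (u w w' : Fk), ipx u (k *: w + w') = k^* * ipx u w + ipx u w';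
  ff_sym : forall (m : nat) (z w : m.-tuple H),
    {subset z <= Fb} -> {subset w <= Fb} ->
    ipx (mono z) (mono w) = \sum_(p : 'S_m) \prod_(i < m) herm (tnth z i) (tnth w (p i));
  ff_orth : forall z w : seq H,
    {subset z <= Fb} -> {subset w <= Fb} -> size z != size w ->
    ipx (mono z) (mono w) = 0 }.

Hypothesis ipP : fock_form.

Lemma ipDl u v w' : ipx (u + v) w' = ipx u w' + ipx v w'.
Proof. by have := ff_linear ipP 1 u v w'; rewrite scale1r mul1r. Qed.

Lemma ip0l w' : ipx 0 w' = 0.
Proof. by have := ff_linear ipP (-1) (0 : Fk) 0 w'; rewrite scaler0 addr0 mulN1r addNr. Qed.

Lemma ipZl k u w' : ipx (k *: u) w' = k * ipx u w'.
Proof. by have := ff_linear ipP k u 0 w'; rewrite ip0l !addr0. Qed.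

Lemma ipDr u v w' : ipx w' (u + v) = ipx w' u + ipx w' v.
Proof. by have := ff_antilinear ipP 1 w' u v; rewrite scale1r rmorph1 mul1r. Qed.

Lemma ip0r w' : ipx w' 0 = 0.
Proof. by have := ff_antilinear ipP (-1) w' (0 : Fk) 0; rewrite scaler0 addr0 rmorphN1 mulN1r addNr. Qed.

Lemma ipZr k u w' : ipx w' (k *: u) = k^* * ipx w' u.
Proof. by have := ff_antilinear ipP k w' u 0; rewrite ip0r !addr0. Qed.

Lemma ip_sumr (I : Type) (s : seq I) (f : I -> Fk) u :
  ipx u (\sum_(i <- s) f i) = \sum_(i <- s) ipx u (f i).
Proof. by apply: (big_morph (ipx u)) => [a b|]; [exact: ipDr|exact: ip0r]. Qed.

Lemma herm_conj a b : (herm a b)^* = herm b a :> C.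
Proof.
by rewrite /herm rmorphM /= conjCi conj_form conjK formNr mulNr mulrN opprK.
Qed.

Lemma ip_mkseq (Z W : nat -> H) m : (forall i, Z i \in Fb) -> (forall i, W i \in Fb) ->
  ipx (mono (mkseq Z m)) (mono (mkseq W m)) =
  \sum_(p : 'S_m) \prod_(i < m) herm (Z i) (W (p i)).
Proof.
move=> ZF WF; pose tz := [tuple Z i | i < m]; pose tw := [tuple W i | i < m].
have ez : mkseq Z m = tz by rewrite /mkseq /tz /= -val_enum_ord -map_comp.
have ew : mkseq W m = tw by rewrite /mkseq /tw /= -val_enum_ord -map_comp.
rewrite ez ew (ff_sym ipP); first last.
- by have := mkseq_Fbar (m := m) WF; rewrite ew.
- by have := mkseq_Fbar (m := m) ZF; rewrite ez.
by apply: eq_bigr => p _; apply: eq_bigr => i _; rewrite !tnth_mktuple.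
Qed.

Lemma ip_mkseq_neq (Z W : nat -> H) m m' : (forall i, Z i \in Fb) -> (forall i, W i \in Fb) ->
  m != m' -> ipx (mono (mkseq Z m)) (mono (mkseq W m')) = 0.
Proof.
move=> ZF WF mm; apply: (ff_orth ipP); [exact: mkseq_Fbar|exact: mkseq_Fbar|].
by rewrite !size_mkseq.
Qed.

Lemma mkseq_cons z (Z : nat -> H) m :
  z :: mkseq Z m = mkseq (fun i => if i is j.+1 then Z j else z) m.+1.
Proof. by rewrite /mkseq /= (iotaDl 1 0) -map_comp. Qed.

(** Expansion of the permanent along the row of [z], to be compared with
    [rho_mono]. *)
Lemma ip_adjoint_mono z (Z W : nat -> H) m m' : z \in Fb ->
  (forall i, Z i \in Fb) -> (forall i, W i \in Fb) ->
  ipx (rho z (mono (mkseq Z m))) (mono (mkseq W m')) =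
  ipx (mono (mkseq Z m)) ('i *: rho (conj z) (mono (mkseq W m'))).
Proof.
move=> zF ZF WF; have czF : conj z \in F by rewrite -mem_Fbar.
pose Z' i := if i is j.+1 then Z j else z.
have Z'F i : Z' i \in Fb by case: i.
rewrite -mono_cons mkseq_cons -/Z'; case: m' => [|m'].
  by rewrite ip_mkseq_neq // /mkseq /= mono_nil rho_vac // scaler0 ip0r.
rewrite rho_mono // scaler_sumr ip_sumr.
have WkF (k : nat) i : W (bump k i) \in Fb by [].
have coef (k : nat) : ('i * form (conj z) (W k))^* = herm z (W k).
  by rewrite -[RHS]conjCK herm_conj /herm.
have [<-|mm] := eqVneq m m'.
  rewrite ip_mkseq // (permanent_expand (fun i j => herm (Z' i) (W j))).
  apply: eq_bigr => k _; rewrite scalerA ipZr coef ip_mkseq //.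
rewrite ip_mkseq_neq //; first by rewrite big1 // => k _; rewrite scalerA ipZr ip_mkseq_neq ?mulr0.
Qed.

Lemma ip_conj_mono (Z W : nat -> H) m m' :
  (forall i, Z i \in Fb) -> (forall i, W i \in Fb) ->
  (ipx (mono (mkseq Z m)) (mono (mkseq W m')))^* = ipx (mono (mkseq W m')) (mono (mkseq Z m)).
Proof.
move=> ZF WF; have [<-|mm] := eqVneq m m'; last first.
  by rewrite !ip_mkseq_neq ?rmorph0 // eq_sym.
rewrite !ip_mkseq // rmorph_sum /= [RHS](reindex_inj (@invg_inj {perm 'I_m})) /=.
apply: eq_bigr => p _; rewrite rmorph_prod /= [RHS](reindex_inj (@perm_inj _ p)) /=.
by apply: eq_bigr => i _; rewrite herm_conj permK.
Qed.

Lemma ip_conj u v : fock_poly u -> fock_poly v -> (ipx u v)^* = ipx v u.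
Proof.
move=> pu pv; elim: pu => [|k zs u' zF _ IH]; first by rewrite ip0l ip0r rmorph0.
rewrite ipDl ipDr rmorphD /= IH ipZl ipZr rmorphM /=; congr (_ * _ + _).
elim: pv {IH} => [|l ws v' wF _ IH]; first by rewrite ip0l ip0r rmorph0.
rewrite ipDl ipDr rmorphD /= IH ipZl ipZr rmorphM /= conjCK; congr (_ * _ + _).
rewrite -[zs](mkseq_nth 0) -[ws](mkseq_nth 0).
by apply: ip_conj_mono => i; exact: nth_Fbar.
Qed.

Lemma ip_adjoint_Fbar z u v : z \in Fb -> fock_poly u -> fock_poly v ->
  ipx (rho z u) v = ipx u ('i *: rho (conj z) v).
Proof.
move=> zF pu pv; elim: pu => [|k zs u' zsF _ IH]; first by rewrite rho0 !ip0l.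
rewrite rho_linear !ipDl IH !ipZl; congr (_ * _ + _).
elim: pv {IH} => [|l ws v' wF _ IH]; first by rewrite rho0 scaler0 !ip0r.
rewrite rho_linear scalerDr !ipDr IH scalerA mulrC -scalerA !(ipZr l); congr (_ * _ + _).
rewrite -[zs](mkseq_nth 0) -[ws](mkseq_nth 0).
by apply: ip_adjoint_mono => // i; exact: nth_Fbar.
Qed.

(** Creation and annihilation operators are adjoint up to the factor that
    relates the hermitian and the symplectic form. *)
Lemma ip_adjoint a u v : fock_poly u -> fock_poly v ->
  ipx (rho a u) v = ipx u ('i *: rho (conj a) v).
Proof.
move=> pu pv.
have adjF b : b \in F -> ipx (rho b u) v = ipx u ('i *: rho (conj b) v).
  move=> bF; have cF := conj_Fbar bF.
  rewrite -(ip_conj pv (fock_poly_rho b pu)).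
  have := ip_adjoint_Fbar cF pv pu; rewrite conjK ipZr conjCi => e.
  rewrite ipZr conjCi -(ip_conj (fock_poly_rho (conj b) pv) pu) e.
  by rewrite rmorphM rmorphN /= conjCi opprK mulrA mulNr -expr2 sqrCi opprK mul1r.
rewrite -(projF_add a) conjD !rhoDl ipDl scalerDr ipDr.
by rewrite adjF ?projF_mem // ip_adjoint_Fbar ?projFbar_mem.
Qed.

Lemma ip_vac : ipx vac vac = 1.
Proof.
have := @ip_mkseq (fun=> 0) (fun=> 0) 0 (fun=> mem0v Fb) (fun=> mem0v Fb).
rewrite /mkseq /= mono_nil => ->.
rewrite (eq_bigr (fun=> 1)) => [|p _]; last by rewrite big_ord0.
by rewrite sumr_const card_Sn.
Qed.

Lemma ip_vac_rho z u : z \in Fb -> fock_poly u -> ipx (rho z u) vac = 0.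
Proof.
move=> zF pu; rewrite ip_adjoint //; last exact: (@fock_poly_mono [::]).
by rewrite rho_vac -?mem_Fbar // scaler0 ip0r.
Qed.

End InnerProduct.

End FiberFock.

(** * Sections, frames and the second fundamental form *)
Section Geometry.
Context {R : realType} {n : nat} {S : cmanifold R n} {r g : nat}.
Context (V : pvhs S r g).
Local Notation C := (R[i]).
Local Notation Cn := (Cn R n).
Local Notation H := (vfib (pbun V)).
Local Notation F := (pF V).
Local Notation Fb := (Fbar V).
Local Notation nabla := (pnabla V).
Local Notation form := (pform V _).
Local Notation conj := (pconj V _).
Local Notation smooth := (smooth_sec (E := pbun V)).
Implicit Types (W : set S) (c : mchart S) (v w : Cn) (x : S) (f : S -> C)
  (s t : forall x, H x).

Local Opaque ddir.

Lemma smooth_sec_sub W W' s : W' `<=` W -> smooth W s -> smooth W' s.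
Proof. by move=> sW h t i; apply: smooth_fun_sub (h t i) => x [/sW]. Qed.

Lemma smooth_sec_local W s :
  (forall x, W x -> exists2 W', W' x & smooth W' s) -> smooth W s.
Proof.
move=> h t i; apply: smooth_fun_local => x [Wx tx].
by have [W' W'x hs] := h x Wx; exists (W' `&` vdom t); [split|exact: hs].
Qed.

Lemma smooth_sec_eq W s t : open W -> (forall x, W x -> s x = t x) ->
  smooth W s -> smooth W t.
Proof.
move=> oW st h tr i; apply: smooth_fun_eq (h tr i).
  by apply: openI => //; exact: vdom_open.
by move=> x [Wx _]; rewrite st.
Qed.

Lemma smooth_secD W s t : open W -> smooth W s -> smooth W t ->
  smooth W (fun x => s x + t x).
Proof.
move=> oW hs ht tr i.
have o : open (W `&` vdom tr) by apply: openI => //; exact: vdom_open.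
apply: (smooth_fun_eq o _ (smooth_funD o (hs tr i) (ht tr i))) => x _.
by rewrite linearD mxE.
Qed.

Lemma smooth_secZ W f s : open W -> smooth_fun W f -> smooth W s ->
  smooth W (fun x => f x *: s x).
Proof.
move=> oW hf hs tr i.
have o : open (W `&` vdom tr) by apply: openI => //; exact: vdom_open.
have hf' : smooth_fun (W `&` vdom tr) f by apply: smooth_fun_sub hf => x [].
apply: (smooth_fun_eq o _ (smooth_funM o hf' (hs tr i))) => x _.
by rewrite linearZ mxE.
Qed.

Lemma smooth_sec0 W : smooth W (fun x => 0).
Proof.
move=> tr i; apply: smooth_fun_local => x h; exists (W `&` vdom tr) => //.
have -> : (fun x => vmap tr x (0 : H x) i 0) = fun=> 0.
  by apply/funext => y; rewrite linear0 mxE.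
exact: smooth_fun_cst.
Qed.

Lemma smooth_sec_sum W (I : Type) (q : seq I) (h : I -> forall x, H x) : open W ->
  (forall i, smooth W (h i)) -> smooth W (fun x => \sum_(i <- q) h i x).
Proof.
move=> oW H'; elim: q => [|i q IH].
  by apply: (smooth_sec_eq oW _ (smooth_sec0 W)) => x _; rewrite big_nil.
by apply: (smooth_sec_eq oW _ (smooth_secD oW (H' i) IH)) => x _; rewrite big_cons.
Qed.

Lemma smooth_in_sub (G : forall x, {vspace H x}) W W' s : W' `<=` W ->
  smooth_in G W s -> smooth_in G W' s.
Proof. by move=> sW [h1 h2]; split; [exact: smooth_sec_sub h1|move=> x /sW/h2]. Qed.

Lemma smooth_in_lin (G : forall x, {vspace H x}) W k s t : open W ->
  smooth_in G W s -> smooth_in G W t -> smooth_in G W (fun x => k *: s x + t x).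
Proof.
move=> oW [h1 h2] [h3 h4]; split.
  by apply: (smooth_secD oW) => //; apply: (smooth_secZ oW) => //; exact: smooth_fun_cst.
by move=> x Wx; rewrite memvD ?memvZ ?h2 ?h4.
Qed.

Lemma smooth_inZ (G : forall x, {vspace H x}) W f s : open W -> smooth_fun W f ->
  smooth_in G W s -> smooth_in G W (fun x => f x *: s x).
Proof.
by move=> oW hf [h1 h2]; split; [exact: smooth_secZ|move=> x Wx; rewrite memvZ ?h2].
Qed.

Lemma smooth_in_sum (G : forall x, {vspace H x}) W (I : Type) (q : seq I)
  (h : I -> forall x, H x) : open W -> (forall i, smooth_in G W (h i)) ->
  smooth_in G W (fun x => \sum_(i <- q) h i x).
Proof.
move=> oW hh; split; first by apply: smooth_sec_sum => // i; exact: (hh i).1.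
by move=> x Wx; apply: memv_suml => i _; exact: (hh i).2.
Qed.

Lemma smooth_in_conjb W s : open W -> smooth_in Fb W s ->
  smooth_in F W (fun x => conj (s x)).
Proof.
move=> oW [h1 h2]; split; first exact: pconj_smooth.
by move=> x Wx; rewrite -mem_Fbar; exact: h2.
Qed.

(** Frames of [F] with holomorphic coefficients are smooth, and so are the
    frames of the conjugate bundle dual to them. *)
Lemma local_frames x0 : exists W (f b : 'I_g -> forall x, H x),
  [/\ open W, W x0, forall j, smooth_in F W (f j), forall j, smooth_in Fb W (b j) &
      forall x, W x -> dual_frames (f^~ x) (b^~ x)].
Proof.
have [W [oW Wx [e [m [es _ _ mh bF]]]]] := pF_holomorphic V x0.
pose f (j : 'I_g) x := \sum_k m j k x *: e k x.
pose b (j : 'I_g) x := dual_frame (f^~ x) j.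
have df x : W x -> dual_frames (f^~ x) (b^~ x).
  by move=> Wy; apply: dual_frameP; exact: bF.
have fs j : smooth W (f j).
  apply: smooth_sec_sum => // k; apply: smooth_secZ => //.
  by apply: holo_smooth_fun => //; exact: mh.
have gs i j : smooth_fun W (fun x => gram (f^~ x) i j).
  have h := pform_smooth oW (fs i) (pconj_smooth oW (fs j)).
  by apply: (smooth_fun_eq oW _ h) => x _; rewrite mxE.
have bs j : smooth W (b j).
  apply: smooth_sec_sum => // k; apply: smooth_secZ => //; last exact: pconj_smooth.
  apply: smooth_fun_invmx => // x Wy; apply: gram_unit; exact: bF.
exists W, f, b; split=> // j; split=> // x Wy.
  exact: (df_memF (df x Wy)).
exact: (df_memFbar (df x Wy)).
Qed.

Lemma smooth_projF W s : open W -> smooth W s ->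
  smooth_in F W (fun x => projF (V := V) (s x)).
Proof.
move=> oW hs; split; last by move=> x _; exact: projF_mem.
apply: smooth_sec_local => x Wx; have [W' [f [b [oW' W'x hf hb df]]]] := local_frames x.
exists (W `&` W'); first by split.
have o : open (W `&` W') by exact: openI.
have s' : smooth (W `&` W') s by apply: smooth_sec_sub hs => y [].
have h : smooth (W `&` W') (fun y => \sum_j form (s y) (b j y) *: f j y).
  apply: smooth_sec_sum => // j; apply: smooth_secZ => //.
    by apply: pform_smooth => //; apply: smooth_sec_sub (hb j).1 => y [].
  by apply: smooth_sec_sub (hf j).1 => y [].
apply: (smooth_sec_eq o _ h) => y [_ W'y].
by rewrite (projFE _ (df y W'y)).
Qed.

Lemma smooth_projFbar W s : open W -> smooth W s ->
  smooth_in Fb W (fun x => projFbar (V := V) (s x)).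
Proof.
move=> oW hs; split; last by move=> x _; exact: projFbar_mem.
have h : smooth W (fun x => s x + (-1) *: projF (V := V) (s x)).
  apply: (smooth_secD oW) => //; apply: (smooth_secZ oW); first exact: smooth_fun_cst.
  by have [] := smooth_projF oW hs.
apply: (smooth_sec_eq oW _ h) => x _.
by rewrite -{1}(projF_add (s x)) scaleN1r addrAC subrr add0r.
Qed.

Section Chart.
Context (c : mchart S).
Implicit Types (u : Cn).

Lemma nabla_smooth v W s : open W -> W `<=` mdom c -> smooth W s -> smooth W (nabla c v s).
Proof. exact: (conn_smooth (pnabla_conn V)). Qed.

Lemma nabla_local v W s t x : open W -> W `<=` mdom c -> smooth W s -> smooth W t ->
  (forall y, W y -> s y = t y) -> W x -> nabla c v s x = nabla c v t x.
Proof. by move=> *; apply: (conn_local (pnabla_conn V)); eassumption. Qed.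

Lemma nablaD v W s t x : open W -> W `<=` mdom c -> smooth W s -> smooth W t -> W x ->
  nabla c v (fun y => s y + t y) x = nabla c v s x + nabla c v t x.
Proof. by move=> oW Wc hs ht Wx; exact (conn_add (pnabla_conn V) v oW Wc hs ht Wx). Qed.

Lemma nablaZ v W f s x : open W -> W `<=` mdom c -> smooth_fun W f -> smooth W s -> W x ->
  nabla c v (fun y => f y *: s y) x = pderiv c v f x *: s x + f x *: nabla c v s x.
Proof. by move=> oW Wc hf hs Wx; exact (conn_leibniz (pnabla_conn V) v oW Wc hf hs Wx). Qed.

Lemma pderiv_cst v (k : C) x : pderiv c v (fun=> k) x = 0.
Proof. exact: is_pderiv_val (is_pderiv_cst c v k x). Qed.

Lemma nabla_lin v W k s t x : open W -> W `<=` mdom c -> smooth W s -> smooth W t -> W x ->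
  nabla c v (fun y => k *: s y + t y) x = k *: nabla c v s x + nabla c v t x.
Proof.
move=> oW Wc hs ht Wx; have hk := smooth_fun_cst W k.
rewrite (nablaD v oW Wc (smooth_secZ oW hk hs) ht Wx) (nablaZ v oW Wc hk hs Wx).
by rewrite pderiv_cst scale0r add0r.
Qed.

Lemma nabla0 v W x : open W -> W `<=` mdom c -> W x -> nabla c v (fun y => 0) x = 0.
Proof.
move=> oW Wc Wx; have := nabla_lin v (-1) oW Wc (smooth_sec0 W) (smooth_sec0 W) Wx.
rewrite scaleN1r addNr => <-.
by congr (nabla c v _ x); apply: functional_extensionality_dep => y; rewrite scaler0 addr0.
Qed.

Lemma nabla_sum v W (I : Type) (q : seq I) (h : I -> forall x, H x) x : open W ->
  W `<=` mdom c -> (forall i, smooth W (h i)) -> W x ->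
  nabla c v (fun y => \sum_(i <- q) h i y) x = \sum_(i <- q) nabla c v (h i) x.
Proof.
move=> oW Wc hh Wx; elim: q => [|i q IH].
  rewrite big_nil -[RHS](nabla0 v oW Wc Wx).
  apply: (nabla_local v oW Wc) => //; first exact: smooth_sec_sum.
    exact: smooth_sec0.
  by move=> y _; rewrite big_nil.
rewrite big_cons -IH -(nablaD v oW Wc (hh i) (smooth_sec_sum q oW hh) Wx).
apply: (nabla_local v oW Wc) => //; first exact: smooth_sec_sum.
  by apply: smooth_secD => //; exact: smooth_sec_sum.
by move=> y _; rewrite big_cons.
Qed.

(** The derivative of a section of [F] is tensorial modulo [F]. *)
Lemma projFbar_nabla_frame v W (f b : 'I_g -> forall x, H x) s x : open W -> W `<=` mdom c ->
  (forall j, smooth_in F W (f j)) -> (forall j, smooth_in Fb W (b j)) ->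
  (forall y, W y -> dual_frames (f^~ y) (b^~ y)) -> smooth_in F W s -> W x ->
  projFbar (V := V) (nabla c v s x) =
  \sum_j form (s x) (b j x) *: projFbar (V := V) (nabla c v (f j) x).
Proof.
move=> oW Wc hf hb df [hs sF] Wx.
pose cf j y := form (s y) (b j y).
have hcf j : smooth_fun W (cf j) by apply: pform_smooth => //; exact: (hb j).1.
have hcs j : smooth W (fun y => cf j y *: f j y) by apply: smooth_secZ => //; exact: (hf j).1.
have e : nabla c v s x = \sum_j nabla c v (fun y => cf j y *: f j y) x.
  rewrite -(nabla_sum v _ oW Wc hcs Wx).
  apply: (nabla_local v oW Wc hs (smooth_sec_sum _ oW hcs)) => // y Wy.
  by rewrite {1}(df_F (df y Wy) (sF y Wy)).
rewrite e /projFbar linear_sum; apply: eq_bigr => j _ /=.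
rewrite (nablaZ v oW Wc (hcf j) (hf j).1 Wx) linearP linearZ /=.
by rewrite [X in _ *: X + _]projFbar_F ?scaler0 ?add0r //; exact: (hf j).2.
Qed.

(** By [projFbar_nabla_frame] the value that defines [sigma] is the same for all
    sections through a given vector. *)
Lemma sigmaE v W s x : open W -> W `<=` mdom c -> smooth_in F W s -> W x ->
  sigma c v (s x) = projFbar (V := V) (nabla c v s x).
Proof.
move=> oW Wc hs Wx; rewrite /sigma.
set A := [set b | _]; have Ab : A (projFbar (V := V) (nabla c v s x)).
  by exists W, s; split.
have := xgetI 0 Ab; set y := xget 0 A => -[W' [s' [oW' W'x W'c hs' [e ->]]]].
have [W0 [f [b [oW0 W0x hf hb df]]]] := local_frames x.
pose N := W `&` (W' `&` W0).
have oN : open N by do 2?apply: openI.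
have Nc : N `<=` mdom c by move=> z [/Wc].
have Nx : N x by [].
have hf' j : smooth_in F N (f j) by apply: smooth_in_sub (hf j) => z [_ []].
have hb' j : smooth_in Fb N (b j) by apply: smooth_in_sub (hb j) => z [_ []].
have df' z : N z -> dual_frames (f^~ z) (b^~ z) by move=> [_ [_ /df]].
have s1 : smooth_in F N s by apply: smooth_in_sub hs => z [].
have s2 : smooth_in F N s' by apply: smooth_in_sub hs' => z [_ []].
rewrite (projFbar_nabla_frame v oN Nc hf' hb' df' s1 Nx).
by rewrite (projFbar_nabla_frame v oN Nc hf' hb' df' s2 Nx) e.
Qed.

(** Extension by constant coefficients in a local frame. *)
Lemma section_through x (a : H x) : mdom c x -> a \in F x ->
  exists W s, [/\ open W, W x, W `<=` mdom c, smooth_in F W s & s x = a].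
Proof.
move=> cx aF; have [W [f [b [oW Wx hf hb df]]]] := local_frames x.
pose N := W `&` mdom c.
have oN : open N by apply: openI => //; exact: mdom_open.
exists N, (fun y => \sum_j form a (b j x) *: f j y); split=> //; first by move=> y [].
  apply: smooth_in_sum => // j; apply: smooth_inZ => //; first exact: smooth_fun_cst.
  by apply: smooth_in_sub (hf j) => y [].
by rewrite -(df_F (df x Wx) aF).
Qed.

Lemma sections_through x (a a' : H x) : mdom c x -> a \in F x -> a' \in F x ->
  exists W s s', [/\ open W, W x, W `<=` mdom c, smooth_in F W s /\ smooth_in F W s' &
    s x = a /\ s' x = a'].
Proof.
move=> cx aF aF'; have [W [s [oW Wx Wc hs e]]] := section_through cx aF.
have [W' [s' [oW' W'x W'c hs' e']]] := section_through cx aF'.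
exists (W `&` W'), s, s'; split=> //.
- exact: openI.
- by move=> y [/Wc].
- by split; [apply: smooth_in_sub hs => y []|apply: smooth_in_sub hs' => y []].
Qed.

Lemma sigma_mem v x (a : H x) : mdom c x -> a \in F x -> sigma c v a \in Fb x.
Proof.
move=> cx aF; have [W [s [oW Wx Wc hs <-]]] := section_through cx aF.
by rewrite (sigmaE v oW Wc hs Wx) projFbar_mem.
Qed.

Lemma sigma_linear v x k (a a' : H x) : mdom c x -> a \in F x -> a' \in F x ->
  sigma c v (k *: a + a') = k *: sigma c v a + sigma c v a'.
Proof.
move=> cx aF aF'; have [W [s [s' [oW Wx Wc [hs hs'] [<- <-]]]]] := sections_through cx aF aF'.
rewrite (sigmaE v oW Wc hs Wx) (sigmaE v oW Wc hs' Wx).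
rewrite [LHS](sigmaE v oW Wc (smooth_in_lin k oW hs hs') Wx).
by rewrite (nabla_lin v k oW Wc hs.1 hs'.1 Wx) projFbar_linear.
Qed.

(** Differentiate the pairing of two sections of the isotropic bundle [F], which
    is 0. *)
Lemma sigma_sym v x (a a' : H x) : mdom c x -> a \in F x -> a' \in F x ->
  form (sigma c v a) a' = form (sigma c v a') a.
Proof.
move=> cx aF aF'; have [W [s [s' [oW Wx Wc [hs hs'] [e e']]]]] := sections_through cx aF aF'.
have := pform_flat v oW Wc hs.1 hs'.1 Wx.
have z : is_pderiv c v (fun y => form (s y) (s' y)) x 0.
  apply: (is_pderiv_eq oW Wx cx _ (is_pderiv_cst c v 0 x)) => y Wy.
  by rewrite form_F // ?hs.2 ?hs'.2.
rewrite (is_pderiv_val z) -e -e' => /esym/eqP.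
rewrite (sigmaE v oW Wc hs Wx) (sigmaE v oW Wc hs' Wx).
rewrite [form (projFbar _) _]formNr form_projFbar ?hs'.2 // [form (projFbar _) _]formNr form_projFbar ?hs.2 //.
rewrite addr_eq0 [form (nabla _ _ _ _) _]formNr => /eqP h.
exact: h.
Qed.

Lemma sigma_vlinear (k : R) v w x (a : H x) : mdom c x -> a \in F x ->
  sigma c (k%:C *: v + w) a = k%:C *: sigma c v a + sigma c w a.
Proof.
move=> cx aF; have [W [s [oW Wx Wc hs <-]]] := section_through cx aF.
rewrite !(sigmaE _ oW Wc hs Wx) (conn_linear (pnabla_conn V)  k v w oW Wc hs.1 Wx).
exact: projFbar_linear.
Qed.

Lemma sigmabar_mem v x (a : H x) : mdom c x -> a \in Fb x -> sigmabar c v a \in F x.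
Proof. by move=> cx aF; rewrite -mem_Fbar sigma_mem // -mem_Fbar. Qed.

Lemma sigmabar_linear v x k (a a' : H x) : mdom c x -> a \in Fb x -> a' \in Fb x ->
  sigmabar c v (k *: a + a') = k *: sigmabar c v a + sigmabar c v a'.
Proof.
move=> cx aF aF'; rewrite /sigmabar conjD conjZ sigma_linear -?mem_Fbar //.
by rewrite conjD conjZ conjCK.
Qed.

Lemma sigmabar_sym v x (a a' : H x) : mdom c x -> a \in Fb x -> a' \in Fb x ->
  form (sigmabar c v a) a' = form (sigmabar c v a') a.
Proof.
move=> cx aF aF'; rewrite /sigmabar -[a' in LHS]conjK -[a in RHS]conjK -!conj_form.
by rewrite sigma_sym -?mem_Fbar.
Qed.

Lemma sigmabar_vlinear (k : R) v w x (a : H x) : mdom c x -> a \in Fb x ->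
  sigmabar c (k%:C *: v + w) a = k%:C *: sigmabar c v a + sigmabar c w a.
Proof.
move=> cx aF; rewrite /sigmabar sigma_vlinear -?mem_Fbar // conjD conjZ.
by congr (_ *: _ + _); exact: conjc_real.
Qed.

(** Conjugation is flat and exchanges [F] with its conjugate. *)
Lemma sigmabarE v W s x : open W -> W `<=` mdom c -> smooth_in Fb W s -> W x ->
  sigmabar c v (s x) = projF (V := V) (nabla c v s x).
Proof.
move=> oW Wc hs Wx; rewrite /sigmabar.
rewrite (sigmaE v oW Wc (smooth_in_conjb oW hs) Wx) (pconj_flat v oW Wc hs.1 Wx).
by rewrite conj_projFbar conjK.
Qed.

End Chart.

Lemma sigma_chart c c' v x (a : H x) : mdom c x -> mdom c' x -> a \in F x ->
  sigma c v a = sigma c' ('d (mcoord c' \o mparam c) (mcoord c x) v) a.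
Proof.
move=> cx c'x aF; have [W [s [oW Wx Wc hs <-]]] := section_through cx aF.
pose N := W `&` mdom c'.
have oN : open N by apply: openI => //; exact: mdom_open.
have hN : smooth_in F N s by apply: smooth_in_sub hs => y [].
have Nc : N `<=` mdom c by move=> y [/Wc].
have Nc' : N `<=` mdom c' by move=> y [].
have Nx : N x by [].
rewrite (sigmaE _ oN Nc hN Nx) (sigmaE _ oN Nc' hN Nx).
congr (projFbar _); apply: (conn_chart (pnabla_conn V) v oN _ hN.1 Nx).
by move=> y Ny; split; [exact: Nc|exact: Nc'].
Qed.

Lemma sigmabar_chart c c' v x (a : H x) : mdom c x -> mdom c' x -> a \in Fb x ->
  sigmabar c v a = sigmabar c' ('d (mcoord c' \o mparam c) (mcoord c x) v) a.
Proof. by move=> cx c'x aF; rewrite /sigmabar (sigma_chart v cx c'x) // -mem_Fbar. Qed.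

End Geometry.

(** * The quadratic part of the connection *)
Section ConnectionForm.
Context {R : realType} {n : nat} {S : cmanifold R n} {r g : nat}.
Context (V : pvhs S r g) (x : S).
Local Notation C := (R[i]).
Local Notation Cn := (Cn R n).
Local Notation H := (vfib (pbun V) x).
Local Notation form := (pform V x).
Local Notation conj := (pconj V x).
Local Notation F := (pF V x).
Local Notation Fb := (Fbar V x).
Context (Fk : lmodType C) (rho : H -> Fk -> Fk) (vac : Fk).
Local Notation sg c v := (@sigma R n S r g V c v x).
Local Notation sgb c v := (@sigmabar R n S r g V c v x).
Hypothesis hm : heisenberg_module rho vac.
Context (c : mchart S) (cx : mdom c x).
Implicit Types (a b : H) (u w : Fk) (v : Cn).

Definition conn_op v u : Fk :=
  hrho2 rho (tens_s V c v x) u + hrho2 rho (tens_sbar V c v x) u.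

Lemma tens_sP v : all (fun p => (p.1 \in F) && (p.2 \in F)) (tens_s V c v x) /\
  forall a, a \in Fb -> tensor_hom form (tens_s V c v x) a = sigmabar c v a.
Proof.
have [f [b df]] := exists_dual_frames V x.
have [t Ht] := tensor_exists (frame_F df) (fun a => @sigmabar_mem _ _ _ _ _ V c v x a cx)
  (fun k a b => @sigmabar_linear _ _ _ _ _ V c v x k a b cx).
rewrite /tens_s; set A := [set t | _]; have At : A t by exact Ht.
exact (xgetI [::] At).
Qed.

Lemma tens_sbarP v : all (fun p => (p.1 \in Fb) && (p.2 \in Fb)) (tens_sbar V c v x) /\
  forall a, a \in F -> tensor_hom form (tens_sbar V c v x) a = sigma c v a.
Proof.
have [f [b df]] := exists_dual_frames V x.
have [t Ht] := tensor_exists (frame_Fbar df) (fun a => @sigma_mem _ _ _ _ _ V c v x a cx)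
  (fun k a b => @sigma_linear _ _ _ _ _ V c v x k a b cx).
rewrite /tens_sbar; set A := [set t | _]; have At : A t by exact Ht.
exact (xgetI [::] At).
Qed.

Lemma conn_opE v (f b : 'I_g -> H) u : dual_frames f b ->
  conn_op v u = quad_op rho f b (sgb c v) u +
    quad_op rho b (fun j => - f j) (sg c v) u.
Proof.
move=> df; have [h1 h2] := tens_sP v; have [h3 h4] := tens_sbarP v.
by rewrite /conn_op (rho2_tensor hm (frame_F df) u h1 h2) (rho2_tensor hm (frame_Fbar df) u h3 h4).
Qed.

Lemma conn_op_linear v k u w : conn_op v (k *: u + w) = k *: conn_op v u + conn_op v w.
Proof. by rewrite /conn_op !(rho2_linear hm) scalerDr addrACA. Qed.

Lemma conn_op_vlinear (k : R) (v w : Cn) u : conn_op (k%:C *: v + w) u = k%:C *: conn_op v u + conn_op w u.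
Proof.
have [f [b df]] := exists_dual_frames V x.
rewrite !(conn_opE _ _ df) /quad_op.
have e1 : \sum_j rho (sigmabar c (k%:C *: v + w) (b j)) (rho (f j) u) =
   k%:C *: (\sum_j rho (sigmabar c v (b j)) (rho (f j) u)) + \sum_j rho (sigmabar c w (b j)) (rho (f j) u).
  rewrite scaler_sumr -big_split; apply: eq_bigr => j _ /=.
  by rewrite sigmabar_vlinear ?(df_memFbar df) // (hm_linearl hm).
have e2 : \sum_j rho (sigma c (k%:C *: v + w) (- f j)) (rho (b j) u) =
   k%:C *: (\sum_j rho (sigma c v (- f j)) (rho (b j) u)) + \sum_j rho (sigma c w (- f j)) (rho (b j) u).
  rewrite scaler_sumr -big_split; apply: eq_bigr => j _ /=.
  by rewrite sigma_vlinear ?memvN ?(df_memF df) // (hm_linearl hm).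
by rewrite e1 e2 !scalerDr !scalerA !(mulrC _ k%:C) addrACA.
Qed.

(** This is what [s] and [sbar] are designed for: the commutator of a quadratic
    with a linear operator is linear, and [s], [sbar] correspond to [sigmabar]
    and [sigma] under it. *)
Lemma conn_op_comm v a u : conn_op v (rho a u) = rho a (conn_op v u) +
  rho (sigma c v (projF (V := V) a) + sigmabar c v (projFbar (V := V) a)) u.
Proof.
have [f [b df]] := exists_dual_frames V x.
rewrite !(conn_opE _ _ df) (rhoD hm).
have q1 := @quad_op_comm _ _ _ _ _ V x Fk rho vac hm _ _ f b (sgb c v) (frame_F df)
  (fun a => @sigmabar_mem _ _ _ _ _ V c v x a cx)
  (fun k a b => @sigmabar_linear _ _ _ _ _ V c v x k a b cx)
  (@form_F _ _ _ _ _ V x) (fun a b => @sigmabar_sym _ _ _ _ _ V c v x a b cx)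
  (projFbar (V := V) a) (projF (V := V) a) u (projFbar_mem a) (projF_mem a).
have q2 := @quad_op_comm _ _ _ _ _ V x Fk rho vac hm _ _ b (fun j => - f j) (sg c v) (frame_Fbar df)
  (fun a => @sigma_mem _ _ _ _ _ V c v x a cx)
  (fun k a b => @sigma_linear _ _ _ _ _ V c v x k a b cx)
  (@form_Fbar _ _ _ _ _ V x) (fun a b => @sigma_sym _ _ _ _ _ V c v x a b cx)
  (projF (V := V) a) (projFbar (V := V) a) u (projF_mem a) (projFbar_mem a).
rewrite [projFbar a + _]addrC projF_add in q1; rewrite projF_add in q2.
by rewrite q1 q2 addrACA (rhoDl hm) [rho (sigma _ _ _) _ + _]addrC.
Qed.

Section Skew.
Context (ipx : Fk -> Fk -> C).
Hypothesis ipP : fock_form rho vac ipx.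

Lemma hrho2_adjoint (G : {vspace H}) t u w : (forall a b, a \in G -> b \in G -> form a b = 0) ->
  fock_poly rho vac u -> fock_poly rho vac w ->
  all (fun p => (conj p.1 \in G) && (conj p.2 \in G)) t ->
  ipx (hrho2 rho t u) w = - ipx u (hrho2 rho [seq (conj p.1, conj p.2) | p <- t] w).
Proof.
move=> Giso pu pw; elim: t => [|p t IH] /=.
  by move=> _; rewrite !rho2_nil (ip0l ipP) (ip0r ipP) oppr0.
case/andP => /andP[p1 p2] /IH {}IH.
rewrite !rho2_cons (ipDl ipP) (ipDr ipP) opprD IH; congr (_ + _).
have pb := fock_poly_rho hm p.2 pu.
rewrite (ip_adjoint hm ipP _ pb pw).
have pa : fock_poly rho vac ('i *: rho (conj p.1) w).
  by apply: fock_polyZ; exact: (fock_poly_rho hm).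
rewrite (ip_adjoint hm ipP _ pu pa) (rhoZ hm) scalerA -expr2 sqrCi.
by rewrite (ipZr ipP) rmorphN1 mulN1r (hm_comm hm) Giso // scale0r addr0.
Qed.

(** The adjoints of the factors, taken in reverse order, commute again since both
    lie in an isotropic subspace; so the adjoint of [rho s] is [- rho sbar]. *)
Lemma conn_op_skew v u w : fock_poly rho vac u -> fock_poly rho vac w ->
  ipx (conn_op v u) w + ipx u (conn_op v w) = 0.
Proof.
move=> pu pw; have [f [b df]] := exists_dual_frames V x.
have [h1 h2] := tens_sP v; have [h3 h4] := tens_sbarP v.
have conj_tensor (t : seq (H * H)) a : tensor_hom form [seq (conj p.1, conj p.2) | p <- t] a =
    conj (tensor_hom form t (conj a)).
  rewrite /tensor_hom big_map conj_sum; apply: eq_bigr => p _ /=.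
  by rewrite conjZ rmorphM rmorph_nat /= conj_form conjK.
have i1 : all (fun p => (conj p.1 \in Fb) && (conj p.2 \in Fb)) (tens_s V c v x).
  by apply/allP => p /(allP h1) /andP[p1 p2]; rewrite !conj_Fbar.
have i2 : all (fun p => (conj p.1 \in F) && (conj p.2 \in F)) (tens_sbar V c v x).
  by apply/allP => p /(allP h3); rewrite !mem_Fbar.
rewrite /conn_op (ipDl ipP) (ipDr ipP).
rewrite (hrho2_adjoint (@form_Fbar _ _ _ _ _ V x) pu pw i1).
rewrite (hrho2_adjoint (@form_F _ _ _ _ _ V x) pu pw i2).
have e1 : hrho2 rho [seq (conj p.1, conj p.2) | p <- tens_s V c v x] w = hrho2 rho (tens_sbar V c v x) w.
  rewrite (rho2_tensor hm (frame_Fbar df) w h3 h4) (rho2_tensor hm (frame_Fbar df) (T := sg c v)) //.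
    by rewrite all_map; apply: sub_all i1 => p.
  by move=> a aF; rewrite conj_tensor h2 ?conj_Fbar // /sigmabar !conjK.
have e2 : hrho2 rho [seq (conj p.1, conj p.2) | p <- tens_sbar V c v x] w = hrho2 rho (tens_s V c v x) w.
  rewrite (rho2_tensor hm (frame_F df) w h1 h2) (rho2_tensor hm (frame_F df) (T := sgb c v)) //.
    by rewrite all_map; apply: sub_all i2 => p.
  by move=> a aF; rewrite conj_tensor h4 -?mem_Fbar.
rewrite e1 e2 addrACA [X in X + _ = 0]addrC.
have cancel (p q : C) : q - p + (- q + p) = 0 by ring.
by rewrite -[RHS](cancel (ipx u (hrho2 rho (tens_sbar V c v x) w)) (ipx u (hrho2 rho (tens_s V c v x) w))); congr (_ + _); rewrite addrC.
Qed.

End Skew.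

End ConnectionForm.

(** * Curvature of a connection *)
Section Curvature.
Context {R : realType} {n : nat} {S : cmanifold R n}.
Local Notation C := (R[i]).
Local Notation Cn := (Cn R n).
Context {E : S -> lmodType C} (smooth : set S -> (forall x, E x) -> Prop).
Context (D : covder E).
Hypothesis conn : is_connection smooth D.
Hypothesis smooth_sub : forall W W' u, open W' -> W' `<=` W -> smooth W u -> smooth W' u.
Hypothesis smoothD : forall W u u', open W -> smooth W u -> smooth W u' ->
  smooth W (fun x => u x + u' x).
Hypothesis smoothZ : forall W f u, open W -> smooth_fun W f -> smooth W u ->
  smooth W (fun x => f x *: u x).
Hypothesis smooth0 : forall W, open W -> smooth W (fun x => 0).
Context (c : mchart S).
Hypothesis pderiv_smooth : forall v W f, open W -> W `<=` mdom c -> smooth_fun W f ->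
  smooth_fun W (pderiv c v f).
Implicit Types (W : set S) (v w : Cn) (u : forall x, E x) (f : S -> C).

Local Opaque pderiv.

Lemma conn0 v W x : open W -> W `<=` mdom c -> W x -> D c v (fun y => 0) x = 0.
Proof.
move=> oW Wc Wx; have h0 := smooth0 oW.
have := conn_add conn v oW Wc h0 h0 Wx.
have -> : (fun y => (0 : E y) + 0) = fun y => 0.
  by apply: functional_extensionality_dep => y; rewrite addr0.
by move=> e; apply: (@addrI _ (D c v (fun y => 0) x)); rewrite -e addr0.
Qed.

Lemma smooth_sum W (I : Type) (q : seq I) (h : I -> forall x, E x) : open W ->
  (forall i, smooth W (h i)) -> smooth W (fun x => \sum_(i <- q) h i x).
Proof.
move=> oW hh; elim: q => [|i q IH].
  have -> : (fun x => \sum_(i <- [::]) h i x) = fun x => 0.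
    by apply: functional_extensionality_dep => y; rewrite big_nil.
  exact: smooth0.
have -> : (fun x => \sum_(j <- i :: q) h j x) = fun x => h i x + \sum_(j <- q) h j x.
  by apply: functional_extensionality_dep => y; rewrite big_cons.
exact: smoothD.
Qed.

Lemma conn_sum v W (I : Type) (q : seq I) (h : I -> forall x, E x) x : open W ->
  W `<=` mdom c -> (forall i, smooth W (h i)) -> W x ->
  D c v (fun y => \sum_(i <- q) h i y) x = \sum_(i <- q) D c v (h i) x.
Proof.
move=> oW Wc hh Wx; elim: q => [|i q IH].
  rewrite big_nil -[RHS](conn0 v oW Wc Wx).
  by congr (D c v _ x); apply: functional_extensionality_dep => y; rewrite big_nil.
rewrite big_cons -IH -(conn_add conn v oW Wc (hh i) (smooth_sum q oW hh) Wx).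
by congr (D c v _ x); apply: functional_extensionality_dep => y; rewrite big_cons.
Qed.

Definition curv v w u x : E x := D c v (D c w u) x - D c w (D c v u) x.

Lemma curv_local v w W u u' x : open W -> W `<=` mdom c -> smooth W u -> smooth W u' ->
  (forall y, W y -> u y = u' y) -> W x -> curv v w u x = curv v w u' x.
Proof.
move=> oW Wc hu hu' e Wx.
have h a b : D c a (D c b u) x = D c a (D c b u') x.
  apply: (conn_local conn a oW Wc _ _ _ Wx).
  - exact (conn_smooth conn b oW Wc hu).
  - exact (conn_smooth conn b oW Wc hu').
  - by move=> y Wy; exact (conn_local conn b oW Wc hu hu' e Wy).
by rewrite /curv !h.
Qed.

Lemma curvD v w W u u' x : open W -> W `<=` mdom c -> smooth W u -> smooth W u' -> W x ->
  curv v w (fun y => u y + u' y) x = curv v w u x + curv v w u' x.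
Proof.
move=> oW Wc hu hu' Wx.
have h a b : D c a (D c b (fun y => u y + u' y)) x = D c a (D c b u) x + D c a (D c b u') x.
  have s1 := conn_smooth conn b oW Wc hu; have s2 := conn_smooth conn b oW Wc hu'.
  rewrite -(conn_add conn a oW Wc s1 s2 Wx).
  apply: (conn_local conn a oW Wc _ _ _ Wx).
  - exact (conn_smooth conn b oW Wc (smoothD oW hu hu')).
  - exact (smoothD oW s1 s2).
  - by move=> y Wy; exact (conn_add conn b oW Wc hu hu' Wy).
by rewrite /curv !h opprD addrACA.
Qed.

Lemma curv0 v w W x : open W -> W `<=` mdom c -> W x -> curv v w (fun y => 0) x = 0.
Proof.
move=> oW Wc Wx; have h0 := smooth0 oW.
have := curvD v w oW Wc h0 h0 Wx.
have -> : (fun y => (0 : E y) + 0) = fun y => 0.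
  by apply: functional_extensionality_dep => y; rewrite addr0.
by move=> e; apply: (@addrI _ (curv v w (fun y => 0) x)); rewrite -e addr0.
Qed.

(** The terms with one derivative of [f] are symmetric in [v] and [w]. *)
Lemma curvZ v w W f u x : open W -> W `<=` mdom c -> smooth_fun W f -> smooth W u -> W x ->
  curv v w (fun y => f y *: u y) x = f x *: curv v w u x.
Proof.
move=> oW Wc hf hu Wx.
have h a b : D c a (D c b (fun y => f y *: u y)) x =
   (pderiv c a (pderiv c b f) x *: u x + f x *: D c a (D c b u) x) +
   (pderiv c b f x *: D c a u x + pderiv c a f x *: D c b u x).
  have s1 := conn_smooth conn b oW Wc hu.
  have hp := pderiv_smooth b oW Wc hf.
  have t1 := smoothZ oW hp hu; have t2 := smoothZ oW hf s1.
  have -> : D c a (D c b (fun y => f y *: u y)) x =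
      D c a (fun y => pderiv c b f y *: u y + f y *: D c b u y) x.
    apply: (conn_local conn a oW Wc _ _ _ Wx).
    - exact (conn_smooth conn b oW Wc (smoothZ oW hf hu)).
    - exact (smoothD oW t1 t2).
    - by move=> y Wy; exact (conn_leibniz conn b oW Wc hf hu Wy).
  rewrite (conn_add conn a oW Wc t1 t2 Wx).
  rewrite (conn_leibniz conn a oW Wc hp hu Wx) (conn_leibniz conn a oW Wc hf s1 Wx).
  have ac (M : zmodType) (p q s t : M) : (p + q) + (s + t) = (p + t) + (q + s).
    by rewrite [s + t]addrC addrACA.
  exact: ac.
rewrite /curv !h (pderivC v w oW hf Wx (Wc x Wx)) [pderiv c w f x *: _ + _]addrC.
by rewrite opprD addrACA subrr addr0 opprD addrACA subrr add0r -scalerBr.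
Qed.

End Curvature.

(** * Sections that are locally combinations of generators *)
Section LocalCombinations.
Context {R : realType} {n : nat} {S : cmanifold R n}.
Local Notation C := (R[i]).
Context {E : S -> lmodType C} {J : eqType}.
Context (gen : J -> forall x, E x) (good : set S -> J -> Prop).
Hypothesis good_sub : forall W W' j, W' `<=` W -> good W j -> good W' j.
Implicit Types (W : set S) (f : S -> C) (u : forall x, E x) (e : seq ((S -> C) * J)).

Definition comb e x : E x := \sum_(p <- e) p.1 x *: gen p.2 x.

Definition comb_data W e := forall p, p \in e -> smooth_fun W p.1 /\ good W p.2.

Definition local_comb W u := forall x, W x -> exists W' e,
  [/\ open W', W' x, W' `<=` W, comb_data W' e & forall y, W' y -> u y = comb e y].

Lemma comb_data_sub W W' e : W' `<=` W -> comb_data W e -> comb_data W' e.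
Proof.
by move=> sW h p /h[h1 h2]; split; [exact: smooth_fun_sub h1|exact: good_sub h2].
Qed.

Lemma comb_data_cons W p e : comb_data W (p :: e) ->
  [/\ smooth_fun W p.1, good W p.2 & comb_data W e].
Proof.
move=> h; have [h1 h2] := h p (mem_head _ _); split=> // q qe.
by apply: h; rewrite inE qe orbT.
Qed.

Lemma local_comb_comb W e : open W -> comb_data W e -> local_comb W (comb e).
Proof. by move=> oW he x Wx; exists W, e; split. Qed.

Lemma local_comb_gen W j : open W -> good W j -> local_comb W (gen j).
Proof.
move=> oW hj x Wx; exists W, [:: (fun=> 1, j)]; split=> //.
  by move=> p; rewrite inE => /eqP->; split=> //; exact: smooth_fun_cst.
by move=> y _; rewrite /comb big_seq1 scale1r.
Qed.

Lemma local_comb_eq W u u' : (forall x, W x -> u x = u' x) ->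
  local_comb W u -> local_comb W u'.
Proof.
move=> uu h x Wx; have [W' [e [oW' W'x W'W he ue]]] := h x Wx.
by exists W', e; split=> // y W'y; rewrite -uu ?ue //; exact: W'W.
Qed.

Lemma local_comb_local W u : open W ->
  (forall x, W x -> exists2 W', W' x & local_comb W' u) -> local_comb W u.
Proof.
move=> oW h x Wx; have [W' W'x hu] := h x Wx.
have [W0 [e [oW0 W0x W0W he ue]]] := hu x W'x.
exists (W `&` W0), e; split.
- exact: openI.
- by split.
- by move=> y [].
- by apply: comb_data_sub he => y [].
- by move=> y [_ /ue].
Qed.

Lemma local_comb_sub W W' u : open W' -> W' `<=` W -> local_comb W u -> local_comb W' u.
Proof.
by move=> oW' sW h; apply: local_comb_local => // x W'x; exists W; [exact: sW|].
Qed.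

Lemma local_combD W u u' : open W -> local_comb W u -> local_comb W u' ->
  local_comb W (fun x => u x + u' x).
Proof.
move=> oW h h' x Wx; have [W1 [e1 [ o1 x1 s1 d1 u1]]] := h x Wx.
have [W2 [e2 [ o2 x2 s2 d2 u2]]] := h' x Wx.
exists (W1 `&` W2), (e1 ++ e2); split.
- exact: openI.
- by split.
- by move=> y [/s1].
- move=> p; rewrite mem_cat => /orP[pe|pe].
    by apply: (comb_data_sub _ d1 pe) => y [].
  by apply: (comb_data_sub _ d2 pe) => y [].
- by move=> y [y1 y2]; rewrite u1 // u2 // /comb big_cat.
Qed.

Lemma local_combZ W f u : open W -> smooth_fun W f -> local_comb W u ->
  local_comb W (fun x => f x *: u x).
Proof.
move=> oW hf h x Wx; have [W1 [e1 [ o1 x1 s1 d1 u1]]] := h x Wx.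
exists W1, [seq ((fun y => f y * p.1 y), p.2) | p <- e1]; split=> //.
- move=> q /mapP[p /d1[h1 h2] ->]; split=> //=; apply: smooth_funM => //.
  exact: smooth_fun_sub hf.
- move=> y y1; rewrite u1 // /comb big_map scaler_sumr.
  by apply: eq_bigr => p _; rewrite scalerA.
Qed.

Lemma local_comb0 W : open W -> local_comb W (fun x => 0).
Proof.
by move=> oW x Wx; exists W, [::]; split=> // y _; rewrite /comb big_nil.
Qed.

End LocalCombinations.

(** * The connection on a bundle of Heisenberg modules *)
Section FockBundle.
Context {R : realType} {n : nat} {S : cmanifold R n} {r g : nat}.
Context (V : pvhs S r g).
Local Notation C := (R[i]).
Local Notation Cn := (Cn R n).
Local Notation H := (vfib (pbun V)).
Local Notation F := (pF V).
Local Notation Fb := (Fbar V).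
Local Notation nabla := (pnabla V).
Local Notation form := (pform V _).
Local Notation conj := (pconj V _).
Local Notation pr := (projF (V := V)).
Local Notation prb := (projFbar (V := V)).
Local Notation smoothH := (smooth_sec (E := pbun V)).
Context (Fk : S -> lmodType C) (rho : forall x, H x -> Fk x -> Fk x)
  (vac : forall x, Fk x).
Hypothesis hm : forall x, heisenberg_module (@rho x) (vac x).
Local Notation mono x := (hmono (@rho x) (vac x)).
Local Notation poly := (fock_poly (@rho _) (vac _)).
Implicit Types (W : set S) (v w : Cn) (f : S -> C) (x : S)
  (a z : forall x, H x) (u : forall x, Fk x)
  (e : seq ((S -> C) * seq (forall x, H x))).

Local Opaque pderiv.

Definition fock_gen (zs : seq (forall x, H x)) x : Fk x := mono x [seq z x | z <- zs].

Definition good_factors W (zs : seq (forall x, H x)) :=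
  forall z, z \in zs -> smooth_in Fb W z.

Lemma good_factors_sub W W' zs : W' `<=` W -> good_factors W zs -> good_factors W' zs.
Proof. by move=> sW h z /h; exact: smooth_in_sub. Qed.

Definition fsum := comb fock_gen.
Definition fsum_data := comb_data good_factors.
Definition hsmooth := local_comb fock_gen good_factors.

Lemma hsmooth_fsum W e : open W -> fsum_data W e -> hsmooth W (fsum e).
Proof. exact: local_comb_comb. Qed.

Lemma hsmooth_eq W u u' : (forall x, W x -> u x = u' x) ->
  hsmooth W u -> hsmooth W u'.
Proof. exact: local_comb_eq. Qed.

Lemma hsmooth_sub W W' u : open W' -> W' `<=` W -> hsmooth W u -> hsmooth W' u.
Proof. exact: (local_comb_sub good_factors_sub). Qed.

Lemma hsmooth_local W u : open W ->
  (forall x, W x -> exists2 W', W' x & hsmooth W' u) -> hsmooth W u.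
Proof. exact: (local_comb_local good_factors_sub). Qed.

Lemma hsmoothD W u u' : open W -> hsmooth W u -> hsmooth W u' ->
  hsmooth W (fun x => u x + u' x).
Proof. exact: (local_combD good_factors_sub). Qed.

Lemma hsmoothZ W f u : open W -> smooth_fun W f -> hsmooth W u ->
  hsmooth W (fun x => f x *: u x).
Proof. exact: local_combZ. Qed.

Lemma hsmooth_vac W : open W -> hsmooth W vac.
Proof. by move=> oW; exact: (local_comb_gen fock_gen (j := [::]) oW). Qed.

Lemma hsmooth0 W : open W -> hsmooth W (fun x => 0).
Proof. exact: local_comb0. Qed.

Lemma hsmooth_sum W (I : Type) (q : seq I) (h : I -> forall x, Fk x) : open W ->
  (forall i, hsmooth W (h i)) -> hsmooth W (fun x => \sum_(i <- q) h i x).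
Proof. exact: (smooth_sum hsmoothD hsmooth0). Qed.

Lemma hsmooth_rhob W z u : open W -> smooth_in Fb W z -> hsmooth W u ->
  hsmooth W (fun x => rho (z x) (u x)).
Proof.
move=> oW hz h x Wx; have [W1 [e1 [ o1 x1 s1 d1 u1]]] := h x Wx.
exists W1, [seq (p.1, z :: p.2) | p <- e1]; split=> //.
- move=> q /mapP[p /d1[h1 h2] ->]; split=> //= z'; rewrite inE => /orP[/eqP -> | /h2 // ].
  exact: smooth_in_sub hz.
- move=> y y1; rewrite u1 // /fsum /comb big_map (rho_sum (hm y)).
  by apply: eq_bigr => p _; rewrite (rhoZ (hm y)).
Qed.

(** Sections that are finite sums of products are built from the vacuum by
    smooth linear combinations and multiplications. *)
Lemma fsum_ind W (Q : (forall x, Fk x) -> Prop) e : open W ->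
  Q (fun x => 0) -> Q vac ->
  (forall u u', hsmooth W u -> hsmooth W u' -> Q u -> Q u' -> Q (fun x => u x + u' x)) ->
  (forall f u, smooth_fun W f -> hsmooth W u -> Q u -> Q (fun x => f x *: u x)) ->
  (forall z u, smooth_in Fb W z -> hsmooth W u -> Q u -> Q (fun x => rho (z x) (u x))) ->
  fsum_data W e -> Q (fsum e).
Proof.
move=> oW Q0 Qv QD QZ Qr; elim: e => [|p e IH] he.
  have -> : fsum [::] = fun x => 0 by apply: functional_extensionality_dep => x; exact: big_nil.
  exact: Q0.
have [h1 h2 h3] := comb_data_cons he.
have -> : fsum (p :: e) = fun x => p.1 x *: mono x [seq z x | z <- p.2] + fsum e x.
  by apply: functional_extensionality_dep => x; exact: big_cons.
have [m1 m2] : hsmooth W (fun x => mono x [seq z x | z <- p.2]) /\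
    Q (fun x => mono x [seq z x | z <- p.2]).
  elim: p.2 h2 => [|z zs IHz] h2; first by split; [exact: hsmooth_vac|exact: Qv].
  have [|i1 i2] := IHz; first by move=> z' hz'; apply: h2; rewrite inE hz' orbT.
  have hz := h2 z (mem_head _ _).
  split; first by exact (hsmooth_rhob oW hz i1).
  exact (Qr _ _ hz i1 i2).
apply: QD; [exact: hsmoothZ|exact: hsmooth_fsum|exact: QZ|exact: IH].
Qed.

(** Annihilation operators move to the right by the commutation relations, and
    vanish on the vacuum. *)
Lemma hsmooth_rhoF W a u : open W -> smooth_in F W a -> hsmooth W u ->
  hsmooth W (fun x => rho (a x) (u x)).
Proof.
move=> oW ha hu; apply: hsmooth_local => // x Wx.
have [W1 [e1 [ o1 x1 s1 d1 u1]]] := hu x Wx; exists W1 => //.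
have ha1 := smooth_in_sub s1 ha.
suff h : hsmooth W1 (fun y => rho (a y) (fsum e1 y)).
  by apply: (hsmooth_eq _ h) => y y1; rewrite u1.
apply: (fsum_ind (Q := fun u => hsmooth W1 (fun y => rho (a y) (u y))) o1) d1.
- by apply: (hsmooth_eq _ (hsmooth0 o1)) => y _; rewrite (rho0 (hm y)).
- apply: (hsmooth_eq _ (hsmooth0 o1)) => y y1.
  by rewrite (hm_vac (hm y)) //; exact: ha1.2.
- move=> p q _ _ hp hq; apply: (hsmooth_eq _ (hsmoothD o1 hp hq)) => y _.
  by rewrite (rhoD (hm y)).
- move=> f p hf _ hp; apply: (hsmooth_eq _ (hsmoothZ o1 hf hp)) => y _.
  by rewrite (rhoZ (hm y)).
- move=> z p hz hp hap.
  have hf : smooth_fun W1 (fun y => form (a y) (z y)) by apply: pform_smooth => //; [exact: ha1.1|exact: hz.1].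
  apply: (hsmooth_eq _ (hsmoothD o1 (hsmooth_rhob o1 hz hap) (hsmoothZ o1 hf hp))) => y _.
  by rewrite (hm_comm (hm y) (a y)).
Qed.

Lemma hsmooth_rho W a u : open W -> smoothH W a -> hsmooth W u ->
  hsmooth W (fun x => rho (a x) (u x)).
Proof.
move=> oW ha hu.
have h1 := hsmooth_rhoF oW (smooth_projF oW ha) hu.
have h2 := hsmooth_rhob oW (smooth_projFbar oW ha) hu.
apply: (hsmooth_eq _ (hsmoothD oW h1 h2)) => y _.
by rewrite -(rhoDl (hm y)) projF_add.
Qed.

Lemma hsmooth_poly W u x : hsmooth W u -> W x -> poly (u x).
Proof.
move=> hu Wx; have [W1 [e1 [ o1 x1 s1 d1 u1]]] := hu x Wx.
rewrite u1 // /fsum /comb; elim: e1 d1 {u1} => [|p e IH] d1.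
  by rewrite big_nil; constructor.
have [h1 h2 h3] := comb_data_cons d1.
rewrite big_cons; constructor; last exact: IH.
by move=> b /mapP[z /h2[_ hz] ->]; exact: hz.
Qed.

Context (D : covder Fk).
Hypothesis Dconn : is_connection hsmooth D.
Hypothesis Dvac : forall c v x, mdom c x -> D c v vac x = 0.
Hypothesis Dmul : forall c v W z u, open W -> W `<=` mdom c ->
  smooth_in Fb W z -> hsmooth W u -> forall x, W x ->
  D c v (fun y => rho (z y) (u y)) x =
    rho (prb (nabla c v z x)) (u x) + rho (z x) (D c v u x).

Section Chart.
Context (c : mchart S).

Let D0 v W x : open W -> W `<=` mdom c -> W x -> D c v (fun y => 0) x = 0.
Proof. exact: (conn0 Dconn (@hsmooth0)). Qed.

(** Annihilation operators are also derived by the Leibniz rule: they are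
    determined by their commutators with the creation operators, and the form
    is flat. *)
Lemma D_rhoF v W a u x : open W -> W `<=` mdom c -> smooth_in F W a -> hsmooth W u -> W x ->
  D c v (fun y => rho (a y) (u y)) x =
    rho (pr (nabla c v a x)) (u x) + rho (a x) (D c v u x).
Proof.
move=> oW Wc ha hu Wx.
have [W1 [e1 [ o1 x1 s1 d1 u1]]] := hu x Wx.
have W1c : W1 `<=` mdom c by move=> y /s1/Wc.
have ha1 := smooth_in_sub s1 ha; have hu1 := hsmooth_sub o1 s1 hu.
have hf1 := hsmooth_fsum o1 d1.
rewrite (conn_local Dconn v o1 W1c hu1 hf1 u1 x1).
rewrite (conn_local Dconn v o1 W1c (hsmooth_rhoF o1 ha1 hu1) (hsmooth_rhoF o1 ha1 hf1)) //; last first.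
  by move=> y y1; rewrite u1.
rewrite u1 //; move: x x1 {Wx}.
apply: (fsum_ind (Q := fun u => forall x, W1 x -> D c v (fun y => rho (a y) (u y)) x =
    rho (pr (nabla c v a x)) (u x) + rho (a x) (D c v u x)) o1) d1.
- move=> x x1; rewrite (D0 v o1 W1c x1) !(rho0 (hm x)) addr0.
  rewrite -[RHS](D0 v o1 W1c x1).
  by congr (D c v _ x); apply: functional_extensionality_dep => y; rewrite (rho0 (hm y)).
- move=> x x1; rewrite (Dvac v (W1c x x1)) (rho0 (hm x)) (hm_vac (hm x)) ?projF_mem // addr0.
  rewrite -[RHS](D0 v o1 W1c x1).
  apply: (conn_local Dconn v o1 W1c _ (hsmooth0 o1) _ x1).
    exact (hsmooth_rhoF o1 ha1 (hsmooth_vac o1)).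
  by move=> y y1; rewrite (hm_vac (hm y)) //; exact: ha1.2.
- move=> p q sp sq hp hq x x1.
  have tp := hsmooth_rhoF o1 ha1 sp; have tq := hsmooth_rhoF o1 ha1 sq.
  have -> : (fun y => rho (a y) (p y + q y)) = fun y => rho (a y) (p y) + rho (a y) (q y).
    by apply: functional_extensionality_dep => y; rewrite (rhoD (hm y)).
  rewrite (conn_add Dconn v o1 W1c tp tq x1) (conn_add Dconn v o1 W1c sp sq x1).
  by rewrite hp // hq // !(rhoD (hm x)) addrACA.
- move=> f p sf sp hp x x1.
  have tp := hsmooth_rhoF o1 ha1 sp.
  have -> : (fun y => rho (a y) (f y *: p y)) = fun y => f y *: rho (a y) (p y).
    by apply: functional_extensionality_dep => y; rewrite (rhoZ (hm y)).
  rewrite (conn_leibniz Dconn v o1 W1c sf tp x1) (conn_leibniz Dconn v o1 W1c sf sp x1).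
  by rewrite hp // (rhoD (hm x)) !(rhoZ (hm x)) scalerDr addrCA.
- move=> z p sz sp hp x x1.
  have tp := hsmooth_rhoF o1 ha1 sp.
  have hf : smooth_fun W1 (fun y => form (a y) (z y)) by apply: pform_smooth => //; [exact: ha1.1|exact: sz.1].
  have -> : (fun y => rho (a y) (rho (z y) (p y))) =
      fun y => rho (z y) (rho (a y) (p y)) + form (a y) (z y) *: p y.
    by apply: functional_extensionality_dep => y; rewrite (hm_comm (hm y)).
  rewrite (conn_add Dconn v o1 W1c (hsmooth_rhob o1 sz tp) (hsmoothZ o1 hf sp) x1).
  rewrite (Dmul v o1 W1c sz tp x1) (Dmul v o1 W1c sz sp x1) hp //.
  rewrite (conn_leibniz Dconn v o1 W1c hf sp x1) (pform_flat v o1 W1c ha1.1 sz.1 x1).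
  have aF := ha1.2 x x1; have zF := sz.2 x x1.
  have g1 : form (nabla c v a x) (z x) = form (pr (nabla c v a x)) (z x).
    by rewrite formNr -(form_projF _ zF) -formNr.
  have g2 : form (a x) (nabla c v z x) = form (a x) (prb (nabla c v z x)).
    by rewrite form_projFbar.
  rewrite g1 g2 (rhoD (hm x)) scalerDl.
  rewrite (hm_comm (hm x) (pr (nabla c v a x))) (rhoD (hm x) (a x)).
  rewrite (hm_comm (hm x) (a x) (prb (nabla c v z x))) (hm_comm (hm x) (a x) (z x)).
  have ac (M : zmodType) (p1 p2 p3 p4 p5 p6 : M) :
    p1 + (p2 + p3) + (p4 + p5 + p6) = p2 + p4 + (p1 + p5 + (p3 + p6)).
    by rewrite [LHS](AC ((1*2)*3) ((2*4)*(1*5*(3*6)))).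
  exact: ac.
Qed.


Lemma D_rho v W a u x : open W -> W `<=` mdom c -> smoothH W a -> hsmooth W u -> W x ->
  D c v (fun y => rho (a y) (u y)) x =
    rho (pr (nabla c v (fun y => pr (a y)) x) + prb (nabla c v (fun y => prb (a y)) x)) (u x)
    + rho (a x) (D c v u x).
Proof.
move=> oW Wc ha hu Wx.
have h1 := smooth_projF oW ha; have h2 := smooth_projFbar oW ha.
have -> : (fun y => rho (a y) (u y)) =
    fun y => rho (pr (a y)) (u y) + rho (prb (a y)) (u y).
  by apply: functional_extensionality_dep => y; rewrite -(rhoDl (hm y)) projF_add.
rewrite (conn_add Dconn v oW Wc (hsmooth_rhoF oW h1 hu) (hsmooth_rhob oW h2 hu) Wx).
rewrite (D_rhoF v oW Wc h1 hu Wx) (Dmul v oW Wc h2 hu Wx) addrACA -!(rhoDl (hm x)).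
by rewrite projF_add.
Qed.

End Chart.

Definition fock_nabla : covder Fk := fun c v u x => D c v u x + conn_op (@rho x) c v (u x).

(** In a local frame [sigma] and [sigmabar] of the members of the frame are
    projections of covariant derivatives, hence smooth. *)
Lemma hsmooth_conn_op c v W u : open W -> W `<=` mdom c -> hsmooth W u ->
  hsmooth W (fun x => conn_op (@rho x) c v (u x)).
Proof.
move=> oW Wc hu; apply: (hsmooth_local oW) => x Wx.
have [W0 [f [b [oW0 W0x hf hb df]]]] := local_frames V x.
pose N := W `&` W0; have oN : open N by exact: openI.
have NW : N `<=` W by move=> y [].
have Nc : N `<=` mdom c by move=> y /NW/Wc.
exists N; first by split.
have huN := hsmooth_sub oN NW hu.
have hfN j : smooth_in F N (f j) by apply: smooth_in_sub (hf j) => y [].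
have hbN j : smooth_in Fb N (b j) by apply: smooth_in_sub (hb j) => y [].
have hgN j : smooth_in F N (fun y => - f j y).
  have -> : (fun y => - f j y) = fun y => -1 *: f j y.
    by apply: functional_extensionality_dep => y; rewrite scaleN1r.
  exact (smooth_inZ oN (smooth_fun_cst N (-1)) (hfN j)).
have h1 : hsmooth N (fun y => \sum_j rho (pr (nabla c v (b j) y)) (rho (f j y) (u y))).
  apply: (hsmooth_sum _ oN) => j.
  apply: (hsmooth_rhoF oN (smooth_projF oN (nabla_smooth v oN Nc (hbN j).1))).
  exact (hsmooth_rhoF oN (hfN j) huN).
have h2 : hsmooth N (fun y => \sum_j
    rho (prb (nabla c v (fun y' => - f j y') y)) (rho (b j y) (u y))).
  apply: (hsmooth_sum _ oN) => j.
  apply: (hsmooth_rhob oN (smooth_projFbar oN (nabla_smooth v oN Nc (hgN j).1))).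
  exact (hsmooth_rhob oN (hbN j) huN).
have k := smooth_fun_cst N (2^-1).
apply: (hsmooth_eq _ (hsmoothD oN (hsmoothZ oN k h1) (hsmoothZ oN k h2))) => y Ny.
rewrite (conn_opE (hm y) (Nc y Ny) v (u y) (df y Ny.2)) /quad_op.
have e1 : \sum_j rho (pr (nabla c v (b j) y)) (rho (f j y) (u y)) =
    \sum_j rho (sigmabar c v (b j y)) (rho (f j y) (u y)).
  by apply: eq_bigr => j _; rewrite (sigmabarE v oN Nc (hbN j) Ny).
have e2 : \sum_j rho (prb (nabla c v (fun y' => - f j y') y)) (rho (b j y) (u y)) =
    \sum_j rho (sigma c v (- f j y)) (rho (b j y) (u y)).
  by apply: eq_bigr => j _; rewrite (sigmaE v oN Nc (hgN j) Ny).
by rewrite e1 e2.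
Qed.

Lemma conn_op_chart c c' v x (u : Fk x) : mdom c x -> mdom c' x ->
  conn_op (@rho x) c v u =
    conn_op (@rho x) c' ('d (mcoord c' \o mparam c) (mcoord c x) v) u.
Proof.
move=> cx c'x; have [f [b df]] := exists_dual_frames V x.
rewrite (conn_opE (hm x) cx _ _ df) (conn_opE (hm x) c'x _ _ df) /quad_op.
have e1 : \sum_j rho (sigmabar c v (b j)) (rho (f j) u) = \sum_j rho (sigmabar c'
    ('d (mcoord c' \o mparam c) (mcoord c x) v) (b j)) (rho (f j) u).
  by apply: eq_bigr => j _; rewrite -(sigmabar_chart v cx c'x (df_memFbar df j)).
have e2 : \sum_j rho (sigma c v (- f j)) (rho (b j) u) = \sum_j rho (sigma c'
    ('d (mcoord c' \o mparam c) (mcoord c x) v) (- f j)) (rho (b j) u).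
  apply: eq_bigr => j _; rewrite -(sigma_chart v cx c'x) //.
  by rewrite memvN; exact: df_memF df j.
by rewrite e1 e2.
Qed.

Lemma fock_nabla_conn : is_connection hsmooth fock_nabla.
Proof.
split.
- move=> c v W u oW Wc hu.
  exact (hsmoothD oW (conn_smooth Dconn v oW Wc hu) (hsmooth_conn_op v oW Wc hu)).
- move=> c v W u u' oW Wc hu hu' e x Wx.
  by rewrite /fock_nabla (conn_local Dconn v oW Wc hu hu' e Wx) (e x Wx).
- move=> c v W u u' oW Wc hu hu' x Wx.
  rewrite /fock_nabla (conn_add Dconn v oW Wc hu hu' Wx) [RHS]addrACA.
  by have := conn_op_linear (hm x) c v 1 (u x) (u' x); rewrite !scale1r => ->.
- move=> c v W f u oW Wc hf hu x Wx.
  rewrite /fock_nabla (conn_leibniz Dconn v oW Wc hf hu Wx) -addrA scalerDr.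
  have := conn_op_linear (hm x) c v (f x) (u x) 0; rewrite addr0 => ->.
  have := conn_op_linear (hm x) c v (-1) 0 0; rewrite scaler0 addr0 scaleN1r addNr => ->.
  by rewrite addr0.
- move=> c k v w W u oW Wc hu x Wx.
  rewrite /fock_nabla (conn_linear Dconn k v w oW Wc hu Wx).
  by rewrite (conn_op_vlinear (hm x) (Wc x Wx)) (scalerDr _ (D c v u x)) [RHS]addrACA.
- move=> c c' v W u oW Wc hu x Wx; have [cx c'x] := Wc x Wx.
  by rewrite /fock_nabla (conn_chart Dconn v oW Wc hu Wx) (conn_op_chart v (u x) cx c'x).
Qed.

Lemma rho_split x (p q b : H x) (u d e : Fk x) :
  rho (pr p + prb q) u + rho b d + (rho b e + rho (prb p + pr q) u) =
  rho (p + q) u + (rho b d + rho b e).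
Proof.
rewrite [X in _ + X = _]addrC [LHS]addrACA -(rhoDl (hm x)).
have -> // : pr p + prb q + (prb p + pr q) = p + q.
by rewrite [LHS]addrACA projF_add [X in _ + X]addrC projF_add.
Qed.

(** Off the diagonal the flat connection is [sigma + sigmabar], which is what
    [conn_op] contributes: the Heisenberg action is parallel. *)
Lemma fock_nabla_rho c v W a u x : open W -> W `<=` mdom c -> smoothH W a ->
  hsmooth W u -> W x ->
  fock_nabla c v (fun y => rho (a y) (u y)) x =
    rho (nabla c v a x) (u x) + rho (a x) (fock_nabla c v u x).
Proof.
move=> oW Wc ha hu Wx; rewrite /fock_nabla (D_rho v oW Wc ha hu Wx).
have h1 := smooth_projF oW ha; have h2 := smooth_projFbar oW ha.
rewrite (conn_op_comm (hm x) (Wc x Wx)).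
rewrite (sigmaE v oW Wc h1 Wx) (sigmabarE v oW Wc h2 Wx) (rhoD (hm x)).
have -> : nabla c v a x =
    nabla c v (fun y => pr (a y)) x + nabla c v (fun y => prb (a y)) x.
  rewrite -(nablaD v oW Wc h1.1 h2.1 Wx).
  by congr (nabla c v _ x); apply: functional_extensionality_dep => y; rewrite projF_add.
exact: rho_split.
Qed.

End FockBundle.

Arguments hsmooth_fsum {R n S r g V Fk} rho vac {W e} _ _.
Arguments hsmooth_sub {R n S r g V Fk rho vac W W' u} _ _ _.
Arguments hsmoothD {R n S r g V Fk rho vac W u u'} _ _ _.
Arguments hsmoothZ {R n S r g V Fk rho vac W f u} _ _ _.
Arguments hsmooth_vac {R n S r g V Fk} rho vac {W} _.
Arguments hsmooth0 {R n S r g V Fk} rho vac {W} _.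
Arguments hsmooth_sum {R n S r g V Fk rho vac W I} q {h} _ _.
Arguments hsmooth_rhob {R n S r g V Fk rho vac} hm {W z u} _ _ _.
Arguments hsmooth_rhoF {R n S r g V Fk rho vac} hm {W a u} _ _ _.
Arguments hsmooth_rho {R n S r g V Fk rho vac} hm {W a u} _ _ _.

(** * Curvature and unitarity on the Fock bundle *)
Section NumberOperator.
Context {R : realType} {n : nat} {S : cmanifold R n} {r g : nat}.
Context (V : pvhs S r g) (x : S).
Local Notation H := (vfib (pbun V) x).
Local Notation form := (pform V x).
Local Notation Fb := (Fbar V x).
Context (Fk : lmodType R[i]) (rho : H -> Fk -> Fk) (vac : Fk).
Hypothesis hm : heisenberg_module rho vac.

Local Opaque projF projFbar.

Definition degree_two (u : Fk) := exists2 t : seq (H * H),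
  all (fun p => (p.1 \in Fb) && (p.2 \in Fb)) t & u = hrho2 rho t vac.

Lemma degree_two_rho z z' : z \in Fb -> z' \in Fb -> degree_two (rho z (rho z' vac)).
Proof.
by move=> zF z'F; exists [:: (z, z')]; rewrite /= ?zF ?z'F // rho2_cons rho2_nil addr0.
Qed.

Lemma degree_twoD u u' : degree_two u -> degree_two u' -> degree_two (u + u').
Proof.
move=> [t h ->] [t' h' ->]; exists (t ++ t'); first by rewrite all_cat h h'.
by rewrite /hrho2 big_cat.
Qed.

Lemma degree_twoN u : degree_two u -> degree_two (- u).
Proof.
move=> [t h ->]; exists [seq (- p.1, p.2) | p <- t].
  by rewrite all_map; apply: sub_all h => p /=; rewrite memvN.
by rewrite /hrho2 big_map -sumrN; apply: eq_bigr => p _; rewrite (rhoNl hm).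
Qed.

Lemma degree_two_sum (I : Type) (q : seq I) (h : I -> Fk) :
  (forall i, degree_two (h i)) -> degree_two (\sum_(i <- q) h i).
Proof.
move=> hh; elim/big_ind: _ => //; last exact: degree_twoD.
by exists [::]; rewrite ?rho2_nil.
Qed.

Lemma rho_swap z z' u : z \in Fb -> z' \in Fb -> rho z (rho z' u) = rho z' (rho z u).
Proof. by move=> zF z'F; rewrite (hm_comm hm) (form_Fbar zF z'F) scale0r addr0. Qed.

Lemma rho_vacE a : rho a vac = rho (projFbar (V := V) a) vac.
Proof.
transitivity (rho (projF (V := V) a + projFbar (V := V) a) vac); first by rewrite projF_add.
have e := hm_vac hm (projF_mem a).
by rewrite (rhoDl hm) [X in X + _]e [LHS]add0r.
Qed.

Lemma rho_rho_vac a b : rho a (rho b vac) =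
  form (projF (V := V) a) b *: vac + rho (projFbar (V := V) a) (rho b vac).
Proof.
rewrite -{1}(projF_add a) (rhoDl hm); congr (_ + _).
by rewrite (hm_comm hm) (hm_vac hm (projF_mem a)) (rho0 hm) add0r.
Qed.

(** The number operator, the sum of the [rho (b j) rho (f j)], multiplies a
    vector of degree two by 2. *)
Lemma degree_two_eq0 (f b : 'I_g -> H) u : dual_frames f b -> degree_two u ->
  (forall j, rho (f j) u = 0) -> u = 0.
Proof.
move=> df [t tF ->] h.
have N : \sum_j rho (b j) (rho (f j) (hrho2 rho t vac)) = hrho2 rho t vac + hrho2 rho t vac.
  elim: t tF {h} => [|[z z'] t IH] /=.
    by move=> _; rewrite rho2_nil addr0 big1 // => j _; rewrite !(rho0 hm).
  case/andP => /andP[zF zF'] /IH {}IH.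
  rewrite !rho2_cons /=.
  under eq_bigr do rewrite !(rhoD hm).
  rewrite big_split IH [RHS]addrACA; congr (_ + _).
  have e j : rho (b j) (rho (f j) (rho z (rho z' vac))) =
     rho (form (f j) z' *: b j) (rho z vac) + rho (form (f j) z *: b j) (rho z' vac).
    rewrite (hm_comm hm (f j)) (hm_comm hm (f j) z') (hm_vac hm (df_memF df j)) (rho0 hm) add0r.
    by rewrite (rhoZ hm) (rhoD hm) !(rhoZ hm) !(rhoZl hm).
  rewrite (eq_bigr _ (fun j _ => e j)) big_split /= -!(rho_suml hm) -!(df_Fbar df) //.
  by rewrite (hm_comm hm z' z) (form_Fbar zF' zF) scale0r addr0.
move: N; rewrite big1 => [|j _]; last by rewrite h (rho0 hm).
move=> e; have : (2 : R[i]) *: hrho2 rho t vac = 0.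
  by rewrite -[2]/(1 + 1) scalerDl !scale1r -e.
by move/eqP; rewrite scaler_eq0 pnatr_eq0 /= => /eqP.
Qed.

End NumberOperator.

Section FockCurvature.
Context {R : realType} {n : nat} {S : cmanifold R n} {r g : nat}.
Context (V : pvhs S r g).
Local Notation C := (R[i]).
Local Notation Cn := (Cn R n).
Local Notation H := (vfib (pbun V)).
Local Notation F := (pF V).
Local Notation Fb := (Fbar V).
Local Notation nabla := (pnabla V).
Local Notation form := (pform V _).
Local Notation conj := (pconj V _).
Local Notation pr := (projF (V := V)).
Local Notation prb := (projFbar (V := V)).
Local Notation smoothH := (smooth_sec (E := pbun V)).
Context (Fk : S -> lmodType C) (rho : forall x, H x -> Fk x -> Fk x)
  (vac : forall x, Fk x) (ip : forall x, Fk x -> Fk x -> C).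
Hypothesis hm : forall x, heisenberg_module (@rho x) (vac x).
Hypothesis ipP : forall x, fock_form (@rho x) (vac x) (@ip x).
Local Notation hsmooth := (hsmooth rho vac).
Context (Nab : covder Fk).
Hypothesis Nconn : is_connection hsmooth Nab.
Hypothesis Nrho : forall c v W a u x, open W -> W `<=` mdom c -> smoothH W a ->
  hsmooth W u -> W x ->
  Nab c v (fun y => rho (a y) (u y)) x =
    rho (nabla c v a x) (u x) + rho (a x) (Nab c v u x).
Hypothesis Nvac : forall c v x, mdom c x -> Nab c v vac x = conn_op (@rho x) c v (vac x).
Implicit Types (W : set S) (v w : Cn) (f : S -> C) (x : S) (c : mchart S)
  (a z : forall x, H x) (u : forall x, Fk x)
  (e : seq ((S -> C) * seq (forall x, H x))).

Local Opaque pderiv projF projFbar.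

Let Nab0 c v W x : open W -> W `<=` mdom c -> W x -> Nab c v (fun y => 0) x = 0.
Proof. exact: (conn0 Nconn (@hsmooth0 _ _ _ _ _ _ _ _ _)). Qed.

Let Ncurv0 c v w W x : open W -> W `<=` mdom c -> W x ->
  curv Nab c v w (fun y => 0) x = 0.
Proof.
exact: (curv0 Nconn (@hsmoothD _ _ _ _ _ _ _ _ _) (@hsmooth0 _ _ _ _ _ _ _ _ _)).
Qed.

Lemma ip_vac_mono x (zs : seq (H x)) : {subset zs <= Fb x} ->
  ip (hmono (@rho x) (vac x) zs) (vac x) = (nilp zs)%:R.
Proof.
case: zs => [|z zs] h; first exact: (ip_vac (ipP x)).
rewrite mono_cons (ip_vac_rho (hm x) (ipP x)) //; first by apply: h; rewrite inE eqxx.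
by apply: fock_poly_mono => z' hz'; apply: h; rewrite inE hz' orbT.
Qed.

Lemma smooth_ip_vac W u : open W -> hsmooth W u -> smooth_fun W (fun x => ip (u x) (vac x)).
Proof.
move=> oW hu; apply: smooth_fun_local => x Wx.
have [W1 [e1 [ o1 x1 s1 d1 u1]]] := hu x Wx.
exists (W `&` W1).
  by split=> //; exact: openI.
have oI : open (W `&` W1) by exact: openI.
suff h : smooth_fun (W `&` W1) (fun y => ip (fsum rho vac e1 y) (vac y)).
  by apply: (smooth_fun_eq oI _ h) => y [_ y1]; rewrite u1.
have {d1} := comb_data_sub (@good_factors_sub _ _ _ _ _ V) (W' := W `&` W1) (fun y => @proj2 _ _) d1.
elim: e1 {u1} => [|p e IH] d1.
  by apply: (smooth_fun_eq oI _ (smooth_fun_cst _ 0)) => y _; rewrite /fsum /comb big_nil (ip0l (ipP y)).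
have [h1 h2 h3] := comb_data_cons d1.
apply: (smooth_fun_eq oI _ (smooth_funD oI (smooth_funM oI h1
  (smooth_fun_cst (W `&` W1) (nilp p.2)%:R)) (IH h3))) => y Wy.
rewrite /fsum /comb big_cons (ipDl (ipP y)) (ipZl (ipP y)) ip_vac_mono.
  by rewrite /nilp size_map.
by move=> b /mapP[z /h2[_ hz] ->]; exact: hz.
Qed.

(** [pderiv c v f] is a coefficient of the derivative of [f *: vac], so that
    its smoothness, also in the other charts, is that of the connection. *)
Lemma pderiv_smooth c v W f : open W -> W `<=` mdom c -> smooth_fun W f ->
  smooth_fun W (pderiv c v f).
Proof.
move=> oW Wc hf; have hv : hsmooth W vac := hsmooth_vac rho vac oW.
have h1 : hsmooth W (Nab c v (fun y => f y *: vac y)) :=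
  conn_smooth Nconn v oW Wc (hsmoothZ oW hf hv).
have h2 : hsmooth W (Nab c v vac) := conn_smooth Nconn v oW Wc hv.
have k1 := smooth_ip_vac oW h1; have k2 := smooth_ip_vac oW h2.
apply: (smooth_fun_eq oW _ (smooth_funD oW k1 (smooth_funN oW (smooth_funM oW hf k2)))) => y Wy.
rewrite (conn_leibniz Nconn v oW Wc hf hv Wy) (ipDl (ipP y)) !(ipZl (ipP y)).
by rewrite (ip_vac (ipP y)) mulr1 addrK.
Qed.

Section Chart.
Context (c : mchart S) (v w : Cn).

Lemma Nab_local v' W u u' x : open W -> W `<=` mdom c -> hsmooth W u -> hsmooth W u' ->
  (forall y, W y -> u y = u' y) -> W x -> Nab c v' u x = Nab c v' u' x.
Proof. by move=> oW Wc hu hu' e Wx; exact (conn_local Nconn v' oW Wc hu hu' e Wx). Qed.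

Lemma Nab_rho2 v1 v2 W a u x : open W -> W `<=` mdom c -> smoothH W a -> hsmooth W u ->
  W x -> Nab c v1 (Nab c v2 (fun y => rho (a y) (u y))) x =
  (rho (nabla c v1 (nabla c v2 a) x) (u x) + rho (a x) (Nab c v1 (Nab c v2 u) x))
  + (rho (nabla c v2 a x) (Nab c v1 u x) + rho (nabla c v1 a x) (Nab c v2 u x)).
Proof.
move=> oW Wc ha hu Wx.
have sa := nabla_smooth v2 oW Wc ha.
have su : hsmooth W (Nab c v2 u) := conn_smooth Nconn v2 oW Wc hu.
have t1 : hsmooth W (fun y => rho (nabla c v2 a y) (u y)) := hsmooth_rho hm oW sa hu.
have t2 : hsmooth W (fun y => rho (a y) (Nab c v2 u y)) := hsmooth_rho hm oW ha su.
have t0 : hsmooth W (fun y => rho (a y) (u y)) := hsmooth_rho hm oW ha hu.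
have t3 : hsmooth W (Nab c v2 (fun y => rho (a y) (u y))) := conn_smooth Nconn v2 oW Wc t0.
have t12 := hsmoothD oW t1 t2.
rewrite (Nab_local v1 oW Wc t3 t12 (fun y Wy => Nrho v2 oW Wc ha hu Wy) Wx).
rewrite (conn_add Nconn v1 oW Wc t1 t2 Wx).
rewrite (Nrho v1 oW Wc sa hu Wx) (Nrho v1 oW Wc ha su Wx).
have ac (M : zmodType) (p q s t : M) : (p + q) + (s + t) = (p + t) + (q + s).
  by rewrite [s + t]addrC addrACA.
exact: ac.
Qed.

(** Expanding twice, the mixed terms are symmetric in [v] and [w]. *)
Lemma Nab_curv_rho W a u x : open W -> W `<=` mdom c -> smoothH W a -> hsmooth W u -> W x ->
  curv Nab c v w (fun y => rho (a y) (u y)) x = rho (a x) (curv Nab c v w u x).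
Proof.
move=> oW Wc ha hu Wx.
rewrite /curv (Nab_rho2 v w oW Wc ha hu Wx) (Nab_rho2 w v oW Wc ha hu Wx).
have fl := pnabla_flat v w oW Wc ha Wx; rewrite scale0r in fl.
have -> : nabla c v (nabla c w a) x = nabla c w (nabla c v a) x by apply/eqP; rewrite -subr_eq0; apply/eqP.
rewrite (rhoD (hm x)) (rhoN (hm x)).
have ac (M : zmodType) (p q q' s t : M) : (p + q) + (s + t) - ((p + q') + (t + s)) = q - q'.
  by rewrite [t + s]addrC opprD addrACA subrr addr0 opprD addrACA subrr add0r.
exact: ac.
Qed.


(** The curvature commutes with the action, and [F] annihilates the vacuum. *)
Lemma curv_annihilate W a x : open W -> W `<=` mdom c -> smooth_in F W a -> W x ->
  rho (a x) (curv Nab c v w vac x) = 0.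
Proof.
move=> oW Wc ha Wx; have hv := hsmooth_vac rho vac oW.
rewrite -(Nab_curv_rho oW Wc ha.1 hv Wx) -[RHS](Ncurv0 v w oW Wc Wx).
apply: (curv_local Nconn v w oW Wc (hsmooth_rho hm oW ha.1 hv) (hsmooth0 rho vac oW) _ Wx).
by move=> y Wy; rewrite (hm_vac (hm y)) //; exact: ha.2.
Qed.

Lemma sigmaZ v' x k (a : H x) : mdom c x -> a \in F x ->
  sigma c v' (k *: a) = k *: sigma c v' a.
Proof.
move=> cx aF; have s0 : sigma c v' (0 : H x) = 0.
  by have := sigma_linear v' (-1) cx (mem0v (F x)) (mem0v (F x));
    rewrite scaler0 addr0 scaleN1r addNr.
by have := sigma_linear v' k cx aF (mem0v (F x)); rewrite s0 !addr0.
Qed.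

Lemma sigmabarZ v' x k (a : H x) : mdom c x -> a \in Fb x ->
  sigmabar c v' (k *: a) = k *: sigmabar c v' a.
Proof.
by move=> cx aF; rewrite /sigmabar conjZ sigmaZ -?mem_Fbar // conjZ conjCK.
Qed.

Section Frames.
Context (W : set S) (f b : 'I_g -> forall x, H x).
Hypothesis oW : open W.
Hypothesis Wc : W `<=` mdom c.
Hypothesis hf : forall j, smooth_in F W (f j).
Hypothesis hb : forall j, smooth_in Fb W (b j).
Hypothesis df : forall x, W x -> dual_frames (f^~ x) (b^~ x).

(** On the vacuum the connection is the sum of the [rho (z j) rho (b j)]. *)
Let z v' j y : H y := - 2^-1 *: prb (nabla c v' (f j) y).

Let hz v' j : smooth_in Fb W (z v' j).
Proof.
apply: (smooth_inZ oW (smooth_fun_cst W (- 2^-1))).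
exact (smooth_projFbar oW (nabla_smooth v' oW Wc (hf j).1)).
Qed.

Let zE v' j y : W y -> z v' j y = - 2^-1 *: sigma c v' (f j y).
Proof. by move=> Wy; rewrite /z (sigmaE v' oW Wc (hf j) Wy). Qed.

Lemma Nab_vacE v' y : W y ->
  Nab c v' vac y = \sum_j rho (z v' j y) (rho (b j y) (vac y)).
Proof.
move=> Wy; have cy := Wc Wy.
rewrite (Nvac v' cy) (conn_opE (hm y) cy v' (vac y) (df Wy)) /quad_op.
rewrite big1 => [|j _]; last by rewrite (hm_vac (hm y) (df_memF (df Wy) j)) (rho0 (hm y)).
rewrite scaler0 add0r scaler_sumr; apply: eq_bigr => j _.
rewrite (zE v' j Wy) -scaleN1r (sigmaZ v' _ cy (df_memF (df Wy) j)).
by rewrite -(rhoZl (hm y)) scalerA mulrN1.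
Qed.

Let lam v1 v2 x := \sum_j form (pr (nabla c v1 (z v2 j) x)) (b j x).
Let quad v1 v2 x := \sum_j (rho (prb (nabla c v1 (z v2 j) x)) (rho (b j x) (vac x)) +
  rho (z v2 j x) (rho (prb (nabla c v1 (b j) x)) (vac x))).
Let quart v1 v2 x := \sum_j rho (z v2 j x) (rho (b j x) (Nab c v1 vac x)).

Lemma Nab2_vacE v1 v2 x : W x ->
  Nab c v1 (Nab c v2 vac) x = lam v1 v2 x *: vac x + quad v1 v2 x + quart v1 v2 x.
Proof.
move=> Wx; have hv := hsmooth_vac rho vac oW.
have s1 j : hsmooth W (fun y => rho (b j y) (vac y)) := hsmooth_rho hm oW (hb j).1 hv.
have s2 j : hsmooth W (fun y => rho (z v2 j y) (rho (b j y) (vac y))) :=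
  hsmooth_rho hm oW (hz v2 j).1 (s1 j).
have s3 := hsmooth_sum (index_enum 'I_g) oW s2.
have s4 : hsmooth W (Nab c v2 vac) := conn_smooth Nconn v2 oW Wc hv.
rewrite (Nab_local v1 oW Wc s4 s3 (fun y Wy => Nab_vacE v2 Wy) Wx).
rewrite (conn_sum Nconn (@hsmoothD _ _ _ _ _ _ _ _ _) (@hsmooth0 _ _ _ _ _ _ _ _ _)
  v1 _ oW Wc s2 Wx).
have e j : Nab c v1 (fun y => rho (z v2 j y) (rho (b j y) (vac y))) x =
  form (pr (nabla c v1 (z v2 j) x)) (b j x) *: vac x +
  (rho (prb (nabla c v1 (z v2 j) x)) (rho (b j x) (vac x)) +
  rho (z v2 j x) (rho (prb (nabla c v1 (b j) x)) (vac x))) +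
  rho (z v2 j x) (rho (b j x) (Nab c v1 vac x)).
  rewrite (Nrho v1 oW Wc (hz v2 j).1 (s1 j) Wx) (Nrho v1 oW Wc (hb j).1 hv Wx).
  rewrite (rhoD (hm x)) addrA; congr (_ + _).
  by rewrite (rho_rho_vac (hm x) (nabla c v1 (z v2 j) x)) (rho_vacE (hm x) (nabla c v1 (b j) x)) addrA.
rewrite (eq_bigr _ (fun j _ => e j)) !big_split /=.
by rewrite -scaler_suml /quad big_split.
Qed.

(** Creation operators commute. *)
Lemma quart_sym v1 v2 x : W x -> quart v1 v2 x = quart v2 v1 x.
Proof.
move=> Wx; rewrite /quart !Nab_vacE //.
under eq_bigr do rewrite !(rho_sum (hm x)).
under [RHS]eq_bigr do rewrite !(rho_sum (hm x)).
rewrite exchange_big /=; apply: eq_bigr => k _; apply: eq_bigr => j _.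
have z1 := (hz v1 k).2 x Wx; have z2 := (hz v2 j).2 x Wx.
have b1 := (hb k).2 x Wx; have b2 := (hb j).2 x Wx.
rewrite (rho_swap (hm x) (rho (b k x) (vac x)) b2 z1) (rho_swap (hm x) _ z2 z1).
by rewrite (rho_swap (hm x) (vac x) b2 b1) (rho_swap (hm x) _ z2 b1).
Qed.

Lemma quad_degree_two v1 v2 x : W x -> degree_two (@rho x) (vac x) (quad v1 v2 x).
Proof.
move=> Wx; apply: degree_two_sum => j; apply: degree_twoD; apply: degree_two_rho;
  by [exact: projFbar_mem|exact: (hb j).2|exact: (hz v2 j).2].
Qed.

Lemma lamE v1 v2 x : W x ->
  lam v1 v2 x = - 2^-1 * \sum_j form (sigmabar c v1 (sigma c v2 (f j x))) (b j x).
Proof.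
move=> Wx; rewrite /lam mulr_sumr; apply: eq_bigr => j _.
rewrite -(sigmabarE v1 oW Wc (hz v2 j) Wx) (zE v2 j Wx).
rewrite (sigmabarZ v1 _ (Wc Wx)) ?formZl //.
by apply: (sigma_mem v2 (Wc Wx)); exact: (hf j).2.
Qed.

Lemma curv_vac_frame x : W x ->
  curv Nab c v w vac x = (- 2^-1 * trace_sigmabar_sigma V c v w x) *: vac x.
Proof.
move=> Wx; have cx := Wc Wx.
have e : curv Nab c v w vac x = (lam v w x - lam w v x) *: vac x +
    (quad v w x - quad w v x).
  rewrite /curv (Nab2_vacE v w Wx) (Nab2_vacE w v Wx) (quart_sym v w Wx).
  have ac (M : zmodType) (p p' q q' s : M) : p + q + s - (p' + q' + s) = p - p' + (q - q').
    by rewrite opprD addrACA subrr addr0 opprD addrACA.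
  rewrite ac scalerBl //.
(* [F] annihilates both the curvature of the vacuum and the vacuum, hence also
   the part of degree two. *)
have q0 : quad v w x - quad w v x = 0.
  apply: (degree_two_eq0 (hm x) (df Wx)).
    apply: degree_twoD; first exact: quad_degree_two.
    by apply: (degree_twoN (hm x)); exact: quad_degree_two.
  move=> j; have := curv_annihilate oW Wc (hf j) Wx; rewrite e (rhoD (hm x)) (rhoZ (hm x)).
  by rewrite (hm_vac (hm x) (df_memF (df Wx) j)) scaler0 add0r.
rewrite e q0 addr0 !lamE //; congr (_ *: _).
rewrite -mulrBr; congr (_ * _); rewrite /trace_sigmabar_sigma.
rewrite (trace_on_frames (df Wx)).
- by rewrite -sumrB; apply: eq_bigr => j _; rewrite formDl formNl.
- by move=> a aF; apply: memvB; apply: (sigmabar_mem _ cx); exact: (sigma_mem _ cx).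
- move=> k a a' aF aF'; rewrite !(sigma_linear _ _ cx) // !(sigmabar_linear _ _ cx) //;
    try exact: (sigma_mem _ cx).
  by rewrite scalerBr opprD addrACA.
Qed.

End Frames.

Lemma curv_vac x : mdom c x ->
  curv Nab c v w vac x = (- 2^-1 * trace_sigmabar_sigma V c v w x) *: vac x.
Proof.
move=> cx; have [W [f [b [oW Wx hf hb df]]]] := local_frames V x.
have oN : open (W `&` mdom c) by apply: openI => //; exact: mdom_open.
apply: (curv_vac_frame (W := W `&` mdom c) (f := f) (b := b) oN) => //.
- by move=> j; apply: smooth_in_sub (hf j) => y [].
- by move=> j; apply: smooth_in_sub (hb j) => y [].
- by move=> y [Wy _]; exact: df.
Qed.

End Chart.


(** The curvature is a scalar on the vacuum and commutes with the Heisenberg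
    action, as the flat connection has no curvature. *)
Lemma fock_curvature : scalar_curvature hsmooth Nab
  (fun c v w x => - 2^-1 * trace_sigmabar_sigma V c v w x).
Proof.
move=> c v w W u oW Wc hu x Wx.
have [W1 [e1 [ o1 x1 s1 d1 u1]]] := hu x Wx.
have W1c : W1 `<=` mdom c by move=> y /s1/Wc.
have hu1 := hsmooth_sub o1 s1 hu; have hf1 := hsmooth_fsum rho vac o1 d1.
have e0 := curv_local Nconn v w o1 W1c hu1 hf1 u1 x1.
rewrite -[LHS]/(curv Nab c v w u x) e0 u1 //; move: x x1 {Wx e0}.
apply: (fsum_ind hm (Q := fun u => forall x, W1 x ->
  curv Nab c v w u x = (- 2^-1 * trace_sigmabar_sigma V c v w x) *: u x) o1) d1.
- by move=> x x1; rewrite (Ncurv0 v w o1 W1c x1) scaler0.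
- by move=> x x1; exact (curv_vac v w (W1c x x1)).
- move=> p q sp sq hp hq x x1.
  rewrite (curvD Nconn (@hsmoothD _ _ _ _ _ _ _ _ _) v w o1 W1c sp sq x1).
  by rewrite hp // hq // scalerDr.
- move=> f p sf sp hp x x1.
  rewrite (curvZ Nconn (@hsmoothD _ _ _ _ _ _ _ _ _) (@hsmoothZ _ _ _ _ _ _ _ _ _)
    (@pderiv_smooth c) v w o1 W1c sf sp x1).
  by rewrite hp // !scalerA mulrC.
- move=> z p sz sp hp x x1.
  by rewrite (Nab_curv_rho v w o1 W1c sz.1 sp x1) hp // (rhoZ (hm x)).
Qed.

Section Unitarity.
Context (c : mchart S) (v : Cn) (W : set S).
Hypothesis oW : open W.
Hypothesis Wc : W `<=` mdom c.

Definition ip_parallel u u' := forall x, W x ->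
  is_pderiv c v (fun y => ip (u y) (u' y)) x
    (ip (Nab c v u x) (u' x) + ip (u x) (Nab c v u' x)).

Lemma ip_parallel_eq u u1 u' u1' : hsmooth W u -> hsmooth W u1 ->
  hsmooth W u' -> hsmooth W u1' ->
  (forall x, W x -> u x = u1 x) -> (forall x, W x -> u' x = u1' x) ->
  ip_parallel u u' -> ip_parallel u1 u1'.
Proof.
move=> su su1 su' su1' e e' h x Wx.
rewrite -(conn_local Nconn v oW Wc su su1 e Wx) -(conn_local Nconn v oW Wc su' su1' e' Wx).
rewrite -(e x Wx) -(e' x Wx).
apply: (is_pderiv_eq oW Wx (Wc Wx) _ (h x Wx)) => y Wy.
by rewrite e // e'.
Qed.

Lemma ip_parallel_sym u u' : hsmooth W u -> hsmooth W u' ->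
  ip_parallel u u' -> ip_parallel u' u.
Proof.
move=> su su' h x Wx; have k := is_pderiv_conj (h x Wx).
have pu y (Wy : W y) := hsmooth_poly su Wy; have pu' y (Wy : W y) := hsmooth_poly su' Wy.
have nu : hsmooth W (Nab c v u) := conn_smooth Nconn v oW Wc su.
have nu' : hsmooth W (Nab c v u') := conn_smooth Nconn v oW Wc su'.
have k' : is_pderiv c v (fun y => ip (u' y) (u y)) x
    ((ip (Nab c v u x) (u' x) + ip (u x) (Nab c v u' x))^*).
  apply: (is_pderiv_eq oW Wx (Wc Wx) _ k) => y Wy.
  exact (ip_conj (ipP y) (pu y Wy) (pu' y Wy)).
rewrite rmorphD /= (ip_conj (ipP x) (hsmooth_poly nu Wx) (pu' x Wx)) in k'.
by rewrite (ip_conj (ipP x) (pu x Wx) (hsmooth_poly nu' Wx)) addrC in k'.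
Qed.

Lemma ip_parallelD u1 u2 u' : hsmooth W u1 -> hsmooth W u2 ->
  ip_parallel u1 u' -> ip_parallel u2 u' -> ip_parallel (fun x => u1 x + u2 x) u'.
Proof.
move=> s1 s2 h1 h2 x Wx; rewrite (conn_add Nconn v oW Wc s1 s2 Wx) !(ipDl (ipP x)).
rewrite addrACA.
apply: (is_pderiv_eq oW Wx (Wc Wx) _ (is_pderivD (h1 x Wx) (h2 x Wx))) => y _.
by rewrite (ipDl (ipP y)).
Qed.

Lemma ip_parallelZ f u u' : smooth_fun W f -> hsmooth W u ->
  ip_parallel u u' -> ip_parallel (fun x => f x *: u x) u'.
Proof.
move=> sf su h x Wx.
rewrite (conn_leibniz Nconn v oW Wc sf su Wx) (ipDl (ipP x)) !(ipZl (ipP x)).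
rewrite -addrA -mulrDr.
have k := is_pderivM (Wc Wx) (pderivP (v := v) sf Wx (Wc Wx)) (h x Wx).
apply: (is_pderiv_eq oW Wx (Wc Wx) _ k) => y _.
by rewrite (ipZl (ipP y)).
Qed.

(** The adjoint of the action of [z] is that of a multiple of the conjugate of
    [z], and conjugation is flat. *)
Lemma ip_parallel_rho z u u' : smooth_in Fb W z -> hsmooth W u -> hsmooth W u' ->
  ip_parallel u (fun x => 'i *: rho (conj (z x)) (u' x)) ->
  ip_parallel (fun x => rho (z x) (u x)) u'.
Proof.
move=> [sz _] su su' h x Wx.
have scz : smoothH W (fun y => conj (z y)) := pconj_smooth oW sz.
have sr : hsmooth W (fun y => rho (conj (z y)) (u' y)) := hsmooth_rho hm oW scz su'.
have nu : hsmooth W (Nab c v u) := conn_smooth Nconn v oW Wc su.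
have nu' : hsmooth W (Nab c v u') := conn_smooth Nconn v oW Wc su'.
have pu := hsmooth_poly su Wx; have pu' := hsmooth_poly su' Wx.
have pnu := hsmooth_poly nu Wx; have pnu' := hsmooth_poly nu' Wx.
have E : ip (Nab c v (fun y => rho (z y) (u y)) x) (u' x) + ip (rho (z x) (u x)) (Nab c v u' x) =
  ip (Nab c v u x) ('i *: rho (conj (z x)) (u' x)) +
  ip (u x) (Nab c v (fun y => 'i *: rho (conj (z y)) (u' y)) x).
  rewrite (Nrho v oW Wc sz su Wx) (ipDl (ipP x)).
  rewrite (ip_adjoint (hm x) (ipP x) (nabla c v z x) pu pu').
  rewrite (ip_adjoint (hm x) (ipP x) (z x) pnu pu').
  rewrite (ip_adjoint (hm x) (ipP x) (z x) pu pnu').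
  rewrite (conn_leibniz Nconn v oW Wc (smooth_fun_cst W 'i) sr Wx) pderiv_cst scale0r add0r.
  rewrite (Nrho v oW Wc scz su' Wx) (pconj_flat v oW Wc sz Wx).
  by rewrite scalerDr (ipDr (ipP x)) [RHS]addrCA addrA.
rewrite E; apply: (is_pderiv_eq oW Wx (Wc Wx) _ (h x Wx)) => y Wy.
by rewrite -(ip_adjoint (hm y) (ipP y) (z y) (hsmooth_poly su Wy) (hsmooth_poly su' Wy)).
Qed.

Lemma ip_parallel0l u' : ip_parallel (fun x => 0) u'.
Proof.
move=> x Wx; rewrite (Nab0 v oW Wc Wx) !(ip0l (ipP x)) addr0.
apply: (is_pderiv_eq oW Wx (Wc Wx) _ (is_pderiv_cst c v 0 x)) => y _.
by rewrite (ip0l (ipP y)).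
Qed.

(** The vacuum has constant length, and skew-hermiticity makes the other side
    vanish. *)
Lemma ip_parallel_vac : ip_parallel vac vac.
Proof.
move=> x Wx; have pv : fock_poly (@rho x) (vac x) (vac x).
  exact: (@fock_poly_mono _ _ _ _ _ V x (Fk x) (@rho x) (vac x) [::]).
rewrite (Nvac v (Wc Wx)) (conn_op_skew (hm x) (Wc Wx) (ipP x) v pv pv).
apply: (is_pderiv_eq oW Wx (Wc Wx) _ (is_pderiv_cst c v 1 x)) => y _.
by rewrite (ip_vac (ipP y)).
Qed.


Lemma ip_parallel_fsum_vac e : fsum_data W e -> ip_parallel (fsum rho vac e) vac.
Proof.
move=> he; have sv : hsmooth W vac := hsmooth_vac rho vac oW.
have s0 : hsmooth W (fun x => 0) := hsmooth0 rho vac oW.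
apply: (fsum_ind hm (Q := fun u => ip_parallel u vac) oW) he.
- exact: ip_parallel0l.
- exact: ip_parallel_vac.
- by move=> p q sp sq; exact: ip_parallelD.
- by move=> f p sf sp; exact: ip_parallelZ.
- move=> z p sz sp hp; apply: (ip_parallel_rho sz sp sv).
  have k0 x : W x -> 0 = 'i *: rho (conj (z x)) (vac x) :> Fk x.
    by move=> Wx; rewrite (hm_vac (hm x)) ?scaler0 // -mem_Fbar; exact: sz.2.
  have s1 : hsmooth W (fun x => 'i *: rho (conj (z x)) (vac x)) := hsmooth_eq k0 s0.
  have k1 : ip_parallel p (fun x => 0) := ip_parallel_sym s0 sp (@ip_parallel0l p).
  exact (ip_parallel_eq sp sp s0 s1 (fun _ _ => erefl) k0 k1).
Qed.

End Unitarity.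

Lemma ip_parallel_local c v W u u' : open W -> W `<=` mdom c -> hsmooth W u ->
  (forall W' e, open W' -> W' `<=` W -> fsum_data W' e ->
    ip_parallel c v W' (fsum rho vac e) u') ->
  hsmooth W u' -> ip_parallel c v W u u'.
Proof.
move=> oW Wc su h su' x Wx; have [W1 [e1 [ o1 x1 s1 d1 u1]]] := su x Wx.
have W1c : W1 `<=` mdom c by move=> y /s1/Wc.
have k := h W1 e1 o1 s1 d1.
have su1 := hsmooth_sub o1 s1 su; have su1' := hsmooth_sub o1 s1 su'.
have sf := hsmooth_fsum rho vac o1 d1.
exact (ip_parallel_eq o1 W1c sf su1 su1' su1' (fun y y1 => esym (u1 y y1)) (fun y _ => erefl) k x1).
Qed.

Lemma ip_parallel_vac_all c v W u : open W -> W `<=` mdom c -> hsmooth W u ->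
  ip_parallel c v W u vac.
Proof.
move=> oW Wc su; apply: (ip_parallel_local oW Wc su _ (hsmooth_vac rho vac oW)).
move=> W' e oW' sW he; have W'c : W' `<=` mdom c by move=> y /sW/Wc.
exact (ip_parallel_fsum_vac oW' W'c he).
Qed.

Lemma fock_unitary : unitary hsmooth ip Nab.
Proof.
move=> c v W u u' oW Wc su su'.
suff h : ip_parallel c v W u u' by exact: h.
apply: (ip_parallel_local oW Wc su _ su') => W' e oW' sW he.
have W'c : W' `<=` mdom c by move=> y /sW/Wc.
have su1 := hsmooth_sub oW' sW su'; move: u' su1 {su'}.
apply: (fsum_ind hm (Q := fun u => forall u', hsmooth W' u' -> ip_parallel c v W' u u') oW') he.
- by move=> t _; exact: (ip_parallel0l oW' W'c).
- move=> t st; apply: (ip_parallel_sym oW' W'c st (hsmooth_vac rho vac oW')).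
  exact: ip_parallel_vac_all.
- by move=> p q sp sq hp hq t st; exact: (ip_parallelD oW' W'c sp sq (hp t st) (hq t st)).
- by move=> f p sf sp hp t st; exact: (ip_parallelZ oW' W'c sf sp (hp t st)).
- move=> z p sz sp hp t st; apply: (ip_parallel_rho oW' W'c sz sp st); apply: hp.
  apply: (hsmoothZ oW' (smooth_fun_cst W' 'i)).
  exact: (hsmooth_rho hm oW' (pconj_smooth oW' sz.1) st).
Qed.

End FockCurvature.

(** * Exterior powers *)
Section Wedge.
Context {K : comNzRingType} {M : lmodType K} {g : nat}.
Implicit Types (a : 'I_g -> M) (i j : 'I_g) (y z : M) (k : K).

Definition upd (T : Type) (a : 'I_g -> T) i (y : T) : 'I_g -> T :=
  fun j => if j == i then y else a j.

Lemma wedge_linear a i k y z :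
  wedge (upd a i (k *: y + z)) = k *: wedge (upd a i y) + wedge (upd a i z).
Proof.
have h b : finfun (upd a i b) = tup_set (finfun a) i b.
  by apply/ffunP => j; rewrite !ffunE /upd; case: eqP.
rewrite /wedge !h.
set p := mkmalgU _ _; set q := mkmalgU _ _; set s := mkmalgU _ _.
have e : lspan (@extpow_rel K M g) (p - (k *: q + s)).
  move=> P [P0 PP] Q; apply: Q; rewrite opprD addrA; exact: ExtLinear.
have -> : \pi_(lquot (@extpow_rel K M g)) p = \pi_(lquot (@extpow_rel K M g)) (k *: q + s).
  exact/lquot_eqP.
rewrite lquot_piD lquot_piZ; reflexivity.
Qed.

Lemma wedge_alt a i j : i != j -> a i = a j -> wedge a = 0.
Proof.
move=> ij e; rewrite /wedge.
have -> : (0 : extpow M g) = \pi_(lquot (@extpow_rel K M g)) 0 by [].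
apply/lquot_eqP => P _ Q; apply: Q; rewrite subr0.
by apply: (@ExtAlternating _ _ _ (finfun a) i j ij); rewrite !ffunE.
Qed.

End Wedge.

(** * Alternating maps and the trace *)
Section Alternating.
Context {K : fieldType} {H : vectType K} {E : lmodType K} {g : nat}.
Context (om : ('I_g -> H) -> E).
Hypothesis om_linear : forall a i k y z,
  om (upd a i (k *: y + z)) = k *: om (upd a i y) + om (upd a i z).
Hypothesis om_alt : forall a i j, i != j -> a i = a j -> om a = 0.
Implicit Types (a : 'I_g -> H) (i j : 'I_g) (y z : H).

Lemma upd_id a i : upd a i (a i) = a.
Proof. by apply: functional_extensionality_dep => j; rewrite /upd; case: eqP => [->|]. Qed.

Lemma updC a i j y z : i != j -> upd (upd a i y) j z = upd (upd a j z) i y.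
Proof.
move=> ij; apply: functional_extensionality_dep => l; rewrite /upd.
by case: (eqVneq l j) => // ->; rewrite eq_sym (negbTE ij).
Qed.

Lemma upd_upd a i y z : upd (upd a i y) i z = upd a i z.
Proof. by apply: functional_extensionality_dep => l; rewrite /upd; case: eqP. Qed.

Lemma upd_same a i y : upd a i y i = y.
Proof. by rewrite /upd eqxx. Qed.

Lemma upd_other a i j y : j != i -> upd a i y j = a j.
Proof. by rewrite /upd => /negbTE->. Qed.

Lemma om_D a i y z : om (upd a i (y + z)) = om (upd a i y) + om (upd a i z).
Proof. by have := om_linear a i 1 y z; rewrite !scale1r. Qed.

Lemma om_0 a i : om (upd a i 0) = 0.
Proof. by have := om_linear a i (-1) 0 0; rewrite scaler0 addr0 scaleN1r addNr. Qed.

Lemma om_sum a i (I : Type) (q : seq I) (c : I -> K) (h : I -> H) :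
  om (upd a i (\sum_(j <- q) c j *: h j)) = \sum_(j <- q) c j *: om (upd a i (h j)).
Proof.
elim: q => [|j q IH]; first by rewrite !big_nil om_0.
by rewrite !big_cons om_linear IH.
Qed.

(** Antisymmetry, from alternation on [y + z]. *)
Lemma om_swap a i j y z : i != j ->
  om (upd (upd a i y) j z) + om (upd (upd a i z) j y) = 0.
Proof.
move=> ij; have ji : j != i by rewrite eq_sym.
have d x : om (upd (upd a i x) j x) = 0.
  by apply: (om_alt ij); rewrite /upd !eqxx (negbTE ij).
have dD x : om (upd (upd a i (y + z)) j x) = om (upd (upd a i y) j x) + om (upd (upd a i z) j x).
  by rewrite !(updC _ _ _ ij) om_D.
by have := d (y + z); rewrite om_D !dD !d add0r addr0 addrC.
Qed.

(** The derivation of the exterior algebra induced by [T]. *)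
Definition om_der (T : H -> H) a : E := \sum_i om (upd a i (T (a i))).

Lemma om_der_frame (T : H -> H) a (m : 'I_g -> 'I_g -> K) :
  (forall i, T (a i) = \sum_j m i j *: a j) -> om_der T a = (\sum_i m i i) *: om a.
Proof.
move=> h; rewrite /om_der scaler_suml; apply: eq_bigr => i _.
rewrite h om_sum (bigD1 i) //= upd_id big1 ?addr0 // => j ji.
by rewrite (@om_alt _ i j) ?scaler0 // 1?eq_sym // /upd eqxx (negbTE ji).
Qed.

Context (T : H -> H).
Hypothesis T_linear : forall k y z, T (k *: y + z) = k *: T y + T z.

(** The two terms in which [T] hits one of the equal arguments cancel. *)
Lemma om_der_alt a i j : i != j -> a i = a j -> om_der T a = 0.
Proof.
move=> ij e; rewrite /om_der (bigD1 i) //= (bigD1 j) 1?eq_sym //= big1 ?addr0.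
  have := om_swap a (T (a i)) (a i) ij.
  have -> : upd (upd a i (T (a i))) j (a i) = upd a i (T (a i)).
    apply: functional_extensionality_dep => l; rewrite /upd.
    by case: (eqVneq l j) => // ->; rewrite eq_sym (negbTE ij) e.
  by rewrite upd_id e.
move=> l /andP[li lj]; apply: (om_alt ij).
by rewrite /upd ![_ == l]eq_sym (negbTE li) (negbTE lj).
Qed.

Lemma om_der_linear a i k y z :
  om_der T (upd a i (k *: y + z)) = k *: om_der T (upd a i y) + om_der T (upd a i z).
Proof.
have h x : om_der T (upd a i x) =
    om (upd a i (T x)) + \sum_(j | j != i) om (upd (upd a j (T (a j))) i x).
  rewrite /om_der (bigD1 i) //= upd_same upd_upd; congr (_ + _).
  apply: eq_bigr => j ji; rewrite (upd_other _ _ ji) updC //.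
  by rewrite eq_sym.
rewrite !h T_linear om_linear scalerDr addrACA; congr (_ + _).
rewrite scaler_sumr -big_split; apply: eq_bigr => j _ /=.
exact: om_linear.
Qed.

End Alternating.

Section Dependent.
Context {K : fieldType} {H : vectType K} {E : lmodType K} {g : nat}.
Context (om : ('I_g -> H) -> E).
Hypothesis om_linear : forall a i k y z,
  om (upd a i (k *: y + z)) = k *: om (upd a i y) + om (upd a i z).
Hypothesis om_alt : forall a i j, i != j -> a i = a j -> om a = 0.

Lemma alternating_dependent (a : 'I_g -> H) (c : 'I_g -> K) i :
  \sum_j c j *: a j = 0 -> c i != 0 -> om a = 0.
Proof.
move=> e ci; have := om_0 om_linear a i; rewrite -e (om_sum om_linear).
rewrite (bigD1 i) //= upd_id big1 ?addr0 => [/eqP|j ji].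
  by rewrite scaler_eq0 (negbTE ci) => /eqP.
by rewrite (@om_alt _ i j) ?scaler0 // 1?eq_sym // /upd eqxx (negbTE ji).
Qed.

End Dependent.

(** * The determinant line *)
Section DetFiber.
Context {R : realType} {n : nat} {S : cmanifold R n} {r g : nat}.
Context (V : pvhs S r g) (x : S).
Local Notation C := (R[i]).
Local Notation H := (vfib (pbun V) x).
Local Notation form := (pform V x).
Local Notation F := (pF V x).
Implicit Types (p q : 'I_g -> H) (T : H -> H).

Definition wedge_fib p : detF V x := wedge (fun i => vsproj F (p i)).

Lemma vsproj_upd p i y : (fun j => vsproj F (upd p i y j)) = upd (fun j => vsproj F (p j)) i (vsproj F y).
Proof. by apply: functional_extensionality_dep => j; rewrite /upd; case: eqP. Qed.

Lemma wedge_fib_linear p i k y z : wedge_fib (upd p i (k *: y + z)) =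
  k *: wedge_fib (upd p i y) + wedge_fib (upd p i z).
Proof. by rewrite /wedge_fib !vsproj_upd linearP wedge_linear. Qed.

Lemma wedge_fib_alt p i j : i != j -> p i = p j -> wedge_fib p = 0.
Proof. by move=> ij e; apply: (wedge_alt ij); rewrite e. Qed.

Lemma dependent_or_basis p : (forall i, p i \in F) ->
  (exists c i, \sum_j c j *: p j = 0 /\ c i != 0) \/
  basis_of F [seq p i | i <- enum 'I_g].
Proof.
move=> pF; set X := [seq p i | i <- enum 'I_g].
have sX : size X = g by rewrite size_map size_enum_ord.
have dF : \dim F = g.
  have [W [_ Wx [e [m [_ _ _ _ /(_ x Wx) bf]]]]] := pF_holomorphic V x.
  by rewrite (size_basis bf) card_ord.
have [fr|fr] := boolP (free X).
  right; rewrite basisEfree fr /= sX dF leqnn andbT.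
  by apply/span_subvP => y /mapP[j _ ->].
left; apply/not_existsP => N; move/negP: fr; apply.
apply/(freeP (X := in_tuple X)) => k k0 i.
apply/eqP/negPn/negP => ki.
apply: (N (fun j => k (cast_ord (esym sX) j))).
exists (cast_ord sX i); split; last by rewrite cast_ordK.
rewrite -[RHS]k0 [RHS](reindex (cast_ord (esym sX))); last first.
  by exists (cast_ord sX) => j _; [exact: cast_ordKV|exact: cast_ordK].
apply: eq_bigr => j _; congr (_ *: _).
by rewrite (nth_map j) ?size_enum_ord //= nth_ord_enum.
Qed.

(** Both sides are alternating and multilinear, so that it is enough to compare
    them on bases; on a basis the left side only sees the diagonal of [T]. *)
Lemma wedge_trace T p : (forall a, a \in F -> T a \in F) ->
  (forall k a b, T (k *: a + b) = k *: T a + T b) -> (forall i, p i \in F) ->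
  \sum_i wedge_fib (upd p i (T (p i))) = trace_on F T *: wedge_fib p.
Proof.
move=> TF Tl pF.
have [[c [i [e ci]]]|bp] := dependent_or_basis pF.
  rewrite (alternating_dependent wedge_fib_linear wedge_fib_alt e ci) scaler0.
  apply: (alternating_dependent (om := om_der wedge_fib T) _ _ e ci).
    exact (@om_der_linear _ _ _ _ _ wedge_fib_linear _ Tl).
  exact (@om_der_alt _ _ _ _ _ wedge_fib_linear wedge_fib_alt _).
have df := dual_frameP bp.
rewrite (trace_on_frames df TF (fun k a c _ _ => Tl k a c)).
apply: (om_der_frame wedge_fib_linear wedge_fib_alt
  (m := fun i j => form (T (p i)) (dual_frame p j))) => i.
exact: (df_F df (TF _ (pF i))).
Qed.

End DetFiber.

Section DetBundle.
Context {R : realType} {n : nat} {S : cmanifold R n} {r g : nat}.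
Context (V : pvhs S r g).
Local Notation C := (R[i]).
Local Notation Cn := (Cn R n).
Local Notation H := (vfib (pbun V)).
Local Notation F := (pF V).
Local Notation Fb := (Fbar V).
Local Notation nabla := (pnabla V).
Local Notation pr := (projF (V := V)).
Local Notation prb := (projFbar (V := V)).
Local Notation smooth := (@smooth_det R n S r g V).
Implicit Types (W : set S) (v w : Cn) (f : S -> C) (x : S) (c : mchart S)
  (a : 'I_g -> forall x, H x) (u : forall x, detF V x)
  (e : seq ((S -> C) * ('I_g -> forall x, H x))).

Local Opaque pderiv projF projFbar.

Definition good_columns W a := forall i, smooth_in F W (a i).

Lemma good_columns_sub W W' a : W' `<=` W -> good_columns W a -> good_columns W' a.
Proof. by move=> sW h i; exact: smooth_in_sub (h i). Qed.

Lemma wedgeFE a x : wedgeF a x = wedge_fib (fun i => a i x).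
Proof. by []. Qed.

Lemma smooth_det_sub W W' u : open W' -> W' `<=` W -> smooth W u -> smooth W' u.
Proof. exact: (local_comb_sub (gen := @wedgeF _ _ _ _ _ V) good_columns_sub). Qed.

Lemma smooth_detD W u u' : open W -> smooth W u -> smooth W u' ->
  smooth W (fun x => u x + u' x).
Proof. exact: (local_combD (gen := @wedgeF _ _ _ _ _ V) good_columns_sub). Qed.

Lemma smooth_detZ W f u : open W -> smooth_fun W f -> smooth W u ->
  smooth W (fun x => f x *: u x).
Proof. exact: (local_combZ (gen := @wedgeF _ _ _ _ _ V) (good := good_columns)). Qed.

Lemma smooth_det0 W : open W -> smooth W (fun x => 0).
Proof. exact: (local_comb0 (@wedgeF _ _ _ _ _ V) good_columns). Qed.

Lemma smooth_det_wedge W a : open W -> good_columns W a -> smooth W (wedgeF a).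
Proof. exact: (local_comb_gen (@wedgeF _ _ _ _ _ V) (good := good_columns)). Qed.

End DetBundle.

Arguments smooth_detD {R n S r g V W u u'} _ _ _.
Arguments smooth_detZ {R n S r g V W f u} _ _ _.
Arguments smooth_det0 {R n S r g V W} _.
Arguments smooth_det_sub {R n S r g V W W' u} _ _ _.
Arguments smooth_det_wedge {R n S r g V W a} _ _.

Section DetCurvature.
Context {R : realType} {n : nat} {S : cmanifold R n} {r g : nat}.
Context (V : pvhs S r g).
Local Notation C := (R[i]).
Local Notation Cn := (Cn R n).
Local Notation H := (vfib (pbun V)).
Local Notation F := (pF V).
Local Notation Fb := (Fbar V).
Local Notation nabla := (pnabla V).
Local Notation nF := (nablaF (V := V)).
Local Notation pr := (projF (V := V)).
Local Notation prb := (projFbar (V := V)).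
Local Notation smooth := (@smooth_det R n S r g V).
Context (c : mchart S).
Implicit Types (W : set S) (v w : Cn) (f : S -> C) (x : S)
  (a : 'I_g -> forall x, H x) (u : forall x, detF V x).

Local Opaque pderiv projF projFbar.

Lemma nablaF_smooth v W (s : forall x, H x) : open W -> W `<=` mdom c ->
  smooth_in F W s -> smooth_in F W (nF c v s).
Proof.
by move=> oW Wc hs; exact (smooth_projF oW (nabla_smooth v oW Wc hs.1)).
Qed.

(** The Gauss equation of the subbundle [F]: split the inner derivative into its
    components in [F] and in the conjugate of [F]. *)
Lemma nablaF2 v w W (s : forall x, H x) x : open W -> W `<=` mdom c ->
  smooth_in F W s -> W x ->
  nF c v (nF c w s) x =
    pr (nabla c v (nabla c w s) x) - sigmabar c v (sigma c w (s x)).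
Proof.
move=> oW Wc hs Wx; have sw := nabla_smooth w oW Wc hs.1.
have h1 := smooth_projF oW sw; have h2 := smooth_projFbar oW sw.
rewrite (sigmaE w oW Wc hs Wx) (sigmabarE v oW Wc h2 Wx).
have -> : nabla c v (nabla c w s) x =
    nabla c v (nF c w s) x + nabla c v (fun y => prb (nabla c w s y)) x.
  rewrite -(nablaD v oW Wc h1.1 h2.1 Wx).
  by congr (nabla c v _ x); apply: functional_extensionality_dep => y; rewrite projF_add.
have := projF_linear 1 (nabla c v (nF c w s) x) (nabla c v (fun y => prb (nabla c w s y)) x).
by rewrite !scale1r => ->; rewrite addrK.
Qed.

Definition curv_F v w x (b : H x) : H x :=
  - (sigmabar c v (sigma c w (pr b)) - sigmabar c w (sigma c v (pr b))).

Lemma nablaF_curv v w W (s : forall x, H x) x : open W -> W `<=` mdom c ->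
  smooth_in F W s -> W x ->
  nF c v (nF c w s) x - nF c w (nF c v s) x = curv_F v w (s x).
Proof.
move=> oW Wc hs Wx; rewrite (nablaF2 v w oW Wc hs Wx) (nablaF2 w v oW Wc hs Wx).
have fl := pnabla_flat v w oW Wc hs.1 Wx; rewrite scale0r in fl.
have -> : nabla c v (nabla c w s) x = nabla c w (nabla c v s) x.
  by apply/eqP; rewrite -subr_eq0; apply/eqP.
rewrite /curv_F (projF_F (hs.2 x Wx)).
have ac (M : zmodType) (p q q' : M) : p - q - (p - q') = - (q - q').
  by rewrite !opprD !opprK addrACA subrr add0r.
exact: ac.
Qed.

Lemma curv_F_mem v w x (b : H x) : mdom c x -> b \in F x -> curv_F v w b \in F x.
Proof.
move=> cx bF; rewrite memvN; apply: memvB; apply: (sigmabar_mem _ cx);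
  by apply: (sigma_mem _ cx); exact: projF_mem.
Qed.

Lemma curv_F_linear v w x k (a b : H x) : mdom c x ->
  curv_F v w (k *: a + b) = k *: curv_F v w a + curv_F v w b.
Proof.
move=> cx; have pa := projF_mem a; have pb := projF_mem b.
have sa := sigma_mem _ cx pa; have sb := sigma_mem _ cx pb.
rewrite /curv_F projF_linear !(sigma_linear _ _ cx pa pb).
rewrite !(sigmabar_linear _ _ cx (sa _) (sb _)).
rewrite scalerN scalerBr -opprD; congr (- _).
by rewrite opprD addrACA.
Qed.

Lemma trace_curv_F v w x : mdom c x ->
  trace_on (F x) (curv_F v w (x := x)) = - trace_sigmabar_sigma V c v w x.
Proof.
move=> cx; have [f [b df]] := exists_dual_frames V x.
rewrite (trace_on_frames df (fun d => @curv_F_mem v w x d cx)); last first.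
  by move=> k a d _ _; exact: curv_F_linear.
rewrite /trace_sigmabar_sigma (trace_on_frames df).
- rewrite -sumrN; apply: eq_bigr => j _.
  by rewrite /curv_F (projF_F (df_memF df j)) formNl.
- by move=> a aF; apply: memvB; apply: (sigmabar_mem _ cx); exact: (sigma_mem _ cx).
- move=> k a d aF dF.
  have sa := sigma_mem _ cx aF; have sd := sigma_mem _ cx dF.
  rewrite !(sigma_linear _ _ cx aF dF) !(sigmabar_linear _ _ cx (sa _) (sd _)).
  by rewrite scalerBr opprD addrACA.
Qed.

Context (D : covder (detF V)).
Hypothesis Dconn : is_connection smooth D.
Hypothesis Dwedge : forall v W a, open W -> W `<=` mdom c ->
  (forall i, smooth_in F W (a i)) -> forall x, W x ->
  D c v (wedgeF a) x =
    \sum_(i < g) wedgeF (fun j => if j == i then nF c v (a j) else a j) x.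
Hypothesis pderiv_smooth : forall v W f, open W -> W `<=` mdom c ->
  smooth_fun W f -> smooth_fun W (pderiv c v f).

Definition der1 v a i : 'I_g -> forall x, H x :=
  fun j => if j == i then nF c v (a j) else a j.

Lemma der1_smooth v W a i : open W -> W `<=` mdom c ->
  (forall j, smooth_in F W (a j)) -> forall j, smooth_in F W (der1 v a i j).
Proof.
move=> oW Wc ha j; rewrite /der1; case: (j == i); last exact: ha.
exact: nablaF_smooth.
Qed.

(** Either the second derivative falls on the factor already derived, or on
    another one; the latter terms are symmetric in [v] and [w]. *)
Lemma det_second v w W a x : open W -> W `<=` mdom c ->
  (forall i, smooth_in F W (a i)) -> W x ->
  D c v (D c w (wedgeF a)) x =
  \sum_i wedge_fib (upd (a^~ x) i (nF c v (nF c w (a i)) x)) +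
  \sum_i \sum_(k | k != i)
    wedge_fib (upd (upd (a^~ x) i (nF c w (a i) x)) k (nF c v (a k) x)).
Proof.
move=> oW Wc ha Wx.
have h1 i := der1_smooth w i oW Wc ha.
have s1 i : smooth W (wedgeF (der1 w a i)) := smooth_det_wedge oW (h1 i).
have s2 : smooth W (fun y => \sum_i wedgeF (der1 w a i) y) :=
  smooth_sum (@smooth_detD _ _ _ _ _ _) (@smooth_det0 _ _ _ _ _ _) _ oW s1.
have s3 : smooth W (D c w (wedgeF a)) :=
  conn_smooth Dconn w oW Wc (smooth_det_wedge oW ha).
have e := conn_local Dconn v oW Wc s3 s2 (Dwedge w oW Wc ha) Wx.
rewrite e (conn_sum Dconn (@smooth_detD _ _ _ _ _ _) (@smooth_det0 _ _ _ _ _ _)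
  v _ oW Wc s1 Wx) -big_split; apply: eq_bigr => i _ /=.
have eI : wedgeF (der1 v (der1 w a i) i) x =
    wedge_fib (upd (a^~ x) i (nF c v (nF c w (a i)) x)).
  apply: (congr1 (@wedge_fib _ _ _ _ _ V x)); apply: functional_extensionality_dep => j.
  by rewrite /upd /der1; case: (eqVneq j i) => [->|].
have eK k : k != i -> wedgeF (der1 v (der1 w a i) k) x =
    wedge_fib (upd (upd (a^~ x) i (nF c w (a i) x)) k (nF c v (a k) x)).
  move=> ki; apply: (congr1 (@wedge_fib _ _ _ _ _ V x)).
  apply: functional_extensionality_dep => j; rewrite /upd /der1.
  case: (eqVneq j k) => [->|jk]; first by rewrite (negbTE ki).
  by case: eqP => // ->.
rewrite (Dwedge v oW Wc (h1 i) Wx) (bigD1 i isT).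
exact (congr2 +%R eI (eq_bigr _ eK)).
Qed.

Lemma det_curv_wedge v w W a x : open W -> W `<=` mdom c ->
  (forall i, smooth_in F W (a i)) -> W x ->
  curv D c v w (wedgeF a) x = - trace_sigmabar_sigma V c v w x *: wedgeF a x.
Proof.
move=> oW Wc ha Wx; have cx := Wc x Wx.
rewrite /curv (det_second v w oW Wc ha Wx) (det_second w v oW Wc ha Wx).
set A := \sum_i wedge_fib _; set A' := \sum_i wedge_fib _.
set B := \sum_i _; set B' := \sum_i _.
have -> : B = B'.
  rewrite /B /B' (exchange_big_dep xpredT) //=; apply: eq_bigr => k _.
  by apply: eq_big => [i|i ki]; [rewrite eq_sym|rewrite updC // eq_sym].
have ac (M : zmodType) (p q s : M) : p + s - (q + s) = p - q.
  by rewrite opprD addrACA subrr addr0.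
rewrite ac /A /A' -sumrB.
rewrite -(trace_curv_F v w cx) wedgeFE -wedge_trace.
- apply: eq_bigr => i _; rewrite -(nablaF_curv v w oW Wc (ha i) Wx).
  have := wedge_fib_linear (V := V) (a^~ x) i (-1) (nF c w (nF c v (a i)) x)
    (nF c v (nF c w (a i)) x).
  by rewrite !scaleN1r ![- _ + _]addrC => ->.
- by move=> b; exact: curv_F_mem.
- by move=> k b d; exact: curv_F_linear.
- by move=> i; exact: (ha i).2.
Qed.

Lemma det_curvature v w W u x : open W -> W `<=` mdom c -> smooth W u -> W x ->
  D c v (D c w u) x - D c w (D c v u) x = - trace_sigmabar_sigma V c v w x *: u x.
Proof.
move=> oW Wc hu Wx.
have [W1 [e1 [ o1 x1 s1 d1 u1]]] := hu x Wx.
have W1c : W1 `<=` mdom c by move=> y /s1/Wc.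
have hu1 := smooth_det_sub o1 s1 hu.
have csm e : comb_data (@good_columns _ _ _ _ _ V) W1 e ->
    smooth W1 (comb (@wedgeF _ _ _ _ _ V) e) by exact: local_comb_comb.
have {}d1 : comb_data (@good_columns _ _ _ _ _ V) W1 e1 := d1.
have hf1 := csm e1 d1.
have e0 := curv_local Dconn v w o1 W1c hu1 hf1 u1 x1.
rewrite -[LHS]/(curv D c v w u x) e0 u1 // -[X in _ *: X]/(comb (@wedgeF _ _ _ _ _ V) e1 x).
elim: e1 d1 {u1 e0 hf1} => [|p e IH] d1.
  have -> : comb (@wedgeF _ _ _ _ _ V) [::] = fun y => 0 :> detF V y.
    by apply: functional_extensionality_dep => y; exact: big_nil.
  rewrite scaler0.
  exact (curv0 Dconn (@smooth_detD _ _ _ _ _ _) (@smooth_det0 _ _ _ _ _ _) v w o1 W1c x1).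
have [h1 h2 h3] := comb_data_cons d1.
have -> : comb (@wedgeF _ _ _ _ _ V) (p :: e) = fun y => p.1 y *: wedgeF p.2 y + comb (@wedgeF _ _ _ _ _ V) e y.
  by apply: functional_extensionality_dep => y; exact: big_cons.
have sw := smooth_det_wedge o1 h2.
rewrite (curvD Dconn (@smooth_detD _ _ _ _ _ _) v w o1 W1c (smooth_detZ o1 h1 sw)
  (csm e h3) x1).
rewrite (curvZ Dconn (@smooth_detD _ _ _ _ _ _) (@smooth_detZ _ _ _ _ _ _)
  pderiv_smooth v w o1 W1c h1 sw x1).
rewrite (IH h3) (det_curv_wedge v w o1 W1c h2 x1).
have ab (M : lmodType C) (k l : C) (y z : M) : k *: (l *: y) + l *: z = l *: (k *: y + z).
  by rewrite scalerDr !scalerA mulrC.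
exact (ab _ _ _ _ _).
Qed.

End DetCurvature.

(** * The bundle of Fock spaces *)
Section FockInstance.
Context {R : realType} {n : nat} {S : cmanifold R n} {r g : nat}.
Context (V : pvhs S r g).

Lemma fock_heisenberg x :
  heisenberg_module (V := V) (x := x) (@rho R n S r g V x) (vac V x).
Proof.
split.
- by move=> a k u v; exact: fock_rho_linear.
- by move=> u k a b; exact: fock_rho_linearl.
- by move=> a b u; exact: (fock_rho_comm (fun a => form0l a)).
- by move=> a aF; exact: fock_rho_vac.
Qed.

Lemma fock_inner_form (ip : forall x : S, Fock V x -> Fock V x -> R[i]) :
  is_fock_inner_product ip ->
  forall x, fock_form (V := V) (x := x) (@rho R n S r g V x) (vac V x) (ip x).
Proof.
move=> h x; split.
- exact: (fip_linear h).
- exact: (fip_antilinear h).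
- exact: (fip_sym h).
- exact: (fip_orth h).
Qed.

End FockInstance.

Theorem theorem3p1 (R : realType) (n r g : nat) (S : cmanifold R n)
    (V : pvhs S r g)
    (ip : forall x : S, Fock V x -> Fock V x -> R[i]%C)
    (nablaSym : covder (Fock V))
    (nablaDet : covder (detF V)) :
  is_fock_inner_product ip ->
  is_sym_connection nablaSym ->
  is_det_connection nablaDet ->
  let nabla := nablaFock nablaSym in
  let omega := fun c v w x => - 2^-1 * trace_sigmabar_sigma V c v w x in
  [/\ is_connection (@smooth_Fock _ _ _ _ _ V) nabla,
      unitary (@smooth_Fock _ _ _ _ _ V) ip nabla,
      scalar_curvature (@smooth_Fock _ _ _ _ _ V) nabla omega,
      exists Theta, scalar_curvature (@smooth_det _ _ _ _ _ V) nablaDet Theta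
        /\ (forall c v w x, mdom c x -> omega c v w x = 2^-1 * Theta c v w x)
    & projectively_flat (@smooth_Fock _ _ _ _ _ V) nabla].
Proof.
move=> ipP symP detP nab omega.
have hm := fock_heisenberg V; have ff := fock_inner_form ipP.
have sc : is_connection (hsmooth (@rho R n S r g V) (vac V)) nablaSym := symc_conn symP.
have Nc : is_connection (hsmooth (@rho R n S r g V) (vac V)) nab :=
  fock_nabla_conn hm sc.
have Nr c v W a u x := @fock_nabla_rho _ _ _ _ _ V _ _ _ hm nablaSym sc
  (symc_vac symP) (symc_mul symP) c v W a u x.
have Nv c v x : mdom c x -> nab c v (vac V) x = conn_op (@rho R n S r g V x) c v (vac V x).
  by move=> cx; rewrite /nab /nablaFock (symc_vac symP v cx) add0r.
have curvN : scalar_curvature (@smooth_Fock _ _ _ _ _ V) nab omega :=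
  fock_curvature hm ff Nc Nr Nv.
split.
- exact Nc.
- exact (fock_unitary hm ff Nc Nr Nv).
- exact curvN.
- exists (fun c v w x => - trace_sigmabar_sigma V c v w x); split.
    move=> c v w W u oW Wc hu x Wx.
    exact (det_curvature (detc_conn detP) (detc_wedge detP (c := c))
      (@pderiv_smooth _ _ _ _ _ V _ _ _ ip hm ff nab Nc c) v w oW Wc hu Wx).
  by move=> c v w x _; rewrite /omega mulNr mulrN.
- by exists omega.
Qed.
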